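(* Assume the Exponential-Time Hypothesis (ETH) holds. Then there is no algorithm solving \textsc{Subset Sum with Multiplicities} in time $2^{o(n)}$, even when restricted to instances whose target satisfies $t \le 2^{\mathcal{O}(n)}$, where $n$ denotes the cardinality of the set given on input.
   Context: \textsc{Subset Sum with Multiplicities}: given a set of positive integers $\{a_1,\dots,a_n\}$ and a positive integer $t$ (encoded in binary), decide whether there exist nonnegative integers $\lambda_1,\dots,\lambda_n$ with $\sum_{i=1}^n \lambda_i a_i = t$. The Exponential-Time Hypothesis (ETH) states that there is a constant $c>0$ such that \textsc{3-SAT} with $n$ variables cannot be solved in time $\mathcal{O}(2^{cn})$. *)

(* Defs.v *)
From Stdlib Require Import Reals List Arith Lia NArith.
Import ListNotations.
Open Scope R_scope.

Inductive sym := Blank | Zero | One | Sep.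
Inductive move := MLeft | MRight | MStay.
Inductive action := Halt (accept : bool) | Step (q : nat) (w : sym) (d : move).

(* states are 0 .. nstates-1, start state 0; delta must stay in the state set *)
Record TM := {
  nstates : nat;
  delta : nat -> sym -> action;
  start_lt : (0 < nstates)%nat;
  delta_closed : forall q s q' w d,
      (q < nstates)%nat -> delta q s = Step q' w d -> (q' < nstates)%nat
}.

(* configuration: state, tape left of head (reversed), symbol under head,
   tape right of head; the tape is two-way infinite, blank outside. *)
Definition config : Type := (nat * list sym * sym * list sym)%type.

Definition init_config (w : list sym) : config :=
  match w with
  | [] => (0%nat, [], Blank, [])
  | x :: r => (0%nat, [], x, r)
  end.

Definition do_move (q : nat) (l : list sym) (w : sym) (r : list sym) (d : move)
  : config :=
  match d with
  | MStay => (q, l, w, r)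
  | MLeft => match l with
             | [] => (q, [], Blank, w :: r)
             | x :: l' => (q, l', x, w :: r)
             end
  | MRight => match r with
              | [] => (q, w :: l, Blank, [])
              | x :: r' => (q, w :: l, x, r')
              end
  end.

(* [run M fuel c = Some b] iff M, started in c, halts within [fuel] steps
   (the halting step counts as one step) with answer b. *)
Fixpoint run (M : TM) (fuel : nat) (c : config) : option bool :=
  match fuel with
  | O => None
  | S f =>
      let '(q, l, x, r) := c in
      match delta M q x with
      | Halt b => Some b
      | Step q' w d => run M f (do_move q' l w r d)
      end
  end.

Definition decides_within {X : Type} (M : TM) (enc : X -> list sym)
  (valid : X -> Prop) (P : X -> Prop) (T : X -> R) : Prop :=
  forall x, valid x ->
    exists (s : nat) (b : bool),
      INR s <= T x /\ run M s (init_config (enc x)) = Some b /\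
      (b = true <-> P x).

Fixpoint pos_bits (p : positive) : list sym :=
  match p with
  | xH => [One]
  | xO p' => Zero :: pos_bits p'
  | xI p' => One :: pos_bits p'
  end.

Definition enc_nat (n : nat) : list sym :=
  match N.of_nat n with
  | N0 => []
  | Npos p => pos_bits p
  end.

(* A literal is (polarity, variable index); an instance is the number n of
   variables together with a list of clauses. *)
Definition literal : Type := (bool * nat)%type.
Definition sat_instance : Type := (nat * list (list literal))%type.

Definition sat_nvars (F : sat_instance) : nat := fst F.

Definition valid_3sat (F : sat_instance) : Prop :=
  Forall (fun cl => (length cl <= 3)%nat /\
                    Forall (fun l : literal => (snd l < fst F)%nat) cl) (snd F).

Definition satisfiable (F : sat_instance) : Prop :=
  exists asg : nat -> bool,
    Forall (fun cl => exists l : literal, In l cl /\ asg (snd l) = fst l) (snd F).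

Definition enc_literal (l : literal) : list sym :=
  (if fst l then One else Zero) :: enc_nat (snd l) ++ [Sep].

Definition enc_clause (cl : list literal) : list sym :=
  concat (map enc_literal cl) ++ [Sep].

Definition enc_sat (F : sat_instance) : list sym :=
  enc_nat (fst F) ++ [Sep] ++ concat (map enc_clause (snd F)).

Definition ETH : Prop :=
  exists c : R, 0 < c /\
    forall (M : TM) (C : R) (k : nat),
      ~ decides_within M enc_sat valid_3sat satisfiable
          (fun F => C * Rpower 2 (c * INR (sat_nvars F))
                    * (INR (length (enc_sat F)) + 1) ^ k).

(* instance: the list [a_1; ...; a_n] (the set, so entries pairwise distinct
   and positive) and the target t > 0. *)
Definition ssm_instance : Type := (list nat * nat)%type.

Definition ssm_n (I : ssm_instance) : nat := length (fst I).

Definition valid_ssm (I : ssm_instance) : Prop :=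
  NoDup (fst I) /\ Forall (fun a => (0 < a)%nat) (fst I) /\ (0 < snd I)%nat.

Definition ssm_yes (I : ssm_instance) : Prop :=
  exists lam : nat -> nat,
    list_sum (map (fun i => lam i * nth i (fst I) 0)%nat
                  (seq 0 (length (fst I)))) = snd I.

Definition enc_ssm (I : ssm_instance) : list sym :=
  concat (map (fun a => enc_nat a ++ [Sep]) (fst I)) ++ enc_nat (snd I).

Definition little_o_n (f : nat -> R) : Prop :=
  forall eps : R, 0 < eps ->
    exists N : nat, forall n : nat, (N <= n)%nat -> f n <= eps * INR n.

(* Main.v *)
(** Suppose a machine decides Subset Sum with Multiplicities in time 2^o(n).  The sparsification
    lemma writes a 3-CNF on n variables as a disjunction of 2^(eps n) formulas with O(n) clauses
    each: as long as some literal lies in many 2-clauses, some pair of literals in many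
    3-clauses, or some literal in many 3-clauses, branch on whether this common part (the heart)
    or all the remainders of these clauses (the petals) are satisfied.  Both branches lower a
    potential, linear in n, that pays for new units and new 2-clauses; with thresholds th1, th2
    chosen large the recurrence T(p) <= T(p-1) + T(p - 2 th1^2), respectively
    T(p) <= T(p - 2 th1) + T(p - th2), has growth rate arbitrarily close to 1.

    A formula with v variables and m clauses becomes a Subset Sum instance with numbers of O(v + m)
    octal digits.  There is a group of numbers for each variable (its two literals) and for each
    clause (slack 0, 1, 2).  A number of the i-th of g groups has a 1 in place i of the lowest
    block of digits and a 1 in place g-1-i of the highest block; the target has all ones in both
    blocks.  Going through the places from i = 0 on, the low block forces the multiplicity of group
    i to be 1 modulo 8 and the high block forces it to be at most 1.  Hence exactly one number per
    group is used, no carries occur, and the middle block, with target digits 3, says that each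
    clause has a true literal.  Numbers exceeding the target are added to make t <= 2^n.

    The resulting algorithm for 3-SAT must be run by a single-tape machine.  It is written in
    a language of functions on binary trees, which is compiled to four stacks, and these to one
    tape, with quadratic slowdown. *)

Require Import Defs.
From Stdlib Require Import Reals List Arith Lia ZArith NArith Lra Bool.
Import ListNotations.
Open Scope R_scope.
Local Open Scope nat_scope.

(** * Structured Turing machine programs *)

(** Sparsification is needed because the Subset Sum instance grows linearly with the number of
    clauses, and a 3-CNF can have cubically many. Unrestricted multiplicities defeat the usual digit
    argument, since eight copies of a number yield a carry; hence two blocks of digits in opposite
    order, where the group resolved first in the low block weighs most in the high block.

    The quantitative obstacle is that the hypothetical machine is run inside another one, at a
    polynomial loss whose degree is fixed only when the code is. At the leaves this is harmless:
    o(n) permits every rate [mu], and [mu] is chosen after the degrees are known. For the number of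
    nodes it would be circular, because the code, and with it the degree, depends on the thresholds
    that determine this number. The search is therefore one loop with an iteration per node, so that
    the node count enters linearly and is squared only once, by the passage to one tape. Of the rate
    c in ETH, c/8 goes to the nodes and at most c/8 to the work per node, which makes c/2 after
    squaring. The given time bound may be uncomputable; it appears in the analysis, never in the
    code. *)

Definition tape := Z -> sym.

Definition upd (tp : tape) (h : Z) (a : sym) : tape :=
  fun j => if Z.eqb j h then a else tp j.

Definition dshift (d : move) : Z :=
  match d with MLeft => -1 | MRight => 1 | MStay => 0 end%Z.

Inductive tcmd :=
| TMove (d : move)
| TWrite (a : sym)
| TSeq (c d : tcmd)
| TIf (p : sym -> bool) (c d : tcmd)
| TWhile (p : sym -> bool) (c : tcmd).

(** The last argument counts machine steps exactly: one for a test, one more in the first branch of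
    [TIf] for the jump over the second, one more in each round of [TWhile] for the jump back. *)
Inductive texec : tcmd -> Z -> tape -> Z -> tape -> nat -> Prop :=
| xMove d h tp : texec (TMove d) h tp (h + dshift d)%Z tp 1
| xWrite a h tp : texec (TWrite a) h tp h (upd tp h a) 1
| xSeq c d h tp h1 tp1 h2 tp2 t1 t2 :
    texec c h tp h1 tp1 t1 -> texec d h1 tp1 h2 tp2 t2 ->
    texec (TSeq c d) h tp h2 tp2 (t1 + t2)
| xIfT p c d h tp h1 tp1 t :
    p (tp h) = true -> texec c h tp h1 tp1 t ->
    texec (TIf p c d) h tp h1 tp1 (S t + 1)
| xIfF p c d h tp h1 tp1 t :
    p (tp h) = false -> texec d h tp h1 tp1 t ->
    texec (TIf p c d) h tp h1 tp1 (S t)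
| xWhileT p c h tp h1 tp1 t1 h2 tp2 t2 :
    p (tp h) = true -> texec c h tp h1 tp1 t1 ->
    texec (TWhile p c) h1 tp1 h2 tp2 t2 ->
    texec (TWhile p c) h tp h2 tp2 (S t1 + S t2)
| xWhileF p c h tp :
    p (tp h) = false -> texec (TWhile p c) h tp h tp 1.

Definition instr := sym -> action.

Fixpoint tlen (c : tcmd) : nat :=
  match c with
  | TMove _ | TWrite _ => 1
  | TSeq c d => tlen c + tlen d
  | TIf _ c d => S (tlen c + S (tlen d))
  | TWhile _ c => S (tlen c + 1)
  end.

Definition goto (q : nat) : instr := fun x => Step q x MStay.

(** Addresses are absolute. Code placed at [o] always leaves at [o + tlen c], which makes sequencing
    a mere concatenation. *)
Fixpoint tcomp (c : tcmd) (o : nat) : list instr :=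
  match c with
  | TMove d => [fun x => Step (o + 1) x d]
  | TWrite a => [fun _ => Step (o + 1) a MStay]
  | TSeq c d => tcomp c o ++ tcomp d (o + tlen c)
  | TIf p c d =>
      (fun x => goto (if p x then o + 1 else o + 1 + tlen c + 1) x)
      :: tcomp c (o + 1)
      ++ goto (o + S (tlen c + S (tlen d))) :: tcomp d (o + 1 + tlen c + 1)
  | TWhile p c =>
      (fun x => goto (if p x then o + 1 else o + S (tlen c + 1)) x)
      :: tcomp c (o + 1) ++ [goto o]
  end.

Lemma tcomp_length c : forall o, length (tcomp c o) = tlen c.
Proof.
  induction c; intros; simpl; rewrite ?length_app; simpl;
    rewrite ?IHc, ?IHc1, ?IHc2; lia.
Qed.

(* Jumps out of the code are turned into halts, which makes [delta_closed] hold for any list. *)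
Definition asm_delta (code : list instr) (q : nat) (x : sym) : action :=
  match nth_error code q with
  | Some f =>
      match f x with
      | Step q' w d => if q' <? length code then Step q' w d else Halt false
      | Halt b => Halt b
      end
  | None => Halt false
  end.

Lemma asm_delta_closed code q s q' w d :
  asm_delta code q s = Step q' w d -> q' < length code.
Proof.
  unfold asm_delta. destruct (nth_error code q); [|discriminate].
  destruct (i s); [discriminate|].
  destruct (Nat.ltb_spec q0 (length code)); [|discriminate].
  now intros [= -> -> ->].
Qed.

Definition asm (f : instr) (code : list instr) : TM :=
  {| nstates := length (f :: code);
     delta := asm_delta (f :: code);
     start_lt := Nat.lt_0_succ _;
     delta_closed := fun q s q' w d _ => asm_delta_closed (f :: code) q s q' w d |}.

(** Reading the lists with default [Blank] identifies lists that differ by trailing blanks, so one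
    tape has many representing configurations. *)
Definition cfg (c : config) (q : nat) (h : Z) (tp : tape) : Prop :=
  let '(q0, l, x, r) := c in
  q0 = q /\ x = tp h /\
  (forall i, nth i r Blank = tp (h + 1 + Z.of_nat i)%Z) /\
  (forall i, nth i l Blank = tp (h - 1 - Z.of_nat i)%Z).

Definition reach (M : TM) (n : nat) q h tp q' h' tp' : Prop :=
  forall c, cfg c q h tp ->
    exists c', cfg c' q' h' tp' /\ forall f, run M (n + f) c = run M f c'.

Lemma reach_trans M n1 n2 q h tp q1 h1 tp1 q2 h2 tp2 :
  reach M n1 q h tp q1 h1 tp1 -> reach M n2 q1 h1 tp1 q2 h2 tp2 ->
  reach M (n1 + n2) q h tp q2 h2 tp2.
Proof.
  intros H1 H2 c Hc. destruct (H1 c Hc) as (c1 & Hc1 & E1).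
  destruct (H2 c1 Hc1) as (c2 & Hc2 & E2). exists c2. split; auto.
  intros f. rewrite <- Nat.add_assoc, E1. apply E2.
Qed.

Lemma reach_step M q h tp q' w d tp' :
  delta M q (tp h) = Step q' w d ->
  (forall j, tp' j = if Z.eqb j h then w else tp j) ->
  reach M 1 q h tp q' (h + dshift d)%Z tp'.
Proof.
  intros Hd Htp c Hc. destruct c as [[[q0 l] x] r].
  destruct Hc as (-> & -> & Hr & Hl).
  exists (do_move q' l w r d). split.
  2:{ intros f. simpl. now rewrite Hd. }
  assert (Hw : tp' h = w) by (rewrite Htp, Z.eqb_refl; auto).
  assert (Ho : forall j, j <> h -> tp' j = tp j).
  { intros j Hj. rewrite Htp. destruct (Z.eqb_spec j h); congruence. }
  destruct d; simpl.
  - destruct l as [|y l]; simpl.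
    + repeat split.
      * rewrite Ho by lia. specialize (Hl 0). simpl in Hl. rewrite Hl. f_equal; lia.
      * intros [|i]; simpl. { rewrite <- Hw. f_equal; lia. }
        rewrite Hr, Ho by lia. f_equal; lia.
      * intros i. rewrite Ho by lia. specialize (Hl (S i)). simpl in Hl.
        replace (match i with 0 => Blank | S _ => Blank end) with Blank by now destruct i.
        rewrite Hl. f_equal; lia.
    + repeat split.
      * rewrite Ho by lia. specialize (Hl 0). simpl in Hl. rewrite Hl. f_equal; lia.
      * intros [|i]; simpl. { rewrite <- Hw. f_equal; lia. }
        rewrite Hr, Ho by lia. f_equal; lia.
      * intros i. rewrite Ho by lia. specialize (Hl (S i)). simpl in Hl.
        rewrite Hl. f_equal; lia.
  - destruct r as [|y r]; simpl.
    + repeat split.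
      * rewrite Ho by lia. specialize (Hr 0). simpl in Hr. rewrite Hr. f_equal; lia.
      * intros i. rewrite Ho by lia. specialize (Hr (S i)). simpl in Hr.
        replace (match i with 0 => Blank | S _ => Blank end) with Blank by now destruct i.
        rewrite Hr. f_equal; lia.
      * intros [|i]; simpl. { rewrite <- Hw. f_equal; lia. }
        rewrite Hl, Ho by lia. f_equal; lia.
    + repeat split.
      * rewrite Ho by lia. specialize (Hr 0). simpl in Hr. rewrite Hr. f_equal; lia.
      * intros i. rewrite Ho by lia. specialize (Hr (S i)). simpl in Hr.
        rewrite Hr. f_equal; lia.
      * intros [|i]; simpl. { rewrite <- Hw. f_equal; lia. }
        rewrite Hl, Ho by lia. f_equal; lia.
  - repeat split.
    + rewrite <- Hw. f_equal; lia.
    + intros i. rewrite Hr, Ho by lia. f_equal; lia.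
    + intros i. rewrite Hl, Ho by lia. f_equal; lia.
Qed.

Definition code_at (code : list instr) (o : nat) (l : list instr) : Prop :=
  forall i f, nth_error l i = Some f -> nth_error code (o + i) = Some f.

Lemma code_at_app code o l1 l2 :
  code_at code o (l1 ++ l2) ->
  code_at code o l1 /\ code_at code (o + length l1) l2.
Proof.
  intros H. split; intros i f Hi.
  - apply H. rewrite nth_error_app1; auto.
    apply nth_error_Some. congruence.
  - rewrite <- Nat.add_assoc. apply H.
    rewrite nth_error_app2 by lia.
    now replace (length l1 + i - length l1) with i by lia.
Qed.

Lemma code_at_cons code o f l :
  code_at code o (f :: l) -> nth_error code o = Some f /\ code_at code (o + 1) l.
Proof.
  intros H. split.
  - specialize (H 0 f eq_refl). now rewrite Nat.add_0_r in H.
  - intros i g Hi. rewrite <- Nat.add_assoc. now apply H.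
Qed.

Lemma asm_step (f0 : instr) (code : list instr) (q : nat) (f : instr) h tp q' w d tp' :
  nth_error (f0 :: code) q = Some f -> f (tp h) = Step q' w d ->
  q' < length (f0 :: code) ->
  (forall j, tp' j = if Z.eqb j h then w else tp j) ->
  reach (asm f0 code) 1 q h tp q' (h + dshift d)%Z tp'.
Proof.
  intros H1 H2 H3 H4. eapply reach_step with (w := w); [|exact H4].
  cbn [delta asm]. unfold asm_delta. rewrite H1, H2.
  now apply Nat.ltb_lt in H3 as ->.
Qed.

Lemma asm_goto (f0 : instr) (code : list instr) (q : nat) (f : instr) h tp q' :
  nth_error (f0 :: code) q = Some f -> f (tp h) = Step q' (tp h) MStay ->
  q' < length (f0 :: code) ->
  reach (asm f0 code) 1 q h tp q' h tp.
Proof.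
  intros H1 H2 H3. replace h with (h + dshift MStay)%Z at 2 by (simpl; lia).
  eapply asm_step; eauto.
  intros j. destruct (Z.eqb_spec j h); subst; auto.
Qed.

(** The strict bound on [o + tlen c] makes the exit the address of an instruction; a jump beyond the
    code would be turned into a halt by [asm_delta]. *)
Lemma tcomp_correct c h tp h' tp' t :
  texec c h tp h' tp' t ->
  forall f0 code o, code_at (f0 :: code) o (tcomp c o) ->
    o + tlen c < length (f0 :: code) ->
    reach (asm f0 code) t o h tp (o + tlen c) h' tp'.
Proof.
  induction 1; intros f0 code o Hc Hlt; cbn [tcomp tlen] in *.
  - apply code_at_cons in Hc as [Hc _]. eapply asm_step; eauto.
    intros j. destruct (Z.eqb_spec j h); subst; auto.
  - apply code_at_cons in Hc as [Hc _].
    replace h with (h + dshift MStay)%Z at 2 by (simpl; lia).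
    eapply asm_step; eauto.
  - apply code_at_app in Hc as [Hc1 Hc2]. rewrite tcomp_length in Hc2.
    eapply reach_trans; [apply IHtexec1; auto; lia|].
    rewrite Nat.add_assoc. apply IHtexec2; auto; lia.
  - apply code_at_cons in Hc as [Hc0 Hc].
    apply code_at_app in Hc as [Hc1 Hc2]. rewrite tcomp_length in Hc2.
    apply code_at_cons in Hc2 as [Hc2 _].
    change (S t + 1) with (1 + (t + 1)).
    eapply reach_trans. { eapply asm_goto; [eauto|unfold goto; now rewrite H|lia]. }
    eapply reach_trans. { apply IHtexec; auto; lia. }
    eapply asm_goto; [eauto|reflexivity|lia].
  - apply code_at_cons in Hc as [Hc0 Hc].
    apply code_at_app in Hc as [Hc1 Hc2]. rewrite tcomp_length in Hc2.
    apply code_at_cons in Hc2 as [_ Hc2].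
    change (S t) with (1 + t).
    eapply reach_trans. { eapply asm_goto; [eauto|unfold goto; now rewrite H|lia]. }
    replace (o + S (tlen c + S (tlen d))) with (o + 1 + tlen c + 1 + tlen d) by lia.
    apply IHtexec; auto; lia.
  - pose proof Hc as HcW.
    apply code_at_cons in Hc as [Hc0 Hc].
    apply code_at_app in Hc as [Hc1 Hc2]. rewrite tcomp_length in Hc2.
    apply code_at_cons in Hc2 as [Hc2 _].
    replace (S t1 + S t2) with (1 + (t1 + (1 + t2))) by lia.
    eapply reach_trans. { eapply asm_goto; [eauto|unfold goto; now rewrite H|lia]. }
    eapply reach_trans. { apply IHtexec1; auto; lia. }
    eapply reach_trans. { eapply asm_goto; [eauto|reflexivity|lia]. }
    apply IHtexec2; auto.
  - apply code_at_cons in Hc as [Hc0 Hc].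
    eapply asm_goto; [eauto|unfold goto; now rewrite H|lia].
Qed.

Definition halt_instr : instr :=
  fun x => Halt (match x with One => true | _ => false end).

Definition input_tape (h : Z) (w : list sym) : tape :=
  fun j => if (j <? h)%Z then Blank else nth (Z.to_nat (j - h)) w Blank.

(** A halting instruction is placed behind the code and accounts for the step added in [S t]. The
    position [h] of the input is free because machines only sense relative positions. *)
Lemma tcmd_decider (c : tcmd) :
  exists M : TM, forall h w h' tp' t,
    texec c h (input_tape h w) h' tp' t ->
    run M (S t) (init_config w)
    = Some (match tp' h' with One => true | _ => false end).
Proof.
  pose (code := tcomp c 0 ++ [halt_instr]).
  assert (Hl : length code = S (tlen c)).
  { unfold code. rewrite length_app, tcomp_length. simpl. lia. }
  destruct code as [|f0 code0] eqn:Ecode; [discriminate|].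
  exists (asm f0 code0). intros h w h' tp' t Hx.
  assert (Hcode : code_at (f0 :: code0) 0 (tcomp c 0 ++ [halt_instr])).
  { intros i f Hi. rewrite <- Ecode. exact Hi. }
  apply code_at_app in Hcode as [Hc1 Hc2]. rewrite tcomp_length in Hc2.
  apply code_at_cons in Hc2 as [Hc2 _].
  pose proof (tcomp_correct _ _ _ _ _ _ Hx f0 code0 0 Hc1) as Hr.
  rewrite Hl in Hr. specialize (Hr ltac:(lia)).
  destruct (Hr (init_config w)) as (c' & Hc' & Hrun).
  { unfold input_tape. destruct w as [|x w]; simpl; repeat split; try reflexivity;
      rewrite ?Z.ltb_irrefl, ?Z.sub_diag; simpl; auto;
      intros i;
      repeat match goal with |- context [(?a <? ?b)%Z] => destruct (Z.ltb_spec a b); try lia end;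
      try (now destruct i);
      try (now destruct (Z.to_nat _));
      replace (Z.to_nat (h + 1 + Z.of_nat i - h)) with (S i) by lia; auto; now destruct i. }
  replace (S t) with (t + 1) by lia. rewrite Hrun.
  destruct c' as [[[q l] x] r]. destruct Hc' as (-> & -> & _).
  cbn [run delta asm]. unfold asm_delta. rewrite Hc2. reflexivity.
Qed.

(** * Four stacks on one tape *)

(** [SV] carries the values, [SR] and [ST] are buffers for reversing, copying and parking them, [SC]
    controls the loops. *)
Inductive stk := SV | SR | ST | SC.

Record state := mkst { gV : list sym; gR : list sym; gT : list sym; gC : list sym }.

Definition get (i : stk) (s : state) : list sym :=
  match i with SV => gV s | SR => gR s | ST => gT s | SC => gC s end.

Definition set (i : stk) (l : list sym) (s : state) : state :=
  match i with
  | SV => mkst l (gR s) (gT s) (gC s)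
  | SR => mkst (gV s) l (gT s) (gC s)
  | ST => mkst (gV s) (gR s) l (gC s)
  | SC => mkst (gV s) (gR s) (gT s) l
  end.

Definition idx (i : stk) : nat :=
  match i with SV => 1 | SR => 2 | ST => 3 | SC => 4 end.

Lemma get_set i j l s :
  get i (set j l s) = if Nat.eqb (idx i) (idx j) then l else get i s.
Proof. now destruct i, j. Qed.

Inductive cmd :=
| Skip
| Push (i : stk) (a : sym)
| Seq (c d : cmd)
| Case (i : stk) (cz co cs : cmd)
| Loop (i : stk) (c : cmd).

Definition pick {X : Type} (a : sym) (z o s : X) : X :=
  match a with Zero => z | One => o | _ => s end.

(* Popping an empty stack is stuck. *)
Inductive exec : cmd -> state -> state -> nat -> Prop :=
| eSkip s : exec Skip s s 1
| ePush i a s : a <> Blank -> exec (Push i a) s (set i (a :: get i s) s) 1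
| eSeq c d s s1 s2 t1 t2 :
    exec c s s1 t1 -> exec d s1 s2 t2 -> exec (Seq c d) s s2 (t1 + t2)
| eCase i cz co cs s a l s' t :
    get i s = a :: l -> exec (pick a cz co cs) (set i l s) s' t ->
    exec (Case i cz co cs) s s' (S t)
| eStop i c s a l :
    get i s = a :: l -> a <> One -> exec (Loop i c) s (set i l s) 1
| eLoop i c s l s1 s2 t1 t2 :
    get i s = One :: l -> exec c (set i l s) s1 t1 -> exec (Loop i c) s1 s2 t2 ->
    exec (Loop i c) s s2 (S (t1 + t2)).

(* The home cell 0 is marked [Sep], cell 1 is blank, the input starts at cell 2,
   and entry p (counted from the bottom) of stack i is cell -(5p + idx i). *)
Record rep (s : state) (inp : list sym) (tp : tape) : Prop := {
  rep_home : tp 0%Z = Sep;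
  rep_gap : tp 1%Z = Blank;
  rep_mark : forall p : nat, tp (- (5 * Z.of_nat (S p)))%Z = Blank;
  rep_inp : forall j : nat, tp (2 + Z.of_nat j)%Z = nth j inp Blank;
  rep_stk : forall i (p : nat),
      tp (- (5 * Z.of_nat p + Z.of_nat (idx i)))%Z = nth p (rev (get i s)) Blank;
  rep_nb : forall i, Forall (fun a => a <> Blank) (get i s);
  rep_inb : Forall (fun a => a <> Blank) inp
}.

Definition height (s : state) : nat :=
  length (gV s) + length (gR s) + length (gT s) + length (gC s).

Lemma get_height i s : length (get i s) <= height s.
Proof. unfold height; destruct i; simpl; lia. Qed.

(** Each unit of cost pushes at most one symbol. As every stack operation walks along a stack, this
    is where the quadratic slowdown comes from. *)
Lemma exec_height c s s' t : exec c s s' t -> height s' <= height s + t.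
Proof.
  induction 1; try lia.
  - unfold height; destruct i; simpl; lia.
  - enough (height (set i l s) <= height s) by lia.
    unfold height; destruct i; simpl in *; rewrite H; simpl; lia.
  - unfold height; destruct i; simpl in *; rewrite H; simpl; lia.
  - enough (height (set i l s) <= height s) by lia.
    unfold height; destruct i; simpl in *; rewrite H; simpl; lia.
Qed.

Definition nonblank (x : sym) : bool := match x with Blank => false | _ => true end.
Definition is_sep (x : sym) : bool := match x with Sep => true | _ => false end.
Definition is_one (x : sym) : bool := match x with One => true | _ => false end.
Definition is_zero (x : sym) : bool := match x with Zero => true | _ => false end.

Fixpoint tmoves (d : move) (k : nat) : tcmd :=
  match k with 0 => TMove MStay | S k => TSeq (TMove d) (tmoves d k) end.

Lemma tmoves_exec d k : forall h tp h',
  h' = (h + Z.of_nat k * dshift d)%Z -> texec (tmoves d k) h tp h' tp (k + 1).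
Proof.
  induction k; intros h tp h' ->; simpl tmoves.
  - replace (h + Z.of_nat 0 * dshift d)%Z with (h + dshift MStay)%Z by (simpl; lia).
    constructor.
  - change (S k + 1) with (1 + (k + 1)). econstructor; [constructor|].
    apply IHk. lia.
Qed.

Lemma twhile_moves p d k n : forall h tp h',
  h' = (h + Z.of_nat n * (Z.of_nat k * dshift d))%Z ->
  (forall j, j < n -> p (tp (h + Z.of_nat j * (Z.of_nat k * dshift d))%Z) = true) ->
  p (tp h') = false ->
  texec (TWhile p (tmoves d k)) h tp h' tp (n * (k + 3) + 1).
Proof.
  induction n; intros h tp h' -> Hb He.
  - replace (h + Z.of_nat 0 * (Z.of_nat k * dshift d))%Z with h in * by lia.
    now apply xWhileF.
  - replace (S n * (k + 3) + 1) with (S (k + 1) + S (n * (k + 3) + 1)) by lia.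
    econstructor.
    + specialize (Hb 0 ltac:(lia)).
      now replace (h + Z.of_nat 0 * (Z.of_nat k * dshift d))%Z with h in Hb by lia.
    + apply tmoves_exec; reflexivity.
    + apply IHn.
      * lia.
      * intros j Hj. specialize (Hb (S j) ltac:(lia)).
        now replace (h + Z.of_nat k * dshift d + Z.of_nat j * (Z.of_nat k * dshift d))%Z
          with (h + Z.of_nat (S j) * (Z.of_nat k * dshift d))%Z by lia.
      * exact He.
Qed.

Definition cell (i : stk) (p : nat) : Z := (- (5 * Z.of_nat p + Z.of_nat (idx i)))%Z.

Lemma cell_inj i j p q : cell i p = cell j q -> i = j /\ p = q.
Proof. unfold cell. destruct i, j; simpl idx; intros; split; auto; lia. Qed.

Lemma cell_neg i p : (cell i p < 0)%Z /\ forall q, cell i p <> (- (5 * Z.of_nat q))%Z.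
Proof. unfold cell. destruct i; simpl idx; split; intros; lia. Qed.

Definition goto_free (i : stk) : tcmd :=
  TSeq (tmoves MLeft (idx i)) (TWhile nonblank (tmoves MLeft 5)).

(** The first moves lead to a position divisible by 5. That column is blank up to the home mark, so
    a [Sep] stored in a stack cannot be mistaken for home. *)
Definition go_home (i : stk) : tcmd :=
  TSeq (tmoves MRight (idx i)) (TWhile (fun x => negb (is_sep x)) (tmoves MRight 5)).

Definition goto_top (i : stk) : tcmd := TSeq (goto_free i) (tmoves MRight 5).

Lemma nonblank_iff a : nonblank a = true <-> a <> Blank.
Proof. destruct a; simpl; split; congruence. Qed.

Lemma goto_free_exec s inp tp i : rep s inp tp ->
  texec (goto_free i) 0 tp (cell i (length (get i s))) tp (8 * length (get i s) + idx i + 2).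
Proof.
  intros Hr. unfold goto_free.
  replace (8 * length (get i s) + idx i + 2)
    with ((idx i + 1) + (length (get i s) * (5 + 3) + 1)) by lia.
  econstructor. { apply tmoves_exec; reflexivity. }
  apply twhile_moves.
  - unfold cell. simpl dshift. lia.
  - intros j Hj. simpl dshift.
    match goal with |- context [tp ?z] => replace z with (cell i j) by (unfold cell; lia) end.
    unfold cell. rewrite (rep_stk _ _ _ Hr). apply nonblank_iff.
    pose proof (rep_nb _ _ _ Hr i) as Hf. apply Forall_rev in Hf.
    rewrite Forall_forall in Hf. apply Hf. apply nth_In. now rewrite length_rev.
  - unfold cell. rewrite (rep_stk _ _ _ Hr), nth_overflow; auto. now rewrite length_rev.
Qed.

Lemma go_home_exec tp i p :
  tp 0%Z = Sep -> (forall p : nat, tp (- (5 * Z.of_nat (S p)))%Z = Blank) ->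
  texec (go_home i) (cell i p) tp 0 tp (8 * p + idx i + 2).
Proof.
  intros H0 Hm. unfold go_home.
  replace (8 * p + idx i + 2) with ((idx i + 1) + (p * (5 + 3) + 1)) by lia.
  econstructor. { apply tmoves_exec; reflexivity. }
  apply twhile_moves.
  - unfold cell. simpl dshift. lia.
  - intros j Hj. simpl dshift.
    match goal with |- context [tp ?z] =>
      replace z with (- (5 * Z.of_nat (S (p - S j))))%Z by (unfold cell; lia) end.
    now rewrite Hm.
  - now rewrite H0.
Qed.

Lemma goto_top_exec s inp tp i a l : rep s inp tp -> get i s = a :: l ->
  texec (goto_top i) 0 tp (cell i (length l)) tp (8 * length (get i s) + idx i + 8)
  /\ tp (cell i (length l)) = a.
Proof.
  intros Hr Hg. split.
  - unfold goto_top.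
    replace (8 * length (get i s) + idx i + 8)
      with ((8 * length (get i s) + idx i + 2) + (5 + 1)) by lia.
    econstructor. { eapply goto_free_exec; eauto. }
    apply tmoves_exec. rewrite Hg. unfold cell. cbn [length dshift]. lia.
  - unfold cell. rewrite (rep_stk _ _ _ Hr), Hg. simpl.
    rewrite app_nth2, length_rev, Nat.sub_diag by (rewrite length_rev; lia). reflexivity.
Qed.

Lemma upd_same tp h a : upd tp h a h = a.
Proof. unfold upd. now rewrite Z.eqb_refl. Qed.

Lemma upd_other tp h a j : j <> h -> upd tp h a j = tp j.
Proof. unfold upd. now destruct (Z.eqb_spec j h). Qed.

Lemma rep_update s inp tp i l p a :
  rep s inp tp -> Forall (fun a => a <> Blank) l ->
  (forall q, nth q (rev l) Blank = if q =? p then a else nth q (rev (get i s)) Blank) ->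
  rep (set i l s) inp (upd tp (cell i p) a).
Proof.
  intros Hr Hl Hn. pose proof (cell_neg i p) as [Hn1 Hn2]. destruct Hr. constructor.
  - rewrite upd_other; auto; lia.
  - rewrite upd_other; auto; lia.
  - intros q. rewrite upd_other; auto.
  - intros j. rewrite upd_other; auto; lia.
  - intros j q. change (- (5 * Z.of_nat q + Z.of_nat (idx j)))%Z with (cell j q).
    rewrite get_set. destruct (Nat.eqb_spec (idx j) (idx i)).
    + assert (j = i) by (destruct i, j; simpl in *; congruence). subst j.
      rewrite Hn. destruct (Nat.eqb_spec q p).
      * subst. apply upd_same.
      * rewrite upd_other. apply rep_stk0. intros E. apply cell_inj in E. tauto.
    + rewrite upd_other. apply rep_stk0. intros E. apply cell_inj in E as [-> _]. tauto.
  - intros j. rewrite get_set. destruct (Nat.eqb (idx j) (idx i)); auto.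
  - auto.
Qed.

Lemma rep_push s inp tp i a : rep s inp tp -> a <> Blank ->
  rep (set i (a :: get i s) s) inp (upd tp (cell i (length (get i s))) a).
Proof.
  intros Hr Ha. apply rep_update; auto.
  - constructor; auto. apply (rep_nb _ _ _ Hr).
  - intros q. simpl. destruct (Nat.eqb_spec q (length (get i s))).
    + subst. rewrite app_nth2; rewrite length_rev; auto. now rewrite Nat.sub_diag.
    + destruct (Nat.lt_ge_cases q (length (get i s))).
      * now rewrite app_nth1 by now rewrite length_rev.
      * rewrite !nth_overflow; auto; rewrite ?length_app, length_rev; simpl; lia.
Qed.

Lemma rep_pop s inp tp i a l : rep s inp tp -> get i s = a :: l ->
  rep (set i l s) inp (upd tp (cell i (length l)) Blank).
Proof.
  intros Hr Hg. pose proof (rep_nb _ _ _ Hr i) as Hb. rewrite Hg in Hb.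
  inversion Hb; subst. apply rep_update; auto.
  intros q. rewrite Hg. simpl. destruct (Nat.eqb_spec q (length l)).
  - subst. now rewrite nth_overflow by now rewrite length_rev.
  - destruct (Nat.lt_ge_cases q (length l)).
    + now rewrite app_nth1 by now rewrite length_rev.
    + rewrite !nth_overflow; auto; rewrite ?length_app, length_rev; simpl; lia.
Qed.

Definition tpush (i : stk) (a : sym) : tcmd :=
  TSeq (goto_free i) (TSeq (TWrite a) (go_home i)).

Definition terase (i : stk) : tcmd := TSeq (TWrite Blank) (go_home i).

Lemma tpush_exec s inp tp i a : rep s inp tp -> a <> Blank ->
  exists tp' t, texec (tpush i a) 0 tp 0 tp' t /\
    rep (set i (a :: get i s) s) inp tp' /\ t <= 16 * height s + 13.
Proof.
  intros Hr Ha. pose proof (rep_push _ _ _ i a Hr Ha) as Hr'.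
  eexists _, _. split; [|split; [exact Hr'|]].
  - eapply xSeq; [eapply goto_free_exec; eauto|].
    eapply xSeq; [apply xWrite|]. apply go_home_exec; apply Hr'.
  - pose proof (get_height i s). assert (idx i <= 4) by (destruct i; simpl; lia). lia.
Qed.

Lemma terase_exec s inp tp i a l : rep s inp tp -> get i s = a :: l ->
  exists tp' t, texec (terase i) (cell i (length l)) tp 0 tp' t /\
    rep (set i l s) inp tp' /\ t <= 8 * height s + 7.
Proof.
  intros Hr Hg. pose proof (rep_pop _ _ _ i _ _ Hr Hg) as Hr'.
  eexists _, _. split; [|split; [exact Hr'|]].
  - eapply xSeq; [apply xWrite|]. apply go_home_exec; apply Hr'.
  - pose proof (get_height i s). rewrite Hg in H. simpl in H.
    assert (idx i <= 4) by (destruct i; simpl; lia). lia.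
Qed.

Fixpoint tr (c : cmd) : tcmd :=
  match c with
  | Skip => TMove MStay
  | Push i a => tpush i a
  | Seq c d => TSeq (tr c) (tr d)
  | Case i cz co cs =>
      TSeq (goto_top i)
        (TIf is_zero (TSeq (terase i) (tr cz))
           (TIf is_one (TSeq (terase i) (tr co)) (TSeq (terase i) (tr cs))))
  | Loop i c =>
      TSeq (goto_top i)
        (TSeq (TWhile is_one (TSeq (terase i) (TSeq (tr c) (goto_top i)))) (terase i))
  end.

(** The head starts on the top cell of stack [i], the position to which every round returns. The
    subtracted [8 * B + 13] is kept in reserve for the walk to that cell. *)
Lemma tr_loop_aux i c s s' t : exec (Loop i c) s s' t ->
  (forall s s' t, exec c s s' t -> forall inp tp B, rep s inp tp -> height s + t <= B ->
     exists tp' t', texec (tr c) 0 tp 0 tp' t' /\ rep s' inp tp' /\ t' <= t * (40 * (B + 1))) ->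
  forall inp tp B, rep s inp tp -> height s + t <= B ->
  forall a l, get i s = a :: l ->
  exists tp' t' ,
    texec (TSeq (TWhile is_one (TSeq (terase i) (TSeq (tr c) (goto_top i)))) (terase i))
      (cell i (length l)) tp 0 tp' t' /\ rep s' inp tp' /\ t' <= t * (40 * (B + 1)) - (8 * B + 13).
Proof.
  intros Hx IHc. remember (Loop i c) as lp eqn:Elp.
  induction Hx; try discriminate; injection Elp as -> ->; intros inp tp B Hr HB a' l' Hg.
  - rewrite H in Hg. injection Hg as <- <-.
    destruct (terase_exec _ _ _ _ _ _ Hr H) as (tp' & t' & X & R & T).
    eexists _, _. split; [|split; [exact R|]].
    + eapply xSeq; [|exact X]. apply xWhileF.
      destruct (goto_top_exec _ _ _ _ _ _ Hr H) as [_ ->].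
      destruct a; simpl; congruence.
    + lia.
  - rewrite H in Hg. injection Hg as <- <-.
    destruct (terase_exec _ _ _ _ _ _ Hr H) as (tpa & ta & Xa & Ra & Ta).
    assert (Hh : height (set i l s) <= height s).
    { unfold height; destruct i; simpl in *; rewrite H; simpl; lia. }
    destruct (IHc _ _ _ Hx1 inp tpa B Ra ltac:(lia)) as (tpb & tb & Xb & Rb & Tb).
    pose proof (exec_height _ _ _ _ Hx1) as Hh1.
    assert (exists a1 l1, get i s1 = a1 :: l1) as (a1 & l1 & Hg1).
    { inversion Hx2; subst; eauto. }
    destruct (IHHx2 eq_refl inp tpb B Rb ltac:(lia) _ _ Hg1) as (tpc & tc & Xc & Rc & Tc).
    destruct (goto_top_exec _ _ _ _ _ _ Rb Hg1) as [Xd Hd].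
    pose proof (get_height i s1).
    inversion Xc; subst.
    eexists _, _. split; [|split; [exact Rc|]].
    + eapply xSeq; [|eassumption].
      eapply xWhileT; [|eapply xSeq; [exact Xa|eapply xSeq; [exact Xb|exact Xd]]|eassumption].
      destruct (goto_top_exec _ _ _ _ _ _ Hr H) as [_ ->]. reflexivity.
    + assert (idx i <= 4) by (destruct i; simpl; lia).
      assert (1 <= t2) by (inversion Hx2; lia).
      assert (t2 * (40 * (B + 1)) >= 40 * (B + 1)) by nia.
      set (X := 40 * (B + 1)) in *.
      assert (S (t1 + t2) * X = X + t1 * X + t2 * X) by ring. subst X. lia.
Qed.

(** Each unit of cost is realized by a bounded number of walks along a stack, and [B] bounds all
    heights during the execution. *)
Lemma tr_correct c : forall s s' t, exec c s s' t ->
  forall inp tp B, rep s inp tp -> height s + t <= B ->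
  exists tp' t', texec (tr c) 0 tp 0 tp' t' /\ rep s' inp tp' /\ t' <= t * (40 * (B + 1)).
Proof.
  induction c; intros s s' t Hx inp tp B Hr HB.
  - inversion Hx; subst. exists tp, 1. split; [|split; auto; lia].
    change 0%Z with (0 + dshift MStay)%Z at 2. constructor.
  - inversion Hx; subst.
    destruct (tpush_exec _ _ _ i a Hr) as (tp' & t' & X & R & T); auto.
    exists tp', t'. split; [exact X|split; auto; lia].
  - inversion Hx as [| |? ? ? s1 ? t1 t2 Hx1 Hx2| | |]; subst.
    destruct (IHc1 _ _ _ Hx1 inp tp B Hr ltac:(lia)) as (tpa & ta & Xa & Ra & Ta).
    pose proof (exec_height _ _ _ _ Hx1).
    destruct (IHc2 _ _ _ Hx2 inp tpa B Ra ltac:(lia)) as (tpb & tb & Xb & Rb & Tb).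
    exists tpb, (ta + tb). split; [econstructor; eauto|split; auto]. lia.
  - inversion Hx as [| | |? ? ? ? ? a l ? t0 H6 H7| |]; subst.
    destruct (terase_exec _ _ _ _ _ _ Hr H6) as (tpa & ta & Xa & Ra & Ta).
    destruct (goto_top_exec _ _ _ _ _ _ Hr H6) as [Xd Hd].
    pose proof (get_height i s). assert (idx i <= 4) by (destruct i; simpl; lia).
    assert (Hh : height (set i l s) <= height s).
    { unfold height; destruct i; simpl in *; rewrite H6; simpl; lia. }
    assert (exists tp' t', texec (tr (pick a c1 c2 c3)) 0 tpa 0 tp' t' /\ rep s' inp tp'
      /\ t' <= t0 * (40 * (B + 1))) as (tpb & tb & Xb & Rb & Tb).
    { destruct a; simpl in *; eauto using Nat.le_trans; [eapply IHc3|eapply IHc1|eapply IHc2|eapply IHc3]; eauto; lia. }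
    eexists _, _. split; [|split; [exact Rb|]].
    + simpl. eapply xSeq; [exact Xd|].
      instantiate (1 := match a with Zero => S (ta + tb) + 1
        | One => S (S (ta + tb) + 1) | _ => S (S (ta + tb)) end).
      pose proof (rep_nb _ _ _ Hr i) as Hnb. rewrite H6 in Hnb. inversion Hnb; subst.
      destruct (tp (cell i (length l))) eqn:Ea; [congruence| | |].
      * apply xIfT; [now rewrite Ea|]. eapply xSeq; eauto.
      * apply xIfF; [now rewrite Ea|]. apply xIfT; [now rewrite Ea|]. eapply xSeq; eauto.
      * apply xIfF; [now rewrite Ea|]. apply xIfF; [now rewrite Ea|]. eapply xSeq; eauto.
    + destruct a; lia.
  - assert (exists a1 l1, get i s = a1 :: l1) as (a1 & l1 & Hg1).
    { inversion Hx; subst; eauto. }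
    destruct (tr_loop_aux _ _ _ _ _ Hx IHc inp tp B Hr HB _ _ Hg1) as (tp' & t' & X & R & T).
    destruct (goto_top_exec _ _ _ _ _ _ Hr Hg1) as [Xd Hd].
    pose proof (get_height i s). assert (idx i <= 4) by (destruct i; simpl; lia).
    eexists _, _. split; [simpl; eapply xSeq; [exact Xd|exact X]|split; auto].
    assert (1 <= t) by (inversion Hx; lia).
    assert (t * (40 * (B + 1)) >= 40 * (B + 1)) by nia. lia.
Qed.

(** * A language of functions on binary trees *)

Inductive tree := Lf | Nd (a b : tree).

Fixpoint size (x : tree) : nat :=
  match x with Lf => 1 | Nd a b => S (size a + size b) end.

Lemma size_pos x : 1 <= size x.
Proof. destruct x; simpl; lia. Qed.

Fixpoint ser (x : tree) : list sym :=
  match x with Lf => [Zero] | Nd a b => One :: ser a ++ ser b end.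

Lemma ser_length x : length (ser x) = size x.
Proof. induction x; simpl; auto. now rewrite length_app, IHx1, IHx2. Qed.

Definition is_bit (a : sym) : Prop := a = Zero \/ a = One.

Lemma ser_bits x : Forall is_bit (ser x).
Proof.
  induction x; simpl; constructor; auto; [now left|now right|].
  apply Forall_app; auto.
Qed.

(** The preorder code of a tree is self-delimiting: a leaf settles one pending subtree, a node
    replaces one by two. The [Zero] below the counter stops the loop when nothing is pending. *)
Definition walk (z o : cmd) : cmd :=
  Seq (Push SC Zero) (Seq (Push SC One) (Loop SC (Case SV z o Skip))).

Definition toR : cmd :=
  Seq (Push SR Sep) (walk (Push SR Zero)
    (Seq (Push SR One) (Seq (Push SC One) (Push SC One)))).

Definition drop : cmd := walk Skip (Seq (Push SC One) (Push SC One)).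

Definition until_sep (i : stk) (w : sym -> cmd) : cmd :=
  Seq (Push SC One)
    (Loop SC (Case i (Seq (w Zero) (Push SC One)) (Seq (w One) (Push SC One)) (Push SC Zero))).

Definition fromR : cmd := until_sep SR (Push SV).

(** Each transfer between stacks reverses the string. From [SR] both [SV] and [ST] receive it in the
    right direction; the second copy then returns to [SV] by two more reversals. *)
Definition dup : cmd :=
  Seq toR
    (Seq (Push ST Sep)
      (Seq (until_sep SR (fun a => Seq (Push SV a) (Push ST a)))
        (Seq (Push SR Sep) (Seq (until_sep ST (Push SR)) fromR)))).

Ltac push1 := apply ePush; discriminate.

(* The counter on [SC] holds one [One] per subtree still to be read. *)
Lemma toR_walk x : forall V R T C s' t,
  let body := Case SV (Push SR Zero)
                (Seq (Push SR One) (Seq (Push SC One) (Push SC One))) Skip in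
  exec (Loop SC body) (mkst V (rev (ser x) ++ R) T C) s' t ->
  exists t', t' <= t + 5 * size x /\
    exec (Loop SC body) (mkst (ser x ++ V) R T (One :: C)) s' t'.
Proof.
  induction x; intros V R T C s' t body Hx; simpl in Hx |- *.
  - exists (S (2 + t)). split; [lia|].
    eapply eLoop; [reflexivity| |exact Hx].
    eapply eCase; [reflexivity|]. simpl. push1.
  - rewrite rev_app_distr, <- !app_assoc in Hx. simpl in Hx.
    destruct (IHx2 V _ T C s' t Hx) as (t2 & L2 & X2).
    destruct (IHx1 _ (One :: R) T (One :: C) s' t2 X2) as (t1 & L1 & X1).
    exists (S (4 + t1)). split; [lia|].
    rewrite <- app_assoc. eapply eLoop; [reflexivity| |exact X1].
    eapply eCase; [reflexivity|]. simpl.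
    change 3 with (1 + (1 + 1)).
    eapply eSeq; [push1|]. eapply eSeq; [push1|]. push1.
Qed.

Lemma toR_exec x V R T C : exists t, t <= 9 * size x /\
  exec toR (mkst (ser x ++ V) R T C) (mkst V (rev (ser x) ++ Sep :: R) T C) t.
Proof.
  pose proof (size_pos x).
  destruct (toR_walk x V (Sep :: R) T (Zero :: C)
    (mkst V (rev (ser x) ++ Sep :: R) T C) 1) as (t & L & X).
  - eapply (eStop SC _ (mkst _ _ _ _)); [reflexivity|discriminate].
  - exists (1 + (1 + (1 + t))). split; [lia|].
    eapply eSeq; [push1|]. eapply eSeq; [push1|]. eapply eSeq; [push1|]. exact X.
Qed.

(** Stated in continuation form: an execution of the rest of the loop is extended backwards by the
    subtree [x]. For a node the right subtree is added first, then the left one. *)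
Lemma drop_walk x : forall V R T C s' t,
  let body := Case SV Skip (Seq (Push SC One) (Push SC One)) Skip in
  exec (Loop SC body) (mkst V R T C) s' t ->
  exists t', t' <= t + 5 * size x /\
    exec (Loop SC body) (mkst (ser x ++ V) R T (One :: C)) s' t'.
Proof.
  induction x; intros V R T C s' t body Hx; simpl in Hx |- *.
  - exists (S (2 + t)). split; [lia|].
    eapply eLoop; [reflexivity| |exact Hx].
    eapply eCase; [reflexivity|]. apply eSkip.
  - destruct (IHx2 V R T C s' t Hx) as (t2 & L2 & X2).
    destruct (IHx1 _ R T (One :: C) s' t2 X2) as (t1 & L1 & X1).
    exists (S (3 + t1)). split; [lia|].
    rewrite <- app_assoc. eapply eLoop; [reflexivity| |exact X1].
    eapply eCase; [reflexivity|]. simpl.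
    change 2 with (1 + 1). eapply eSeq; push1.
Qed.

Lemma drop_exec x V R T C : exists t, t <= 8 * size x /\
  exec drop (mkst (ser x ++ V) R T C) (mkst V R T C) t.
Proof.
  pose proof (size_pos x).
  destruct (drop_walk x V R T (Zero :: C) (mkst V R T C) 1) as (t & L & X).
  - eapply (eStop SC _ (mkst _ _ _ _)); [reflexivity|discriminate].
  - exists (1 + (1 + t)). split; [lia|].
    eapply eSeq; [push1|]. eapply eSeq; [push1|]. exact X.
Qed.


Ltac until_sep_tac IH :=
  intros Hl; induction Hl as [|a l Ha Hl IH]; intros;
  [ eexists; split; [|
      eapply eLoop; [reflexivity|eapply eCase; [reflexivity|push1]|
        eapply (eStop SC _ (mkst _ _ _ _)); [reflexivity|discriminate]]];
    simpl; lia
  | simpl rev; rewrite <- !app_assoc;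
    edestruct IH as (t & L & X);
    destruct Ha; subst a;
    (eexists; split; [|
      eapply eLoop; [reflexivity| |exact X];
      eapply eCase; [reflexivity|]; simpl; repeat (eapply eSeq); push1]);
    simpl; lia ].

Lemma until_sep_start i w s s' t :
  exec (Loop SC (Case i (Seq (w Zero) (Push SC One)) (Seq (w One) (Push SC One)) (Push SC Zero)))
    (set SC (One :: get SC s) s) s' t -> exec (until_sep i w) s s' (1 + t).
Proof. intros H. eapply eSeq; [push1|exact H]. Qed.

Lemma mvRV_loop l : Forall is_bit l -> forall V R T C, exists t, t <= 5 * length l + 4 /\
  exec (Loop SC (Case SR (Seq (Push SV Zero) (Push SC One))
                   (Seq (Push SV One) (Push SC One)) (Push SC Zero)))
    (mkst V (l ++ Sep :: R) T (One :: C)) (mkst (rev l ++ V) R T C) t.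
Proof. until_sep_tac IH. Qed.

Lemma mvTR_loop l : Forall is_bit l -> forall V R T C, exists t, t <= 5 * length l + 4 /\
  exec (Loop SC (Case ST (Seq (Push SR Zero) (Push SC One))
                   (Seq (Push SR One) (Push SC One)) (Push SC Zero)))
    (mkst V R (l ++ Sep :: T) (One :: C)) (mkst V (rev l ++ R) T C) t.
Proof. until_sep_tac IH. Qed.

Lemma mvRVT_loop l : Forall is_bit l -> forall V R T C, exists t, t <= 5 * length l + 4 /\
  exec (Loop SC (Case SR (Seq (Seq (Push SV Zero) (Push ST Zero)) (Push SC One))
                   (Seq (Seq (Push SV One) (Push ST One)) (Push SC One)) (Push SC Zero)))
    (mkst V (l ++ Sep :: R) T (One :: C)) (mkst (rev l ++ V) R (rev l ++ T) C) t.
Proof. until_sep_tac IH. Qed.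

Lemma fromR_exec x V R T C : exists t, t <= 10 * size x /\
  exec fromR (mkst V (rev (ser x) ++ Sep :: R) T C) (mkst (ser x ++ V) R T C) t.
Proof.
  pose proof (size_pos x).
  destruct (mvRV_loop (rev (ser x)) (Forall_rev (ser_bits x)) V R T C) as (t & L & X).
  rewrite length_rev, ser_length in L. rewrite rev_involutive in X.
  exists (1 + t). split; [lia|]. now apply until_sep_start.
Qed.

Lemma dup_exec x V R T C : exists t, t <= 45 * size x /\
  exec dup (mkst (ser x ++ V) R T C) (mkst (ser x ++ ser x ++ V) R T C) t.
Proof.
  pose proof (size_pos x).
  destruct (toR_exec x V R T C) as (t1 & L1 & X1).
  destruct (mvRVT_loop (rev (ser x)) (Forall_rev (ser_bits x)) V R (Sep :: T) C) as (t2 & L2 & X2).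
  destruct (mvTR_loop (ser x) (ser_bits x) (ser x ++ V) (Sep :: R) T C) as (t3 & L3 & X3).
  destruct (fromR_exec x (ser x ++ V) R T C) as (t4 & L4 & X4).
  rewrite length_rev, ser_length in L2. rewrite rev_involutive in X2.
  rewrite ser_length in L3.
  exists (t1 + (1 + ((1 + t2) + (1 + ((1 + t3) + t4))))). split; [lia|].
  eapply eSeq; [exact X1|]. eapply eSeq; [push1|].
  eapply eSeq; [apply until_sep_start; exact X2|].
  eapply eSeq; [push1|]. eapply eSeq; [apply until_sep_start; exact X3|]. exact X4.
Qed.

Inductive code :=
| Id | Nil | Fst | Snd
| Pair (f g : code)
| Comp (g f : code)
| If (c f g : code)
| While (f : code).

(* Leaves stand for [false]; [While f] iterates [f] on the second component as long as the
   first is not a leaf. *)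
Inductive ev : code -> tree -> tree -> nat -> Prop :=
| vId x : ev Id x x 1
| vNil x : ev Nil x Lf (size x)
| vFst a b : ev Fst (Nd a b) a (size (Nd a b))
| vFstL : ev Fst Lf Lf 1
| vSnd a b : ev Snd (Nd a b) b (size (Nd a b))
| vSndL : ev Snd Lf Lf 1
| vPair f g x a b t1 t2 :
    ev f x a t1 -> ev g x b t2 -> ev (Pair f g) x (Nd a b) (t1 + t2 + size x + size a)
| vComp f g x y z t1 t2 :
    ev f x y t1 -> ev g y z t2 -> ev (Comp g f) x z (t1 + t2)
| vIfT c f g x a b y t1 t2 :
    ev c x (Nd a b) t1 -> ev f x y t2 -> ev (If c f g) x y (t1 + t2 + size x + size (Nd a b))
| vIfF c f g x y t1 t2 :
    ev c x Lf t1 -> ev g x y t2 -> ev (If c f g) x y (t1 + t2 + size x)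
| vWhileL f : ev (While f) Lf Lf 1
| vWhileF f y : ev (While f) (Nd Lf y) y 1
| vWhileT f a b y y' z t1 t2 :
    ev f y y' t1 -> ev (While f) y' z t2 ->
    ev (While f) (Nd (Nd a b) y) z (t1 + t2 + size (Nd a b)).

Lemma ev_size c x y t : ev c x y t -> size y <= size x + t.
Proof.
  induction 1; simpl in *; try lia.
  - pose proof (size_pos x); lia.
  - pose proof (size_pos a); lia.
Qed.

Fixpoint compile (c : code) : cmd :=
  match c with
  | Id => Skip
  | Nil => Seq drop (Push SV Zero)
  | Fst => Case SV (Push SV Zero) (Seq toR (Seq drop fromR)) Skip
  | Snd => Case SV (Push SV Zero) drop Skip
  | Pair f g =>
      Seq dup (Seq (compile f) (Seq toR (Seq (compile g) (Seq fromR (Push SV One)))))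
  | Comp g f => Seq (compile f) (compile g)
  | If c f g =>
      Seq dup (Seq (compile c) (Case SV (compile g) (Seq drop (Seq drop (compile f))) Skip))
  | While f =>
      Seq (Push SC One)
        (Loop SC (Case SV (Seq (Push SV Zero) (Push SC Zero))
           (Case SV (Push SC Zero)
              (Seq drop (Seq drop (Seq (compile f) (Push SC One)))) Skip) Skip))
  end.

Lemma ser_Nd a b V : ser (Nd a b) ++ V = One :: ser a ++ ser b ++ V.
Proof. simpl. now rewrite <- app_assoc. Qed.

(** Quantifying over the rest of all stacks lets programs run on top of saved data: [Pair] parks its
    first result reversed on [SR], and the copy made by [dup] waits below the one that is
    consumed. *)
Lemma compile_correct c : forall x y t, ev c x y t -> forall V R T C, exists t', t' <= 60 * t /\
  exec (compile c) (mkst (ser x ++ V) R T C) (mkst (ser y ++ V) R T C) t'.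
Proof.
  induction c; intros x y t Hx V R T C.
  - inversion Hx; subst. exists 1. split; [lia|constructor].
  - inversion Hx; subst. destruct (drop_exec x V R T C) as (t1 & L1 & X1).
    pose proof (size_pos x).
    exists (t1 + 1). split; [lia|]. eapply eSeq; [exact X1|push1].
  - inversion Hx; subst.
    + destruct (toR_exec y (ser b ++ V) R T C) as (t1 & L1 & X1).
      destruct (drop_exec b V (rev (ser y) ++ Sep :: R) T C) as (t2 & L2 & X2).
      destruct (fromR_exec y V R T C) as (t3 & L3 & X3).
      exists (S (t1 + (t2 + t3))). split; [simpl; lia|].
      rewrite ser_Nd. eapply eCase; [reflexivity|]. simpl.
      eapply eSeq; [exact X1|eapply eSeq; [exact X2|exact X3]].
    + exists 2. split; [lia|]. eapply eCase; [reflexivity|]. simpl. push1.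
  - inversion Hx; subst.
    + destruct (drop_exec a (ser y ++ V) R T C) as (t2 & L2 & X2).
      exists (S t2). split; [simpl; lia|].
      rewrite ser_Nd. eapply eCase; [reflexivity|]. exact X2.
    + exists 2. split; [lia|]. eapply eCase; [reflexivity|]. simpl. push1.
  - inversion Hx as [| | | | | |? ? ? a b u1 u2 E1 E2| | | | | |]; subst.
    pose proof (size_pos x). pose proof (size_pos a).
    destruct (dup_exec x V R T C) as (t1 & L1 & X1).
    destruct (IHc1 _ _ _ E1 (ser x ++ V) R T C) as (t2 & L2 & X2).
    destruct (toR_exec a (ser x ++ V) R T C) as (t3 & L3 & X3).
    destruct (IHc2 _ _ _ E2 V (rev (ser a) ++ Sep :: R) T C) as (t4 & L4 & X4).
    destruct (fromR_exec a (ser b ++ V) R T C) as (t5 & L5 & X5).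
    exists (t1 + (t2 + (t3 + (t4 + (t5 + 1))))). split; [lia|].
    eapply eSeq; [exact X1|]. eapply eSeq; [exact X2|]. eapply eSeq; [exact X3|].
    eapply eSeq; [exact X4|]. eapply eSeq; [exact X5|].
    rewrite ser_Nd. push1.
  - inversion Hx as [| | | | | | |? ? ? z ? u1 u2 E1 E2| | | | |]; subst.
    destruct (IHc2 _ _ _ E1 V R T C) as (t1 & L1 & X1).
    destruct (IHc1 _ _ _ E2 V R T C) as (t2 & L2 & X2).
    exists (t1 + t2). split; [lia|]. eapply eSeq; eauto.
  - pose proof (size_pos x).
    destruct (dup_exec x V R T C) as (t1 & L1 & X1).
    inversion Hx as [| | | | | | | |? ? ? ? a b ? u1 u2 E1 E2|? ? ? ? ? u1 u2 E1 E2| | |]; subst.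
    + destruct (IHc1 _ _ _ E1 (ser x ++ V) R T C) as (t2 & L2 & X2).
      destruct (drop_exec a (ser b ++ ser x ++ V) R T C) as (t3 & L3 & X3).
      destruct (drop_exec b (ser x ++ V) R T C) as (t4 & L4 & X4).
      destruct (IHc2 _ _ _ E2 V R T C) as (t5 & L5 & X5).
      exists (t1 + (t2 + S (t3 + (t4 + t5)))). split; [simpl; lia|].
      eapply eSeq; [exact X1|]. eapply eSeq; [exact X2|].
      rewrite ser_Nd. eapply eCase; [reflexivity|]. simpl.
      eapply eSeq; [exact X3|]. eapply eSeq; [exact X4|exact X5].
    + destruct (IHc1 _ _ _ E1 (ser x ++ V) R T C) as (t2 & L2 & X2).
      destruct (IHc3 _ _ _ E2 V R T C) as (t5 & L5 & X5).
      exists (t1 + (t2 + S t5)). split; [simpl; lia|].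
      eapply eSeq; [exact X1|]. eapply eSeq; [exact X2|].
      eapply eCase; [reflexivity|]. exact X5.
  (* For the induction over the rounds, the control symbol [One] is already on [SC], as it is again
     after each round that continues. *)
  - enough (exists t', t' + 1 <= 60 * t /\
      exec (Loop SC (Case SV (Seq (Push SV Zero) (Push SC Zero))
           (Case SV (Push SC Zero)
              (Seq drop (Seq drop (Seq (compile c) (Push SC One)))) Skip) Skip))
        (mkst (ser x ++ V) R T (One :: C)) (mkst (ser y ++ V) R T C) t') as (t' & L & X).
    { exists (1 + t'). split; [lia|]. eapply eSeq; [push1|exact X]. }
    remember (While c) as w eqn:Ew. induction Hx; try discriminate; injection Ew as ->.
    + exists (S (S (1 + 1) + 1)). split; [lia|].
      eapply eLoop; [reflexivity| |].
      * eapply eCase; [reflexivity|]. eapply eSeq; push1.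
      * eapply (eStop SC _ (mkst _ _ _ _)); [reflexivity|discriminate].
    + exists (S (S (S 1) + 1)). split; [lia|].
      eapply eLoop; [reflexivity| |].
      * rewrite ser_Nd. eapply eCase; [reflexivity|]. eapply eCase; [reflexivity|]. push1.
      * eapply (eStop SC _ (mkst _ _ _ _)); [reflexivity|discriminate].
    + destruct (IHc _ _ _ Hx1 V R T C) as (u1 & L1 & X1).
      destruct (IHHx2 eq_refl) as (u2 & L2 & X2).
      destruct (drop_exec a (ser b ++ ser y ++ V) R T C) as (u3 & L3 & X3).
      destruct (drop_exec b (ser y ++ V) R T C) as (u4 & L4 & X4).
      exists (S (S (S (u3 + (u4 + (u1 + 1)))) + u2)). split; [simpl; lia|].
      eapply eLoop; [reflexivity| |exact X2].
      rewrite ser_Nd. eapply eCase; [reflexivity|].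
      rewrite ser_Nd. eapply eCase; [reflexivity|].
      eapply eSeq; [exact X3|]. eapply eSeq; [exact X4|]. eapply eSeq; [exact X1|push1].
Qed.

(** * Loading the input *)

Definition tsym (a : sym) : tree :=
  match a with
  | Zero => Lf
  | One => Nd Lf Lf
  | Sep => Nd (Nd Lf Lf) Lf
  | Blank => Nd Lf (Nd Lf Lf)
  end.

Fixpoint tlist {X} (e : X -> tree) (l : list X) : tree :=
  match l with [] => Lf | x :: l => Nd (e x) (tlist e l) end.

Fixpoint pushes (l : list sym) : cmd :=
  match l with [] => Skip | a :: l => Seq (pushes l) (Push SV a) end.

Lemma pushes_exec l : Forall (fun a => a <> Blank) l -> forall V R T C,
  exec (pushes l) (mkst V R T C) (mkst (l ++ V) R T C) (S (length l)).
Proof.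
  induction 1; intros; simpl.
  - constructor.
  - replace (S (S (length l))) with (S (length l) + 1) by lia.
    eapply eSeq; [apply IHForall|]. now apply ePush.
Qed.

Definition goto_end : tcmd :=
  TSeq (tmoves MRight 2) (TSeq (TWhile nonblank (tmoves MRight 1)) (tmoves MLeft 1)).

Definition home_from_end : tcmd :=
  TSeq (tmoves MLeft 1) (TSeq (TWhile nonblank (tmoves MLeft 1)) (tmoves MLeft 1)).

Definition take_sym (a : sym) : tcmd :=
  TSeq (TWrite Blank) (TSeq home_from_end (TSeq (tr (pushes (One :: ser (tsym a)))) goto_end)).

(** The input is consumed from its right end because preorder codes of lists grow at the front:
    pushing [One] and the code of the last unread symbol conses it to the list of symbols already
    read. *)
Definition load : tcmd :=
  TSeq (tmoves MLeft 2) (TSeq (TWrite Sep) (TSeq (tpush SV Zero)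
    (TSeq goto_end
      (TSeq (TWhile nonblank
              (TIf is_zero (take_sym Zero) (TIf is_one (take_sym One) (take_sym Sep))))
            (tmoves MLeft 1))))).

Lemma goto_end_exec s inp tp : rep s inp tp ->
  texec goto_end 0 tp (1 + Z.of_nat (length inp)) tp (4 * length inp + 6).
Proof.
  intros Hr. replace (4 * length inp + 6) with ((2 + 1) + ((length inp * (1 + 3) + 1) + (1 + 1))) by lia.
  eapply xSeq; [apply tmoves_exec; reflexivity|].
  eapply xSeq; [|apply tmoves_exec].
  - apply twhile_moves; [reflexivity| |].
    + intros j Hj. simpl dshift.
      match goal with |- context [tp ?z] => replace z with (2 + Z.of_nat j)%Z by lia end.
      rewrite (rep_inp _ _ _ Hr). apply nonblank_iff.
      pose proof (rep_inb _ _ _ Hr) as Hf. rewrite Forall_forall in Hf. apply Hf. now apply nth_In.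
    + simpl dshift.
      match goal with |- context [tp ?z] => replace z with (2 + Z.of_nat (length inp))%Z by lia end.
      rewrite (rep_inp _ _ _ Hr). now rewrite nth_overflow.
  - simpl dshift. lia.
Qed.

Lemma home_from_end_exec s inp tp : rep s inp tp ->
  texec home_from_end (2 + Z.of_nat (length inp)) tp 0 tp (4 * length inp + 5).
Proof.
  intros Hr. replace (4 * length inp + 5) with ((1 + 1) + ((length inp * (1 + 3) + 1) + (1 + 1))) by lia.
  eapply xSeq; [apply tmoves_exec; reflexivity|].
  eapply xSeq; [|apply tmoves_exec].
  - apply twhile_moves; [reflexivity| |].
    + intros j Hj. simpl dshift.
      match goal with |- context [tp ?z] =>
        replace z with (2 + Z.of_nat (length inp - S j))%Z by lia end.
      rewrite (rep_inp _ _ _ Hr). apply nonblank_iff.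
      pose proof (rep_inb _ _ _ Hr) as Hf. rewrite Forall_forall in Hf. apply Hf. apply nth_In. lia.
    + simpl dshift.
      match goal with |- context [tp ?z] => replace z with 1%Z by lia end.
      now rewrite (rep_gap _ _ _ Hr).
  - simpl dshift. lia.
Qed.

Lemma rep_erase_input s inp a tp : rep s (inp ++ [a]) tp ->
  rep s inp (upd tp (2 + Z.of_nat (length inp)) Blank).
Proof.
  intros [H0 H1 Hm Hi Hs Hb Hib]. constructor; auto.
  - rewrite upd_other; auto; lia.
  - rewrite upd_other; auto; lia.
  - intros p. rewrite upd_other; auto; lia.
  - intros j. destruct (Nat.eq_dec j (length inp)).
    + subst. now rewrite upd_same, nth_overflow.
    + rewrite upd_other by lia. rewrite Hi.
      destruct (Nat.lt_ge_cases j (length inp)).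
      * now rewrite app_nth1.
      * rewrite !nth_overflow; auto. rewrite length_app. simpl. lia.
  - intros i p. rewrite upd_other; auto. pose proof (cell_neg i p) as [H _]. unfold cell in H. lia.
  - now apply Forall_app in Hib.
Qed.

Lemma ser_tsym_length a : length (ser (tsym a)) <= 5.
Proof. destruct a; simpl; lia. Qed.

Lemma nonblank_ser x : Forall (fun a => a <> Blank) (ser x).
Proof. eapply Forall_impl; [|apply ser_bits]. intros a [->| ->]; discriminate. Qed.

Lemma take_sym_exec a inp V tp :
  rep (mkst V [] [] []) (inp ++ [a]) tp ->
  exists tp' t, texec (take_sym a) (2 + Z.of_nat (length inp)) tp
       (1 + Z.of_nat (length inp)) tp' t /\
    rep (mkst (One :: ser (tsym a) ++ V) [] [] []) inp tp' /\
    t <= 8 * length inp + 320 * (length V + 10).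
Proof.
  intros Hr. apply rep_erase_input in Hr.
  assert (Hx : exec (pushes (One :: ser (tsym a))) (mkst V [] [] [])
      (mkst (One :: ser (tsym a) ++ V) [] [] []) (S (length (One :: ser (tsym a))))).
  { apply (pushes_exec (One :: ser (tsym a))). constructor; [discriminate|apply nonblank_ser]. }
  pose proof (ser_tsym_length a).
  destruct (tr_correct _ _ _ _ Hx inp _ (length V + 7) Hr) as (tp' & t & X & R & T).
  { unfold height. simpl. lia. }
  eexists _, _. split; [|split; [exact R|]].
  - eapply xSeq; [apply xWrite|]. eapply xSeq; [eapply home_from_end_exec; eauto|].
    eapply xSeq; [exact X|]. eapply goto_end_exec; eauto.
  - assert (t <= 7 * (40 * (length V + 7 + 1))) by (simpl length in T; nia). lia.
Qed.

Lemma load_loop inp : forall x tp,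
  rep (mkst (ser (tlist tsym x)) [] [] []) inp tp ->
  exists tp' t,
    texec (TWhile nonblank
       (TIf is_zero (take_sym Zero) (TIf is_one (take_sym One) (take_sym Sep))))
       (1 + Z.of_nat (length inp)) tp 1 tp' t /\
    rep (mkst (ser (tlist tsym (inp ++ x))) [] [] []) [] tp' /\
    t <= 1 + length inp * (8 * length inp + 320 * (6 * (length inp + length x) + 20)).
Proof.
  induction inp as [|a inp IH] using rev_ind; intros x tp Hr.
  - exists tp, 1. split; [|split; [exact Hr|simpl; lia]].
    apply xWhileF. simpl Z.add. now rewrite (rep_gap _ _ _ Hr).
  - destruct (take_sym_exec a inp _ tp Hr) as (tpa & ta & Xa & Ra & Ta).
    change (One :: ser (tsym a) ++ ser (tlist tsym x)) with (ser (tlist tsym (a :: x))) in Ra.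
    destruct (IH (a :: x) tpa Ra) as (tpb & tb & Xb & Rb & Tb).
    pose proof (rep_inb _ _ _ Hr) as Hnb. apply Forall_app in Hnb as [_ Hnb].
    inversion Hnb as [|? ? Ha _]; subst.
    assert (Hcur : tp (2 + Z.of_nat (length inp))%Z = a).
    { rewrite (rep_inp _ _ _ Hr), app_nth2, Nat.sub_diag by lia. reflexivity. }
    rewrite length_app. simpl length.
    replace (1 + Z.of_nat (length inp + 1))%Z with (2 + Z.of_nat (length inp))%Z by lia.
    assert (Hs : length (ser (tlist tsym x)) <= 6 * length x + 1).
    { clear. rewrite ser_length. induction x as [|b x IH]; simpl; [lia|].
      pose proof (ser_tsym_length b) as Hb. rewrite ser_length in Hb. lia. }
    rewrite <- app_assoc. simpl app.
    eexists tpb, _. split; [|split; [exact Rb|]].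
    + eapply xWhileT; [rewrite Hcur; now apply nonblank_iff| |exact Xb].
      instantiate (1 := match a with Zero => S ta + 1
        | One => S (S ta + 1) | _ => S (S ta) end).
      destruct a; [congruence| | |].
      * apply xIfT; [now rewrite Hcur|exact Xa].
      * apply xIfF; [now rewrite Hcur|]. apply xIfT; [now rewrite Hcur|exact Xa].
      * apply xIfF; [now rewrite Hcur|]. apply xIfF; [now rewrite Hcur|exact Xa].
    + simpl length in Tb.
      assert (match a with Zero => S ta + 1 | One => S (S ta + 1) | _ => S (S ta) end <= ta + 3)
        by (destruct a; lia).
      nia.
Qed.

Lemma load_exec w : Forall (fun a => a <> Blank) w ->
  exists tp' t, texec load 2 (input_tape 2 w) 0 tp' t /\
    rep (mkst (ser (tlist tsym w)) [] [] []) [] tp' /\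
    t <= 4000 * (length w + 1) * (length w + 1).
Proof.
  intros Hw.
  assert (Hr : rep (mkst [] [] [] []) w (upd (input_tape 2 w) 0 Sep)).
  { assert (Hin : forall z, (z < 2)%Z -> input_tape 2 w z = Blank).
    { intros z Hz. unfold input_tape. destruct (Z.ltb_spec z 2); auto; lia. }
    constructor.
    - apply upd_same.
    - rewrite upd_other by lia. apply Hin; lia.
    - intros p. rewrite upd_other by lia. apply Hin; lia.
    - intros j. rewrite upd_other by lia. unfold input_tape.
      destruct (Z.ltb_spec (2 + Z.of_nat j) 2); [lia|]. f_equal. lia.
    - intros i p. pose proof (cell_neg i p) as [Hp _]. unfold cell in Hp.
      rewrite upd_other by (intros E; lia). rewrite Hin by lia. destruct i, p; reflexivity.
    - intros i. destruct i; constructor.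
    - exact Hw. }
  destruct (tpush_exec _ _ _ SV Zero Hr) as (tpa & ta & Xa & Ra & Ta); [discriminate|].
  destruct (load_loop w [] tpa Ra) as (tpb & tb & Xb & Rb & Tb).
  rewrite app_nil_r in Rb. cbn in Ta.
  eexists tpb, _. split; [|split; [exact Rb|]].
  - eapply xSeq; [apply tmoves_exec; reflexivity|].
    eapply xSeq; [apply xWrite|]. eapply xSeq; [exact Xa|].
    eapply xSeq; [eapply goto_end_exec; eauto|].
    eapply xSeq; [exact Xb|]. apply tmoves_exec. reflexivity.
  - simpl length in Tb. nia.
Qed.

Definition truth (x : tree) : bool := match x with Lf => false | _ => true end.

(** The square has two sources, both linear in [t + length w + 1]: the number of stack commands, and
    the height of the stacks along which each of them walks. Loading the input is quadratic as
    well. *)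
Theorem code_to_TM (c : code) : exists (M : TM) (K : nat),
  forall w y t, Forall (fun a => a <> Blank) w -> ev c (tlist tsym w) y t ->
    exists s, s <= K * (t + length w + 1) * (t + length w + 1) /\
      run M s (init_config w) = Some (truth y).
Proof.
  destruct (tcmd_decider (TSeq load (TSeq (tr (compile c)) (goto_top SV)))) as (M & HM).
  exists M, (240 * 1000). intros w y t Hw Hev.
  destruct (load_exec w Hw) as (tp1 & t1 & X1 & R1 & T1).
  destruct (compile_correct c _ _ _ Hev [] [] [] []) as (t' & L & X).
  rewrite !app_nil_r in X.
  assert (Hs : height (mkst (ser (tlist tsym w)) [] [] []) <= 6 * length w + 1).
  { unfold height. simpl. rewrite ser_length. clear. induction w as [|b x IH]; simpl in *; [lia|].
    pose proof (ser_tsym_length b) as Hb. rewrite ser_length in Hb. lia. }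
  destruct (tr_correct _ _ _ _ X [] tp1 (6 * length w + 1 + 60 * t) R1) as (tp2 & t2 & X2 & R2 & T2).
  { lia. }
  assert (exists a l, ser y = a :: l /\ (match a with One => true | _ => false end) = truth y)
    as (a & l & Ey & Ea).
  { destruct y; simpl; eauto. }
  destruct (goto_top_exec _ _ _ SV a l R2) as (X3 & Htop); [exact Ey|].
  pose proof (exec_height _ _ _ _ X) as Hh.
  eexists. split; cycle 1.
  - rewrite (HM 2%Z w (cell SV (length l)) tp2 _ ltac:(eapply xSeq; [exact X1|eapply xSeq; [exact X2|exact X3]])).
    now rewrite Htop, Ea.
  - assert (length (get SV (mkst (ser y) [] [] [])) <= 6 * length w + 1 + 60 * t).
    { etransitivity; [apply get_height|]. lia. }
    set (N := t + length w + 1) in *.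
    assert (t1 <= 4000 * N * N) by (subst N; nia).
    assert (t2 <= (60 * N) * (40 * (62 * N))).
    { etransitivity; [exact T2|]. apply Nat.mul_le_mono; subst N; lia. }
    assert (1 <= N) by (subst N; lia).
    assert (N <= N * N) by nia.
    rewrite <- !Nat.mul_assoc.
    simpl idx. subst N. nia.
Qed.

(** * Data types as trees *)

Class Enc (X : Type) := {
  enc : X -> tree;
  enc_inj : forall x y, enc x = enc y -> x = y
}.

Definition tbool (b : bool) : tree := if b then Nd Lf Lf else Lf.
(** Unary is affordable: only states, digits and lengths are handled as [nat], while the numbers of
    the Subset Sum instance are lists of bits. *)
Fixpoint tnat (n : nat) : tree := match n with 0 => Lf | S n => Nd Lf (tnat n) end.

#[export] Instance Enc_tree : Enc tree := {| enc := fun x => x; enc_inj := fun x y e => e |}.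

Lemma tbool_inj b b' : tbool b = tbool b' -> b = b'.
Proof. destruct b, b'; simpl; congruence. Qed.

Lemma tsym_inj a b : tsym a = tsym b -> a = b.
Proof. destruct a, b; simpl; congruence. Qed.

Lemma tnat_inj n : forall m, tnat n = tnat m -> n = m.
Proof.
  induction n; destruct m; simpl; intros H; try congruence.
  injection H as H. f_equal; auto.
Qed.

Lemma tpair_inj {X Y} `{Enc X} `{Enc Y} (p q : X * Y) :
  Nd (enc (fst p)) (enc (snd p)) = Nd (enc (fst q)) (enc (snd q)) -> p = q.
Proof. destruct p, q. simpl. intros E. injection E as E1 E2. f_equal; now apply enc_inj. Qed.

Lemma tlist_inj {X} `{Enc X} (l : list X) : forall l', tlist enc l = tlist enc l' -> l = l'.
Proof.
  induction l; destruct l'; simpl; intros E; try congruence.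
  injection E as E1 E2. f_equal; auto. now apply enc_inj.
Qed.

Definition toption {X} `{Enc X} (o : option X) : tree :=
  match o with None => Lf | Some x => Nd (enc x) Lf end.

Lemma toption_inj {X} `{Enc X} (o o' : option X) : toption o = toption o' -> o = o'.
Proof. destruct o, o'; simpl; try congruence. intros E. f_equal. apply enc_inj. congruence. Qed.

#[export] Instance Enc_bool : Enc bool := {| enc := tbool; enc_inj := tbool_inj |}.
#[export] Instance Enc_sym : Enc sym := {| enc := tsym; enc_inj := tsym_inj |}.
#[export] Instance Enc_nat : Enc nat := {| enc := tnat; enc_inj := tnat_inj |}.
#[export] Instance Enc_prod X Y `{Enc X} `{Enc Y} : Enc (X * Y) :=
  {| enc := fun p => Nd (enc (fst p)) (enc (snd p)); enc_inj := tpair_inj |}.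
#[export] Instance Enc_list X `{Enc X} : Enc (list X) :=
  {| enc := tlist enc; enc_inj := tlist_inj |}.
#[export] Instance Enc_option X `{Enc X} : Enc (option X) :=
  {| enc := toption; enc_inj := toption_inj |}.

Definition sz {X} `{Enc X} (x : X) : nat := size (enc x).

Lemma sz_pos {X} `{Enc X} (x : X) : 1 <= sz x.
Proof. apply size_pos. Qed.

Lemma sz_pair {X Y} `{Enc X} `{Enc Y} (x : X) (y : Y) : sz (x, y) = S (sz x + sz y).
Proof. reflexivity. Qed.

Lemma sz_cons {X} `{Enc X} (x : X) l : sz (x :: l) = S (sz x + sz l).
Proof. reflexivity. Qed.

Definition evb (c : code) (x y : tree) (B : nat) : Prop := exists t, t <= B /\ ev c x y t.

Lemma evb_weaken c x y B B' : evb c x y B -> B <= B' -> evb c x y B'.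
Proof. intros (t & L & H) HB. exists t. split; [lia|auto]. Qed.

Lemma evb_comp g f x y z B1 B2 :
  evb f x y B1 -> evb g y z B2 -> evb (Comp g f) x z (B1 + B2).
Proof. intros (t & L & H) (t' & L' & H'). exists (t + t'). split; [lia|]. econstructor; eauto. Qed.

Lemma evb_pair f g x a b B1 B2 :
  evb f x a B1 -> evb g x b B2 -> evb (Pair f g) x (Nd a b) (2 * (B1 + B2 + size x)).
Proof.
  intros (t & L & H) (t' & L' & H'). exists (t + t' + size x + size a). split.
  - apply ev_size in H. lia.
  - now constructor.
Qed.

Lemma evb_if c f g x (b : bool) y B1 B2 :
  evb c x (tbool b) B1 -> (if b then evb f x y B2 else evb g x y B2) ->
  evb (If c f g) x y (B1 + B2 + size x + 3).
Proof.
  intros (t & L & H) H2. destruct b; destruct H2 as (t' & L' & H').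
  - exists (t + t' + size x + size (tbool true)). split; [simpl; lia|]. econstructor; eauto.
  - exists (t + t' + size x). split; [lia|]. now eapply vIfF.
Qed.

Lemma evb_size c x y B : evb c x y B -> size y <= size x + B.
Proof. intros (t & L & H). apply ev_size in H. lia. Qed.

(** The first component that [While] inspects is the value of the test [cc], recomputed next to the
    state after every step. *)
Definition loop (cc cs : code) : code := Comp (While (Comp (Pair cc Id) cs)) (Pair cc Id).

(** Iterations without the final failing test can be concatenated. Depth-first search needs this,
    since the iterations spent on two sibling subtrees are appended. *)
Inductive lsteps (cc cs : code) : tree -> tree -> nat -> Prop :=
| ls0 x B : lsteps cc cs x x B
| lsS x y z B B' B'' :
    evb cc x (tbool true) B -> evb cs x y B -> lsteps cc cs y z B' ->
    4 * B + 4 * size x + 10 + B' <= B'' ->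
    lsteps cc cs x z B''.

Lemma lsteps_trans cc cs x y z B B' :
  lsteps cc cs x y B -> lsteps cc cs y z B' -> lsteps cc cs x z (B + B').
Proof.
  induction 1 as [x B|x y z1 B1 B2 B3 Hc Hs Hl IH HB]; intros Hz.
  - destruct Hz as [|x y z B1 B2 B3 Hc Hs Hl HB]; [constructor|]. eapply lsS; eauto. lia.
  - eapply lsS; [exact Hc|exact Hs|exact (IH Hz)|lia].
Qed.

Lemma lsteps_weaken cc cs x y B B' : lsteps cc cs x y B -> B <= B' -> lsteps cc cs x y B'.
Proof. intros H HB. destruct H; [constructor|]. eapply lsS; eauto. lia. Qed.

Lemma lsteps_loop cc cs x z B B' :
  lsteps cc cs x z B -> evb cc z Lf B' -> evb (loop cc cs) x z (B + 4 * B' + 4 * size z + 10).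
Proof.
  intros H Hz. induction H as [x|x y z B1 B2 B3 Hc Hs Hl IH HB].
  - eapply evb_weaken.
    + eapply evb_comp.
      * eapply evb_pair; [exact Hz|]. exists 1. split; [apply le_n|constructor].
      * exists 1. split; [apply le_n|constructor].
    + lia.
  (* The loop started at [y] begins with [Pair cc Id]. Its remaining [While] is exactly what is left
     after one round from [x], so it is extracted and extended by that round. *)
  - destruct (IH Hz) as (t & L & IHt). inversion IHt as [| | | | | | |? ? ? y' ? u1 u2 E1 E2| | | | |]; subst.
    assert (exists v, y' = Nd v y) as (v & ->).
    { inversion E1 as [| | | | | |? ? ? ? ? ? ? ? E3| | | | | |]; subst. inversion E3; subst. eauto. }
    destruct Hc as (tc & Lc & Hc). destruct Hs as (ts & Ls & Hs).
    exists ((tc + 1 + size x + size (tbool true)) + ((ts + u1) + u2 + size (tbool true))).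
    split; [simpl size; lia|].
    eapply vComp.
    + eapply vPair; [exact Hc|constructor].
    + eapply vWhileT; [|exact E2]. eapply vComp; eauto.
Qed.

Lemma lsteps_iter {S} `{Enc S} cc cs (step : S -> S) Q n s :
  (forall i, i < n -> evb cc (enc (Nat.iter i step s)) (tbool true) Q) ->
  (forall i, i < n -> evb cs (enc (Nat.iter i step s)) (enc (Nat.iter (1 + i) step s)) Q) ->
  (forall i, i < n -> sz (Nat.iter i step s) <= Q) ->
  lsteps cc cs (enc s) (enc (Nat.iter n step s)) (n * (8 * Q + 10)).
Proof.
  intros H1 H2 H3. induction n; [constructor|].
  replace (Datatypes.S n * (8 * Q + 10)) with (n * (8 * Q + 10) + (8 * Q + 10)) by lia.
  eapply lsteps_trans; [apply IHn; auto|].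
  eapply lsS; [apply H1; lia|apply H2; lia|apply (ls0 _ _ _ 0)|].
  specialize (H3 n ltac:(lia)). unfold sz in H3. lia.
Qed.

(** * Polynomial-time functions *)

Lemma pw_add s a b i j : a <= (s + 2) ^ i -> b <= (s + 2) ^ j -> a + b <= (s + 2) ^ (i + j + 1).
Proof.
  intros Ha Hb. rewrite !Nat.pow_add_r, Nat.pow_1_r.
  assert (1 <= (s + 2) ^ i) by (apply Nat.neq_0_lt_0, Nat.pow_nonzero; lia).
  assert (1 <= (s + 2) ^ j) by (apply Nat.neq_0_lt_0, Nat.pow_nonzero; lia).
  nia.
Qed.

Lemma pw_mul s a b i j : a <= (s + 2) ^ i -> b <= (s + 2) ^ j -> a * b <= (s + 2) ^ (i + j).
Proof. intros. rewrite Nat.pow_add_r. nia. Qed.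

Lemma pw_const s c : c <= (s + 2) ^ c.
Proof.
  transitivity (2 ^ c); [|apply Nat.pow_le_mono_l; lia].
  apply Nat.lt_le_incl, Nat.pow_gt_lin_r. lia.
Qed.

Lemma pw_mono s a i j : a <= (s + 2) ^ i -> i <= j -> a <= (s + 2) ^ j.
Proof. intros Ha Hij. etransitivity; [exact Ha|]. apply Nat.pow_le_mono_r; lia. Qed.

Lemma pw_comp s a b i j : a + 2 <= (s + 2) ^ i -> b <= (a + 2) ^ j -> b <= (s + 2) ^ (i * j).
Proof.
  intros Ha Hb. etransitivity; [exact Hb|]. rewrite Nat.pow_mul_r.
  now apply Nat.pow_le_mono_l.
Qed.

(** With a base of at least 2, constants, sums, products and compositions are all absorbed by the
    exponent, so no polynomial has to be written down. *)
Definition pbound {X} (g h : X -> nat) : Prop := exists k, forall x, g x <= (h x + 2) ^ k.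

Lemma pb_self {X} (h : X -> nat) : pbound h h.
Proof. exists 1. intros. rewrite Nat.pow_1_r. lia. Qed.

Lemma pb_const {X} c (h : X -> nat) : pbound (fun _ => c) h.
Proof. exists c. intros. apply pw_const. Qed.

Lemma pb_add {X} (f g h : X -> nat) : pbound f h -> pbound g h -> pbound (fun x => f x + g x) h.
Proof. intros (i & Hi) (j & Hj). exists (i + j + 1). intros. now apply pw_add. Qed.

Lemma pb_mul {X} (f g h : X -> nat) : pbound f h -> pbound g h -> pbound (fun x => f x * g x) h.
Proof. intros (i & Hi) (j & Hj). exists (i + j). intros. now apply pw_mul. Qed.

Lemma pb_le {X} (f g h : X -> nat) : (forall x, f x <= g x) -> pbound g h -> pbound f h.
Proof. intros H (i & Hi). exists i. intros. etransitivity; eauto. Qed.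

Lemma pb_pow {X} (f h : X -> nat) k : pbound f h -> pbound (fun x => (f x + 2) ^ k) h.
Proof.
  intros Hf. destruct (pb_add _ _ _ Hf (pb_const 2 h)) as (i & Hi).
  exists (i * k). intros x. eapply pw_comp; [apply Hi|]. apply le_n.
Qed.

Lemma pb_trans {X} (f g h : X -> nat) : pbound f g -> pbound g h -> pbound f h.
Proof. intros (k & Hk) Hg. eapply pb_le; [exact Hk|]. now apply pb_pow. Qed.

Lemma pb_comp {X Y} (f g : Y -> nat) (u : X -> Y) :
  pbound f g -> pbound (fun x => f (u x)) (fun x => g (u x)).
Proof. intros (k & Hk). exists k. auto. Qed.

Definition PT {X Y} `{Enc X} `{Enc Y} (f : X -> Y) : Prop :=
  exists c T, (forall x, evb c (enc x) (enc (f x)) (T x)) /\ pbound T sz.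

Lemma PT_ext {X Y} `{Enc X} `{Enc Y} (f g : X -> Y) : (forall x, f x = g x) -> PT f -> PT g.
Proof.
  intros E (c & T & Hc & Hp). exists c, T. split; auto. intros x. rewrite <- E. auto.
Qed.

Lemma PT_size {X Y} `{Enc X} `{Enc Y} (f : X -> Y) : PT f -> pbound (fun x => sz (f x)) sz.
Proof.
  intros (c & T & Hc & Hp).
  apply (pb_le _ (fun x => sz x + T x)).
  - intros x. eapply evb_size, Hc.
  - apply pb_add; auto. apply pb_self.
Qed.

Lemma PT_comp {X Y Z} `{Enc X} `{Enc Y} `{Enc Z} (g : Y -> Z) (f : X -> Y) :
  PT g -> PT f -> PT (fun x => g (f x)).
Proof.
  intros (cg & Tg & Hg & Pg) Hf. pose proof (PT_size f Hf) as Hs.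
  destruct Hf as (cf & Tf & Hf & Pf).
  exists (Comp cg cf), (fun x => Tf x + Tg (f x)). split.
  - intros x. eapply evb_comp; eauto.
  - apply pb_add; auto. eapply pb_trans; [apply (pb_comp Tg sz f Pg)|exact Hs].
Qed.

Lemma PT_id {X} `{Enc X} : PT (fun x : X => x).
Proof.
  exists Id, (fun _ => 1). split; [|apply pb_const].
  intros x. exists 1. split; auto. constructor.
Qed.

Lemma PT_pair {E X Y} `{Enc E} `{Enc X} `{Enc Y} (f : E -> X) (g : E -> Y) :
  PT f -> PT g -> PT (fun e => (f e, g e)).
Proof.
  intros (cf & Tf & Hf & Pf) (cg & Tg & Hg & Pg).
  exists (Pair cf cg), (fun x => 2 * (Tf x + Tg x + sz x)). split.
  - intros x. apply evb_pair; auto.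
  - apply pb_mul; [apply pb_const|]. apply pb_add; [apply pb_add; auto|apply pb_self].
Qed.

Fixpoint const_code (x : tree) : code :=
  match x with Lf => Nil | Nd a b => Pair (const_code a) (const_code b) end.

Fixpoint const_time (x : tree) (s : nat) : nat :=
  match x with Lf => s | Nd a b => 2 * (const_time a s + const_time b s + s) end.

Lemma PT_const {E Y} `{Enc E} `{Enc Y} (y : Y) : PT (fun _ : E => y).
Proof.
  exists (const_code (enc y)), (fun e => const_time (enc y) (sz e)). split.
  - intros x. generalize (enc y). intros t. induction t; simpl.
    + exists (sz x). split; auto. constructor.
    + apply evb_pair; auto.
  - induction (enc y); simpl; [apply pb_self|].
    apply (pb_mul (fun _ => 2)); [apply pb_const|]. apply pb_add; [apply pb_add; auto|apply pb_self].
Qed.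

Lemma PT_fst {E X Y} `{Enc E} `{Enc X} `{Enc Y} (f : E -> X * Y) : PT f -> PT (fun e => fst (f e)).
Proof.
  apply PT_comp. exists Fst, sz. split; [|apply pb_self].
  intros [x y]. eexists. split; [|constructor]. reflexivity.
Qed.

Lemma PT_snd {E X Y} `{Enc E} `{Enc X} `{Enc Y} (f : E -> X * Y) : PT f -> PT (fun e => snd (f e)).
Proof.
  apply PT_comp. exists Snd, sz. split; [|apply pb_self].
  intros [x y]. eexists. split; [|constructor]. reflexivity.
Qed.

Lemma PT_if {E X} `{Enc E} `{Enc X} (b : E -> bool) (f g : E -> X) :
  PT b -> PT f -> PT g -> PT (fun e => if b e then f e else g e).
Proof.
  intros (cb & Tb & Hb & Pb) (cf & Tf & Hf & Pf) (cg & Tg & Hg & Pg).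
  exists (If cb cf cg), (fun x => Tb x + (Tf x + Tg x) + sz x + 3). split.
  - intros x. apply (evb_if _ _ _ _ (b x)); [apply Hb|].
    destruct (b x); eapply evb_weaken; [apply Hf|lia|apply Hg|lia].
  - repeat apply pb_add; auto using pb_self, pb_const.
Qed.

(** Values with equal encodings need no conversion at run time: a cons is encoded like a pair,
    [Some] and [S] like pairs with a leaf. *)
Lemma PT_retype {E X Y} `{Enc E} `{Enc X} `{Enc Y} (f : E -> X) (g : E -> Y) :
  (forall e, enc (f e) = enc (g e)) -> PT f -> PT g.
Proof. intros Eq (c & T & Hc & Hp). exists c, T. split; auto. intros x. rewrite <- Eq. auto. Qed.

Definition thd (x : tree) : tree := match x with Lf => Lf | Nd a _ => a end.
Definition ttl (x : tree) : tree := match x with Lf => Lf | Nd _ b => b end.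

Lemma PT_tree {E X} `{Enc E} `{Enc X} (f : E -> X) : PT f -> PT (fun e => enc (f e)).
Proof. apply PT_retype. reflexivity. Qed.

Lemma PT_thd : PT thd.
Proof.
  exists Fst, sz. split; [|apply pb_self].
  intros [|a b]; eexists; (split; [|constructor]); reflexivity.
Qed.

Lemma PT_ttl : PT ttl.
Proof.
  exists Snd, sz. split; [|apply pb_self].
  intros [|a b]; eexists; (split; [|constructor]); reflexivity.
Qed.

Lemma PT_truth : PT truth.
Proof.
  exists (If Id (const_code (tbool true)) Nil), (fun x => 40 * size x + 40). split.
  - intros x. pose proof (size_pos x). destruct x as [|a b]; simpl.
    + exists (1 + 1 + 1). split; [simpl; lia|]. eapply vIfF; [constructor|].
      change 1 with (size Lf) at 1. constructor.
    + eexists. split; cycle 1.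
      * eapply vIfT; [constructor|]. eapply vPair; constructor.
      * simpl size. lia.
  - apply (pb_add (fun x => 40 * size x) (fun _ => 40)); [|apply pb_const].
    apply (pb_mul (fun _ => 40) size); [apply pb_const|apply pb_self].
Qed.

(** The common core of case analysis on lists, options and numbers: the constant constructor is a
    leaf, and the other one is encoded exactly like its payload [z], so nothing has to be
    unpacked. *)
Lemma PT_split {E X Z Y} `{Enc E} `{Enc X} `{Enc Z} `{Enc Y} (d : X -> option Z)
    (x : E -> X) (n : E -> Y) (c : E * Z -> Y) :
  (forall y, match d y with None => enc y = Lf | Some z => enc y = enc z /\ enc z <> Lf end) ->
  PT x -> PT n -> PT c ->
  PT (fun e => match d (x e) with None => n e | Some z => c (e, z) end).
Proof.
  intros Hd (cx & Tx & Hx & Px) (cn & Tn & Hn & Pn) (cc & Tc & Hc & Pc).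
  destruct PT_truth as (ct & Tt & Ht & Pt).
  pose proof (PT_size x (ex_intro _ cx (ex_intro _ Tx (conj Hx Px)))) as Psx.
  destruct Pc as (kc & Pc).
  exists (If (Comp ct cx) (Comp cc (Pair Id cx)) cn).
  exists (fun e => (Tx e + Tt (enc (x e))) + (Tn e + 2 * (1 + Tx e + sz e) + (sz e + sz (x e) + 1 + 2) ^ kc) + sz e + 3).
  split.
  - intros e. specialize (Hd (x e)). destruct (d (x e)) as [z|] eqn:Ed.
    + destruct Hd as [E1 E2]. apply (evb_if _ _ _ _ true).
      * eapply evb_comp; [apply Hx|]. change (tbool true) with (enc true).
        replace true with (truth (enc (x e))); [apply (Ht (enc (x e)))|].
        rewrite E1. destruct (enc z); simpl; congruence.
      * eapply evb_weaken.
        -- eapply evb_comp; [|apply (Hc (e, z))].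
           change (enc (e, z)) with (Nd (enc e) (enc z)). rewrite <- E1.
           apply evb_pair; [|apply Hx]. exists 1. split; [apply le_n|constructor].
        -- specialize (Pc (e, z)). rewrite sz_pair in Pc.
           assert (sz z = sz (x e)) as Es by (unfold sz; now rewrite E1). rewrite Es in Pc.
           replace (S (sz e + sz (x e)) + 2) with (sz e + sz (x e) + 1 + 2) in Pc by lia.
           change (size (enc e)) with (sz e). lia.
    + apply (evb_if _ _ _ _ false).
      * eapply evb_comp; [apply Hx|]. change (tbool false) with (enc false).
        replace false with (truth (enc (x e))); [apply (Ht (enc (x e)))|].
        now rewrite Hd.
      * eapply evb_weaken; [apply Hn|]. lia.
  - assert (pbound (fun e => Tt (enc (x e))) sz).
    { eapply pb_trans; [apply (pb_comp Tt sz (fun e => enc (x e)) Pt)|exact Psx]. }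
    assert (pbound (fun e => (sz e + sz (x e) + 1 + 2) ^ kc) sz).
    { apply pb_pow. apply pb_add; [|apply pb_const]. apply pb_add; auto using pb_self. }
    repeat apply pb_add; auto using pb_self, pb_const.
Qed.

Lemma PT_list_case {E X Y} `{Enc E} `{Enc X} `{Enc Y} (l : E -> list X) (n : E -> Y)
    (c : E -> X -> list X -> Y) :
  PT l -> PT n -> PT (fun p : E * (X * list X) => c (fst p) (fst (snd p)) (snd (snd p))) ->
  PT (fun e => match l e with [] => n e | x :: r => c e x r end).
Proof.
  intros Hl Hn Hc.
  apply (PT_ext (fun e => match (match l e with [] => None | x :: r => Some (x, r) end) with
    None => n e | Some z => (fun p => c (fst p) (fst (snd p)) (snd (snd p))) (e, z) end)).
  - intros e. now destruct (l e).
  - apply (PT_split (fun l => match l with [] => None | x :: r => Some (x, r) end) l n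
      (fun p => c (fst p) (fst (snd p)) (snd (snd p)))); auto.
    intros [|x r]; [reflexivity|]. split; [reflexivity|discriminate].
Qed.

Lemma PT_option_case {E X Y} `{Enc E} `{Enc X} `{Enc Y} (o : E -> option X) (n : E -> Y)
    (c : E -> X -> Y) :
  PT o -> PT n -> PT (fun p : E * X => c (fst p) (snd p)) ->
  PT (fun e => match o e with None => n e | Some x => c e x end).
Proof.
  intros Hl Hn Hc.
  apply (PT_ext (fun e => match (match o e with None => None | Some x => Some (x, false) end) with
    None => n e | Some z => (fun p => c (fst p) (fst (snd p))) (e, z) end)).
  - intros e. now destruct (o e).
  - apply (PT_split (fun o => match o with None => None | Some x => Some (x, false) end) o n
      (fun p => c (fst p) (fst (snd p)))); auto.
    + intros [x|]; [|reflexivity]. split; [reflexivity|discriminate].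
    + apply (PT_comp (fun p : E * X => c (fst p) (snd p)) (fun p => (fst p, fst (snd p)))); auto.
      apply PT_pair; repeat apply PT_fst; try apply PT_snd; apply PT_id.
Qed.

Lemma PT_nat_case {E Y} `{Enc E} `{Enc Y} (m : E -> nat) (n : E -> Y) (c : E -> nat -> Y) :
  PT m -> PT n -> PT (fun p : E * nat => c (fst p) (snd p)) ->
  PT (fun e => match m e with 0 => n e | S k => c e k end).
Proof.
  intros Hl Hn Hc.
  apply (PT_ext (fun e => match (match m e with 0 => None | S k => Some (false, k) end) with
    None => n e | Some z => (fun p => c (fst p) (snd (snd p))) (e, z) end)).
  - intros e. now destruct (m e).
  - apply (PT_split (fun m => match m with 0 => None | S k => Some (false, k) end) m n
      (fun p => c (fst p) (snd (snd p)))); auto.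
    + intros [|k]; [reflexivity|]. split; [reflexivity|discriminate].
    + apply (PT_comp (fun p : E * nat => c (fst p) (snd p)) (fun p => (fst p, snd (snd p)))); auto.
      apply PT_pair; [apply PT_fst|repeat apply PT_snd]; apply PT_id.
Qed.

Lemma PT_cons {E X} `{Enc E} `{Enc X} (x : E -> X) (l : E -> list X) :
  PT x -> PT l -> PT (fun e => x e :: l e).
Proof. intros Hx Hl. apply (PT_retype (fun e => (x e, l e))); [reflexivity|now apply PT_pair]. Qed.

Lemma PT_Some {E X} `{Enc E} `{Enc X} (x : E -> X) : PT x -> PT (fun e => Some (x e)).
Proof.
  intros Hx. apply (PT_retype (fun e => (x e, Lf))); [reflexivity|].
  apply PT_pair; auto. apply PT_const.
Qed.

Lemma PT_S {E} `{Enc E} (n : E -> nat) : PT n -> PT (fun e => S (n e)).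
Proof.
  intros Hx. apply (PT_retype (fun e => (Lf, n e))); [reflexivity|].
  apply PT_pair; auto. apply PT_const.
Qed.

Lemma PT_negb {E} `{Enc E} (b : E -> bool) : PT b -> PT (fun e => negb (b e)).
Proof.
  intros Hb. apply (PT_ext (fun e => if b e then false else true)); [reflexivity|].
  apply PT_if; auto using PT_const.
Qed.

Lemma PT_andb {E} `{Enc E} (b c : E -> bool) : PT b -> PT c -> PT (fun e => b e && c e).
Proof.
  intros Hb Hc. apply (PT_ext (fun e => if b e then c e else false)); [reflexivity|].
  apply PT_if; auto using PT_const.
Qed.

Lemma PT_orb {E} `{Enc E} (b c : E -> bool) : PT b -> PT c -> PT (fun e => b e || c e).
Proof.
  intros Hb Hc. apply (PT_ext (fun e => if b e then true else c e)); [reflexivity|].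
  apply PT_if; auto using PT_const.
Qed.

Lemma PT_is_zero {E} `{Enc E} (a : E -> sym) : PT a -> PT (fun e => is_zero (a e)).
Proof.
  intros Ha. apply (PT_ext (fun e => negb (truth (enc (a e))))).
  - intros e. now destruct (a e).
  - apply PT_negb, (PT_comp truth), PT_tree, Ha. apply PT_truth.
Qed.

Lemma PT_is_sep {E} `{Enc E} (a : E -> sym) : PT a -> PT (fun e => is_sep (a e)).
Proof.
  intros Ha. apply (PT_ext (fun e => truth (thd (enc (a e))))).
  - intros e. now destruct (a e).
  - apply (PT_comp truth); [apply PT_truth|]. apply (PT_comp thd); [apply PT_thd|].
    now apply PT_tree.
Qed.

Lemma PT_is_one {E} `{Enc E} (a : E -> sym) : PT a -> PT (fun e => is_one (a e)).
Proof.
  intros Ha. apply (PT_ext (fun e =>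
    truth (enc (a e)) && negb (truth (thd (enc (a e)))) && negb (truth (ttl (enc (a e)))))).
  - intros e. now destruct (a e).
  - pose proof (PT_tree a Ha).
    repeat apply PT_andb; try apply PT_negb; apply (PT_comp truth); try apply PT_truth; auto.
    + apply (PT_comp thd); [apply PT_thd|auto].
    + apply (PT_comp ttl); [apply PT_ttl|auto].
Qed.

(** A polynomial number of polynomial steps can still explode, because states may grow in each step.
    The last hypothesis therefore bounds all intermediate states by one polynomial in the input
    size. *)
Lemma PT_loop {E S} `{Enc E} `{Enc S} (init : E -> S) (cont : S -> bool) (step : S -> S)
    (F : E -> S) (n : E -> nat) :
  PT init -> PT cont -> PT step -> pbound n sz ->
  (forall e, F e = Nat.iter (n e) step (init e)) ->
  (forall e i, i < n e -> cont (Nat.iter i step (init e)) = true) ->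
  (forall e, cont (F e) = false) ->
  (exists k, forall e i, i <= n e -> sz (Nat.iter i step (init e)) <= (sz e + 2) ^ k) ->
  PT F.
Proof.
  intros (ci & Ti & Hi & ki & Pi) (cc & Tc & Hc & kc & Pc) (cs & Ts & Hs & ks & Ps)
    Pn HF Hcont Hend (k & Hk).
  pose (Q := fun e : E => ((sz e + 2) ^ k + 2) ^ kc + ((sz e + 2) ^ k + 2) ^ ks + (sz e + 2) ^ k).
  exists (Comp (loop cc cs) ci),
    (fun e => Ti e + (n e * (8 * Q e + 10) + 4 * Q e + 4 * Q e + 10)). split.
  - intros e. eapply evb_comp; [apply Hi|].
    assert (HQ : forall i, i <= n e -> Tc (Nat.iter i step (init e)) <= Q e /\
        Ts (Nat.iter i step (init e)) <= Q e /\ sz (Nat.iter i step (init e)) <= Q e).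
    { intros i Hin. specialize (Hk e i Hin). set (y := Nat.iter i step (init e)) in *.
      pose proof (Pc y) as H1. pose proof (Ps y) as H3.
      pose proof (Nat.pow_le_mono_l (sz y + 2) ((sz e + 2) ^ k + 2) kc ltac:(lia)) as H2.
      pose proof (Nat.pow_le_mono_l (sz y + 2) ((sz e + 2) ^ k + 2) ks ltac:(lia)) as H4.
      pose proof (Nat.le_trans _ _ _ H1 H2). pose proof (Nat.le_trans _ _ _ H3 H4).
      unfold Q. repeat split; lia. }
    eapply evb_weaken.
    + rewrite HF. eapply lsteps_loop.
      * apply (lsteps_iter cc cs step (Q e)).
        -- intros i Hin. rewrite <- (Hcont e i Hin). eapply evb_weaken; [apply Hc|]. apply HQ; lia.
        -- intros i Hin. eapply evb_weaken; [apply Hs|]. apply HQ; lia.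
        -- intros i Hin. apply HQ; lia.
      * change Lf with (tbool false). rewrite <- (Hend e), HF. apply Hc.
    + destruct (HQ (n e) (le_n _)) as (H1 & H2 & H3). unfold sz in H3 at 1. lia.
  - assert (pbound Q sz).
    { unfold Q. pose proof (pb_self (@sz E _)) as Hsz.
      apply pb_add; [apply pb_add|]; repeat apply pb_pow; auto. }
    assert (pbound (fun e => 4 * Q e) sz) by (apply (pb_mul (fun _ => 4)); auto using pb_const).
    assert (pbound (fun e => 8 * Q e) sz) by (apply (pb_mul (fun _ => 8)); auto using pb_const).
    assert (pbound Ti sz) by (exists ki; auto).
    clearbody Q. repeat apply pb_add; auto using pb_const.
    apply pb_mul; auto. apply pb_add; auto using pb_const.
Qed.

Lemma length_le_sz {X} `{Enc X} (l : list X) : length l <= sz l.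
Proof. induction l; [apply Nat.le_0_l|]. rewrite sz_cons. simpl. lia. Qed.

Lemma sz_In {X} `{Enc X} (x : X) l : In x l -> sz x < sz l.
Proof.
  induction l; [easy|]. rewrite sz_cons. intros [->|Hx]; [lia|]. specialize (IHl Hx). lia.
Qed.

Lemma sz_app {X} `{Enc X} (l l' : list X) : sz (l ++ l') + 1 = sz l + sz l'.
Proof. induction l; simpl app; [change (sz (@nil X)) with 1; lia|]. rewrite !sz_cons. lia. Qed.

Lemma PT_truth' {E} `{Enc E} (x : E -> tree) : PT x -> PT (fun e => truth (x e)).
Proof. apply PT_comp, PT_truth. Qed.

Lemma PT_thd' {E} `{Enc E} (x : E -> tree) : PT x -> PT (fun e => thd (x e)).
Proof. apply PT_comp, PT_thd. Qed.

Lemma PT_ttl' {E} `{Enc E} (x : E -> tree) : PT x -> PT (fun e => ttl (x e)).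
Proof. apply PT_comp, PT_ttl. Qed.

(* Syntax-directed, since unification up to unfolding diverges here. *)
Ltac pt_ext := fail.
Ltac pt1 := match goal with
  | |- PT (fun e => e) => apply PT_id
  | |- PT fst => apply (PT_fst (fun p => p))
  | |- PT snd => apply (PT_snd (fun p => p))
  | |- PT (fun _ => ?c) => apply PT_const
  | |- PT (fun e => fst (@?f e)) => apply (PT_fst f)
  | |- PT (fun e => snd (@?f e)) => apply (PT_snd f)
  | |- PT (fun e => (@?f e, @?g e)) => apply (PT_pair f g)
  | |- PT (fun e => @?f e :: @?g e) => apply (PT_cons f g)
  | |- PT (fun e => Some (@?f e)) => apply (PT_Some f)
  | |- PT (fun e => S (@?f e)) => apply (PT_S f)
  | |- PT (fun e => negb (@?f e)) => apply (PT_negb f)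
  | |- PT (fun e => @?f e && @?g e) => apply (PT_andb f g)
  | |- PT (fun e => @?f e || @?g e) => apply (PT_orb f g)
  | |- PT (fun e => is_zero (@?f e)) => apply (PT_is_zero f)
  | |- PT (fun e => is_one (@?f e)) => apply (PT_is_one f)
  | |- PT (fun e => is_sep (@?f e)) => apply (PT_is_sep f)
  | |- PT (fun e => truth (@?f e)) => apply (PT_truth' f)
  | |- PT (fun e => thd (@?f e)) => apply (PT_thd' f)
  | |- PT (fun e => ttl (@?f e)) => apply (PT_ttl' f)
  | |- PT (fun e => enc (@?f e)) => apply (PT_tree f)
  | |- PT (fun e => if @?b e then @?f e else @?g e) => apply (PT_if b f g)
  | H : PT ?f |- PT ?f => exact H
  | H : PT ?f |- PT (fun e => ?f e) => exact H
  | _ => pt_ext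
  end.
Ltac pt := repeat (cbv beta; pt1).

Lemma split_at {X} (l m : list X) :
  skipn (length l) (l ++ m) = m /\ firstn (length l) (l ++ m) = l.
Proof. induction l; simpl; [auto|]. destruct IHl. split; congruence. Qed.

(** The loop state consists of the unread suffix, the environment and the accumulator; [V] bounds
    the accumulators reached after the prefixes of the list. *)
Lemma PT_fold_gen {E A X} `{Enc E} `{Enc A} `{Enc X} (g : E -> A -> X -> A) (l : E -> list X)
    (a : E -> A) (V : E -> nat) :
  PT (fun p : E * (A * X) => g (fst p) (fst (snd p)) (snd (snd p))) -> PT l -> PT a ->
  pbound V sz ->
  (forall e pre post, l e = pre ++ post -> sz (fold_left (g e) pre (a e)) <= V e) ->
  PT (fun e => fold_left (g e) (l e) (a e)).
Proof.
  intros Hg Hl Ha HV Hsz.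
  pose (step := fun s : list X * (E * A) => match fst s with [] => s
    | x :: r => (r, (fst (snd s), g (fst (snd s)) (snd (snd s)) x)) end).
  pose (init := fun e => (l e, (e, a e))).
  assert (Hit : forall e i, i <= length (l e) ->
    Nat.iter i step (init e) = (skipn i (l e), (e, fold_left (g e) (firstn i (l e)) (a e)))).
  { intros e i. induction i; intros Hi; [reflexivity|]. simpl Nat.iter. rewrite IHi by lia.
    unfold step. simpl fst. simpl snd.
    destruct (nth_error (l e) i) as [x|] eqn:En.
    2:{ apply nth_error_None in En. lia. }
    apply nth_error_split in En as (l1 & l2 & El & Len). rewrite El.
    destruct (split_at l1 (x :: l2)) as [S1 F1].
    destruct (split_at (l1 ++ [x]) l2) as [S2 F2].
    rewrite Len in S1, F1. rewrite <- app_assoc, length_app, Len, Nat.add_1_r in S2, F2.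
    simpl app in S2, F2. rewrite S1, S2, F1, F2, fold_left_app. reflexivity. }
  apply (PT_ext (fun e => snd (snd (Nat.iter (length (l e)) step (init e))))).
  { intros e. rewrite Hit by lia. simpl. now rewrite firstn_all. }
  do 2 apply PT_snd.
  apply (PT_loop init (fun s => match fst s with [] => false | _ :: _ => true end) step _
    (fun e => length (l e))).
  - unfold init. pt.
  - apply PT_list_case; pt.
  - unfold step. apply (PT_list_case (fun s : list X * (E * A) => fst s) (fun s => s)
      (fun s x r => (r, (fst (snd s), g (fst (snd s)) (snd (snd s)) x)))); pt.
    apply (PT_comp (fun p : E * (A * X) => g (fst p) (fst (snd p)) (snd (snd p)))
      (fun p : (list X * (E * A)) * (X * list X) =>
         (fst (snd (fst p)), (snd (snd (fst p)), fst (snd p))))); pt.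
  - eapply pb_le; [intros; apply length_le_sz|]. now apply PT_size.
  - reflexivity.
  - intros e i Hi. rewrite Hit by lia. simpl.
    destruct (skipn i (l e)) eqn:E1; [|reflexivity].
    apply (f_equal (@length _)) in E1. rewrite length_skipn in E1. simpl in E1. lia.
  - intros e. rewrite Hit by lia. simpl. now rewrite skipn_all.
  - apply PT_size in Hl. apply PT_size in Ha.
    assert (Hp : pbound (fun e => sz (l e) + sz e + V e + 2) sz).
    { repeat apply pb_add; auto using pb_self, pb_const. }
    destruct Hp as (k & Hk). exists k. intros e i Hi. rewrite Hit by lia.
    etransitivity; [|apply Hk]. rewrite !sz_pair.
    specialize (Hsz e _ _ (eq_sym (firstn_skipn i (l e)))).
    assert (sz (skipn i (l e)) <= sz (l e)).
    { rewrite <- (firstn_skipn i (l e)) at 2.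
      pose proof (sz_app (firstn i (l e)) (skipn i (l e))).
      pose proof (sz_pos (firstn i (l e))). lia. }
    lia.
Qed.

(** Additive growth by at most [W e] per element keeps the accumulator polynomial, whereas a
    multiplicative bound would not. *)
Lemma PT_fold {E A X} `{Enc E} `{Enc A} `{Enc X} (g : E -> A -> X -> A) (l : E -> list X)
    (a : E -> A) (W : E -> nat) :
  PT (fun p : E * (A * X) => g (fst p) (fst (snd p)) (snd (snd p))) -> PT l -> PT a ->
  pbound W sz ->
  (forall e b x, In x (l e) -> sz (g e b x) <= sz b + W e) ->
  PT (fun e => fold_left (g e) (l e) (a e)).
Proof.
  intros Hg Hl Ha HW Hsz.
  apply (PT_fold_gen g l a (fun e => sz (a e) + sz (l e) * W e)); auto.
  { apply pb_add; [now apply PT_size|]. apply pb_mul; auto. now apply PT_size. }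
  intros e pre post El.
  assert (Hgen : forall pre b, (forall x, In x pre -> In x (l e)) ->
      sz (fold_left (g e) pre b) <= sz b + length pre * W e).
  { induction pre0 as [|x p IH]; intros b Hp; simpl; [lia|].
    etransitivity; [apply IH; intros; apply Hp; now right|].
    pose proof (Hsz e b x (Hp _ (or_introl eq_refl))). lia. }
  specialize (Hgen pre (a e)). rewrite El in Hgen.
  specialize (Hgen (fun x Hx => in_or_app _ _ _ (or_introl Hx))).
  assert (length pre <= sz (l e)).
  { pose proof (length_le_sz (l e)). rewrite El, length_app in *. lia. }
  nia.
Qed.

Lemma PT_rev {E X} `{Enc E} `{Enc X} (l : E -> list X) : PT l -> PT (fun e => rev (l e)).
Proof.
  intros Hl. apply (PT_ext (fun e => fold_left (fun a x => x :: a) (l e) [])).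
  - intros e.
    assert (G : forall (m a : list X), fold_left (fun a x => x :: a) m a = rev m ++ a).
    { induction m as [|y m IHm]; intros a; simpl; [reflexivity|]. rewrite IHm, <- app_assoc. reflexivity. }
    now rewrite G, app_nil_r.
  - apply (PT_fold (fun _ a x => x :: a) l (fun _ => []) (fun e => S (sz (l e)))); pt.
    + apply (pb_add (fun _ => 1)); [apply pb_const|now apply PT_size].
    + intros e b x Hx. rewrite sz_cons. apply sz_In in Hx. lia.
Qed.

Lemma PT_app {E X} `{Enc E} `{Enc X} (l m : E -> list X) : PT l -> PT m -> PT (fun e => l e ++ m e).
Proof.
  intros Hl Hm. apply (PT_ext (fun e => fold_left (fun a x => x :: a) (rev (l e)) (m e))).
  - intros e. rewrite <- fold_left_rev_right, rev_involutive. induction (l e); simpl; congruence.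
  - apply (PT_fold (fun _ a x => x :: a) (fun e => rev (l e)) m (fun e => S (sz (rev (l e))))); pt.
    + now apply PT_rev.
    + apply (pb_add (fun _ => 1)); [apply pb_const|]. apply (PT_size (fun e => rev (l e))). now apply PT_rev.
    + intros e b x Hx. rewrite sz_cons. apply sz_In in Hx. lia.
Qed.

Lemma pb_pair_In {E X Y} `{Enc E} `{Enc X} `{Enc Y} (f : E -> X -> Y) (l : E -> list X) :
  PT (fun p : E * X => f (fst p) (snd p)) -> PT l ->
  exists W, pbound W sz /\ forall e x, In x (l e) -> sz (f e x) <= W e.
Proof.
  intros Hf Hl. apply PT_size in Hf. apply PT_size in Hl. destruct Hf as (k & Hk).
  exists (fun e => (sz e + sz (l e) + 2) ^ k). split.
  - apply pb_pow, pb_add; auto using pb_self.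
  - intros e x Hx. specialize (Hk (e, x)). cbn [fst snd] in Hk. etransitivity; [exact Hk|].
    apply Nat.pow_le_mono_l. rewrite sz_pair. apply sz_In in Hx. lia.
Qed.

Lemma PT_map {E X Y} `{Enc E} `{Enc X} `{Enc Y} (f : E -> X -> Y) (l : E -> list X) :
  PT (fun p : E * X => f (fst p) (snd p)) -> PT l -> PT (fun e => map (f e) (l e)).
Proof.
  intros Hf Hl. apply (PT_ext (fun e => rev (fold_left (fun a x => f e x :: a) (l e) []))).
  - intros e. rewrite <- (rev_involutive (map (f e) (l e))). f_equal.
    assert (G : forall (m : list X) a, fold_left (fun a x => f e x :: a) m a = rev (map (f e) m) ++ a).
    { induction m as [|y m IHm]; intros a; simpl; [reflexivity|]. rewrite IHm, <- app_assoc. reflexivity. }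
    now rewrite G, app_nil_r.
  - apply PT_rev. destruct (pb_pair_In f l Hf Hl) as (W & HW & Hb).
    apply (PT_fold (fun e a x => f e x :: a) l (fun _ => []) (fun e => S (W e))); pt.
    + apply (PT_comp (fun p : E * X => f (fst p) (snd p)) (fun p : E * (list Y * X) => (fst p, snd (snd p)))); pt.
    + apply (pb_add (fun _ => 1)); auto using pb_const.
    + intros e b x Hx. rewrite sz_cons. apply Hb in Hx. lia.
Qed.

Lemma PT_concat {E X} `{Enc E} `{Enc X} (l : E -> list (list X)) : PT l -> PT (fun e => concat (l e)).
Proof.
  intros Hl. apply (PT_ext (fun e => fold_left (fun a x => x ++ a) (rev (l e)) [])).
  - intros e. rewrite <- fold_left_rev_right, rev_involutive. induction (l e); simpl; congruence.
  - pose proof (PT_rev l Hl).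
    apply (PT_fold (fun _ a x => x ++ a) (fun e => rev (l e)) (fun _ => []) (fun e => sz (rev (l e)))); pt.
    + apply PT_app; pt.
    + apply (PT_size (fun e => rev (l e))); auto.
    + intros e b x Hx. pose proof (sz_app x b). apply sz_In in Hx. lia.
Qed.

Lemma PT_flat_map {E X Y} `{Enc E} `{Enc X} `{Enc Y} (f : E -> X -> list Y) (l : E -> list X) :
  PT (fun p : E * X => f (fst p) (snd p)) -> PT l -> PT (fun e => flat_map (f e) (l e)).
Proof.
  intros Hf Hl. apply (PT_ext (fun e => concat (map (f e) (l e)))).
  - intros e. now rewrite flat_map_concat_map.
  - apply PT_concat, PT_map; auto.
Qed.

Lemma PT_filter {E X} `{Enc E} `{Enc X} (f : E -> X -> bool) (l : E -> list X) :
  PT (fun p : E * X => f (fst p) (snd p)) -> PT l -> PT (fun e => filter (f e) (l e)).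
Proof.
  intros Hf Hl. apply (PT_ext (fun e => flat_map (fun x => if f e x then [x] else []) (l e))).
  - intros e. induction (l e); simpl; [reflexivity|]. destruct (f e a); simpl; congruence.
  - apply PT_flat_map; auto. apply PT_if; pt.
Qed.

Lemma PT_fold_bool {E X} `{Enc E} `{Enc X} (g : E -> bool -> X -> bool) (l : E -> list X) (a : E -> bool) :
  PT (fun p : E * (bool * X) => g (fst p) (fst (snd p)) (snd (snd p))) -> PT l -> PT a ->
  PT (fun e => fold_left (g e) (l e) (a e)).
Proof.
  intros Hg Hl Ha. apply (PT_fold g l a (fun _ => 3)); auto using pb_const.
  intros e b x _. destruct (g e b x); unfold sz; simpl; lia.
Qed.

Lemma PT_existsb {E X} `{Enc E} `{Enc X} (f : E -> X -> bool) (l : E -> list X) :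
  PT (fun p : E * X => f (fst p) (snd p)) -> PT l -> PT (fun e => existsb (f e) (l e)).
Proof.
  intros Hf Hl. apply (PT_ext (fun e => fold_left (fun b x => b || f e x) (l e) false)).
  - intros e. assert (G : forall m b, fold_left (fun b x => b || f e x) m b = b || existsb (f e) m).
    { induction m as [|y m IHm]; intros b; simpl; [now rewrite orb_false_r|]. now rewrite IHm, orb_assoc. }
    apply G.
  - apply (PT_fold_bool (fun e b x => b || f e x)); pt.
    apply (PT_comp (fun p : E * X => f (fst p) (snd p)) (fun p : E * (bool * X) => (fst p, snd (snd p)))); pt.
Qed.

Lemma PT_forallb {E X} `{Enc E} `{Enc X} (f : E -> X -> bool) (l : E -> list X) :
  PT (fun p : E * X => f (fst p) (snd p)) -> PT l -> PT (fun e => forallb (f e) (l e)).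
Proof.
  intros Hf Hl. apply (PT_ext (fun e => negb (existsb (fun x => negb (f e x)) (l e)))).
  - intros e. induction (l e); simpl; [reflexivity|]. rewrite <- IHl0. now destruct (f e a).
  - apply PT_negb, PT_existsb; auto. now apply PT_negb.
Qed.

Lemma PT_length {E X} `{Enc E} `{Enc X} (l : E -> list X) : PT l -> PT (fun e => length (l e)).
Proof.
  intros Hl. apply (PT_ext (fun e => fold_left (fun n _ => S n) (l e) 0)).
  - intros e. assert (G : forall (m : list X) n, fold_left (fun n _ => S n) m n = length m + n).
    { induction m as [|y m IHm]; intros n; simpl; [reflexivity|]. rewrite IHm. lia. }
    rewrite G. lia.
  - apply (PT_fold (fun _ n _ => S n) l (fun _ => 0) (fun _ => 2)); pt; auto using pb_const.
    intros e b x _. unfold sz. simpl. lia.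
Qed.

Lemma PT_eqn (k : nat) : PT (fun n => n =? k).
Proof.
  induction k.
  - apply (PT_ext (fun n => match n with 0 => true | S _ => false end)); [now destruct x|].
    apply (PT_nat_case (fun n : nat => n)); pt.
  - apply (PT_ext (fun n => match n with 0 => false | S m => m =? k end)); [now destruct x|].
    apply (PT_nat_case (fun n : nat => n) _ (fun _ m => m =? k)); pt.
    apply (PT_comp (fun n => n =? k)); pt.
Qed.

Lemma PT_leq (k : nat) : PT (fun n => k <=? n).
Proof.
  induction k.
  - apply (PT_const true).
  - apply (PT_ext (fun n => match n with 0 => false | S m => k <=? m end)); [now destruct x|].
    apply (PT_nat_case (fun n : nat => n) _ (fun _ m => k <=? m)); pt.
    apply (PT_comp (fun n => k <=? n)); pt.
Qed.

(** * Equality of trees *)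

Fixpoint teqb (x y : tree) : bool :=
  match x, y with
  | Lf, Lf => true
  | Nd a b, Nd c d => teqb a c && teqb b d
  | _, _ => false
  end.

Lemma teqb_spec x : forall y, teqb x y = true <-> x = y.
Proof.
  induction x; destruct y; simpl; try (split; congruence).
  rewrite andb_true_iff, IHx1, IHx2. split; [intros []; congruence|intros E; now injection E].
Qed.

(* The first component is a worklist of pairs still to be compared. *)
Definition teq_step (s : list (tree * tree) * bool) : list (tree * tree) * bool :=
  match fst s with
  | [] => s
  | p :: r =>
      if truth (fst p) && truth (snd p)
      then ((thd (fst p), thd (snd p)) :: (ttl (fst p), ttl (snd p)) :: r, snd s)
      else (r, snd s && negb (truth (fst p)) && negb (truth (snd p)))
  end.

Fixpoint teq_count (x y : tree) : nat :=
  match x, y with Nd a b, Nd c d => S (teq_count a c + teq_count b d) | _, _ => 1 end.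

Lemma iter_add {S} (f : S -> S) i j s : Nat.iter (i + j) f s = Nat.iter i f (Nat.iter j f s).
Proof. induction i; simpl; congruence. Qed.

Lemma teq_iter x : forall y r b,
  Nat.iter (teq_count x y) teq_step ((x, y) :: r, b) = (r, b && teqb x y).
Proof.
  induction x as [|a0 IHa b0 IHb]; intros [|c d] r b; simpl teq_count; try (destruct b; reflexivity).
  replace (S (teq_count a0 c + teq_count b0 d)) with (teq_count b0 d + teq_count a0 c + 1) by lia.
  rewrite !iter_add. simpl Nat.iter at 3. unfold teq_step at 3. simpl.
  rewrite IHa, IHb. simpl. now rewrite andb_assoc.
Qed.

Lemma teq_iter_nonempty x : forall y r b i, i < teq_count x y ->
  fst (Nat.iter i teq_step ((x, y) :: r, b)) <> [].
Proof.
  assert (H1 : forall x y r b, fst (Nat.iter 0 teq_step ((x, y) :: r, b)) <> []) by discriminate.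
  induction x as [|a0 IHa b0 IHb]; intros [|c d] r b i Hi; simpl teq_count in Hi;
    try (replace i with 0 by lia; apply H1).
  destruct i as [|i]; [apply H1|].
  replace (S i) with (i + 1) by lia. rewrite iter_add. simpl Nat.iter at 2.
  unfold teq_step at 2. simpl.
  destruct (Nat.lt_ge_cases i (teq_count a0 c)); [now apply IHa|].
  replace i with ((i - teq_count a0 c) + teq_count a0 c) by lia.
  rewrite iter_add, teq_iter. apply IHb. lia.
Qed.

(** Splitting a pair of nodes into two pairs of children preserves the size: the two constructors
    removed pay for the new pair and the new list cell. So the initial state bounds all later
    ones. *)
Lemma teq_step_sz s : sz (teq_step s) <= sz s.
Proof.
  destruct s as [[|[x y] r] b]; unfold teq_step; simpl fst; simpl snd; [lia|].
  assert (Hb : forall b b' : bool, sz (b && b') <= sz b) by (intros [] []; unfold sz; simpl; lia).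
  destruct x, y; simpl truth; simpl negb; simpl andb; unfold thd, ttl;
    rewrite !sz_pair, !sz_cons, !sz_pair;
    unfold sz at 1 2 3; simpl; try (specialize (Hb b)); destruct b; unfold sz; simpl; lia.
Qed.

Lemma teq_count_size x : forall y, teq_count x y <= size x.
Proof.
  induction x; destruct y; simpl; try lia. specialize (IHx1 y1). specialize (IHx2 y2). lia.
Qed.

Lemma PT_teqb {E} `{Enc E} (x y : E -> tree) : PT x -> PT y -> PT (fun e => teqb (x e) (y e)).
Proof.
  intros Hx Hy.
  apply (PT_ext (fun e => snd (Nat.iter (teq_count (x e) (y e)) teq_step ([(x e, y e)], true)))).
  { intros e. now rewrite teq_iter. }
  apply PT_snd.
  apply (PT_loop (fun e => ([(x e, y e)], true))
    (fun s => match fst s with [] => false | _ :: _ => true end) teq_step _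
    (fun e => teq_count (x e) (y e))).
  - pt.
  - apply PT_list_case; pt.
  - apply (PT_list_case (fun s : list (tree * tree) * bool => fst s) (fun s => s)
      (fun s p r => if truth (fst p) && truth (snd p)
        then ((thd (fst p), thd (snd p)) :: (ttl (fst p), ttl (snd p)) :: r, snd s)
        else (r, snd s && negb (truth (fst p)) && negb (truth (snd p))))); pt.
  - apply (pb_le _ (fun e => sz (x e))); [intros; apply teq_count_size|now apply PT_size].
  - reflexivity.
  - intros e i Hi. apply (teq_iter_nonempty _ _ [] true) in Hi.
    now destruct (fst (Nat.iter i teq_step ([(x e, y e)], true))).
  - intros e. now rewrite teq_iter.
  - assert (PT (fun e => ([(x e, y e)], true))) as Hi by pt.
    apply PT_size in Hi. destruct Hi as (k & Hk). exists k. intros e i _.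
    etransitivity; [|apply Hk]. induction i; simpl; [lia|].
    etransitivity; [apply teq_step_sz|exact IHi].
Qed.

(** One comparison on encodings serves all types; here the injectivity of [enc] is put to use. *)
Definition eqx {X} `{Enc X} (x y : X) : bool := teqb (enc x) (enc y).

Lemma eqx_spec {X} `{Enc X} (x y : X) : eqx x y = true <-> x = y.
Proof.
  unfold eqx. rewrite teqb_spec. split; [apply enc_inj|congruence].
Qed.

Lemma PT_eqx {E X} `{Enc E} `{Enc X} (x y : E -> X) : PT x -> PT y -> PT (fun e => eqx (x e) (y e)).
Proof. intros. apply PT_teqb; now apply PT_tree. Qed.

(** * The algorithm *)

Notation lit := (bool * list sym)%type.
Notation cnf := (list (list lit)).

Definition mem {X} `{Enc X} (x : X) (l : list X) : bool := existsb (eqx x) l.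
Definition subset {X} `{Enc X} (c d : list X) : bool := forallb (fun x => mem x d) c.
Definition minus {X} `{Enc X} (c d : list X) : list X := filter (fun x => negb (mem x d)) c.
Definition dedup {X} `{Enc X} (l : list X) : list X :=
  fold_left (fun acc x => if mem x acc then acc else x :: acc) l [].

Definition flower (s : nat) (H : list lit) (E : cnf) : cnf :=
  filter (fun c => (length c =? s) && subset H c) E.
(** Clauses containing a new one follow from it. Removing them keeps the formula an antichain, on
    which the counting arguments rest. *)
Definition branch (N E : cnf) : cnf :=
  N ++ filter (fun c => negb (existsb (fun n => subset n c) N)) E.
Definition ins (E : cnf) (c : list lit) : cnf :=
  if existsb (fun e => subset e c) E then E else c :: filter (fun e => negb (subset c e)) E.
Definition reduce (F : cnf) : cnf := fold_left ins F [].

Definition hearts1 (E : cnf) : cnf := map (fun l => [l]) (concat E).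
Definition hearts2 (E : cnf) : cnf :=
  flat_map (fun l => map (fun l' => [l; l']) (filter (fun l' => negb (eqx l l')) (concat E)))
    (concat E).

Definition find_heart (th s : nat) (C E : cnf) : option (list lit) :=
  hd_error (filter (fun H => th <=? length (flower s H E)) C).
Definition expand (s : nat) (H : list lit) (E : cnf) : cnf * cnf :=
  (branch [H] E, branch (map (fun c => minus c H) (flower s H E)) E).

(** The order of the tests matters. New 2-clauses arise only when every literal lies in fewer than
    [th1] 2-clauses; the third test also presupposes that every pair lies in fewer than [th1]
    3-clauses, so its petals do not crowd on one literal. *)
Definition split_cnf (th1 th2 : nat) (E : cnf) : option (cnf * cnf) :=
  match find_heart th1 2 (hearts1 E) E with
  | Some H => Some (expand 2 H E)
  | None =>
      match find_heart th1 3 (hearts2 E) E with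
      | Some H => Some (expand 3 H E)
      | None =>
          match find_heart th2 3 (hearts1 E) E with
          | Some H => Some (expand 3 H E)
          | None => None
          end
      end
  end.

(* Parser state: whether the header has been read, the finished clauses, the current
   clause and the current literal; bit strings of variables come out reversed. *)
Notation pstate := (bool * (cnf * (list lit * option lit)))%type.

Definition parse_step (s : pstate) (a : sym) : pstate :=
  if fst s then
    match snd (snd (snd s)) with
    | None =>
        if is_sep a then (true, (fst (snd (snd s)) :: fst (snd s), ([], None)))
        else (true, (fst (snd s), (fst (snd (snd s)), Some (is_one a, []))))
    | Some l =>
        if is_sep a then (true, (fst (snd s), (l :: fst (snd (snd s)), None)))
        else (true, (fst (snd s), (fst (snd (snd s)), Some (fst l, a :: snd l))))
    end
  else (is_sep a, snd s).

Definition parse (w : list sym) : cnf :=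
  fst (snd (fold_left parse_step w (false, ([], ([], None))))).

Definition normalize (F : cnf) : cnf := reduce (map dedup F).

Definition vars (E : cnf) : list (list sym) := dedup (map snd (concat E)).

Definition vec (P : list lit -> bool) (d : nat) (E : cnf) : list nat :=
  map (fun c => if P c then d else 0) E.
(** The leading group offers the zero vector only. It keeps the list of groups nonempty even for the
    empty formula, so that the high block of the target has a leading digit. *)
Definition groups (E : cnf) : list (list (list nat)) :=
  [map (fun _ => 0) E]
  :: map (fun v => [vec (mem (true, v)) 1 E; vec (mem (false, v)) 1 E]) (vars E)
  ++ map (fun c => [vec (eqx c) 0 E; vec (eqx c) 1 E; vec (eqx c) 2 E]) E.

Definition zeros {X} (l : list X) : list nat := map (fun _ => 0) l.
(** The position of a suffix is recorded as that many zeros, ready to be used as the low digits of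
    an item. *)
Fixpoint splits {X} (z : list nat) (l : list X) : list (list nat * list X) :=
  match l with [] => [] | _ :: r => (z, l) :: splits (0 :: z) r end.

(** The 1 of the high block is left to [bits], which puts it right behind the last zeros. The
    opposite order of the high block thus also makes every item end with its leading digit. *)
Definition item_digits {X} (z : list nat) (post : list X) (u : list nat) : list nat :=
  z ++ 1 :: zeros post ++ u ++ zeros post.
Definition items (G : list (list (list nat))) : list (list nat) :=
  flat_map (fun p => match snd p with
                     | [] => []
                     | g :: post => map (item_digits (fst p) post) g
                     end) (splits [] G).
Definition target_digits {X Y} (G : list X) (E : list Y) : list nat :=
  map (fun _ => 1) G ++ map (fun _ => 3) E ++ map (fun _ => 1) (tl G).

Definition digit_bits (d : nat) : list bool :=
  match d with
  | 0 => [false; false; false]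
  | S 0 => [true; false; false]
  | S (S 0) => [false; true; false]
  | _ => [true; true; false]
  end.
(* The most significant digit is a one, written as the single bit that makes the string canonical. *)
Definition bits (ds : list nat) : list bool := flat_map digit_bits ds ++ [true].
(** One pad per bit of the target lifts the cardinality of the set to at least the bit length of the
    target. The lengths differ, so the pads do. *)
Definition pads (t : list bool) : list (list bool) :=
  map (fun p => map (fun _ => false) t ++ map (fun _ => false) (fst p) ++ [true]) (splits [] t).
Definition bsym (b : bool) : sym := if b then One else Zero.

Definition target (E : cnf) : list bool := bits (target_digits (groups E) E).
(** Two numbers coincide if both literals of a variable occur in the same clauses; since the input
    has to be a set, duplicates are removed. *)
Definition numbers (E : cnf) : list (list bool) :=
  dedup (map bits (items (groups E))) ++ pads (target E).
Definition ssm_input (E : cnf) : list sym :=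
  concat (map (fun s => map bsym s ++ [Sep]) (numbers E)) ++ map bsym (target E).

(** * Polynomial time for the components of the algorithm *)

Lemma PT_mem {D X} `{Enc D} `{Enc X} (x : D -> X) (l : D -> list X) :
  PT x -> PT l -> PT (fun e => mem (x e) (l e)).
Proof.
  intros Hx Hl. unfold mem. apply (PT_existsb (fun e y => eqx (x e) y) l); auto.
  apply (PT_eqx (fun p : D * X => x (fst p)) (fun p => snd p)); pt.
  apply (PT_comp x); pt.
Qed.

Ltac pt_fun f := apply (PT_comp f); pt.

Lemma PT_subset {D X} `{Enc D} `{Enc X} (c d : D -> list X) :
  PT c -> PT d -> PT (fun e => subset (c e) (d e)).
Proof.
  intros Hc Hd. unfold subset. apply (PT_forallb (fun e x => mem x (d e)) c); auto.
  apply (PT_mem (fun p : D * X => snd p) (fun p => d (fst p))); pt. pt_fun d.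
Qed.

Lemma PT_minus {D X} `{Enc D} `{Enc X} (c d : D -> list X) :
  PT c -> PT d -> PT (fun e => minus (c e) (d e)).
Proof.
  intros Hc Hd. unfold minus. apply (PT_filter (fun e x => negb (mem x (d e))) c); auto.
  pt. apply (PT_mem (fun p : D * X => snd p) (fun p => d (fst p))); pt. pt_fun d.
Qed.

Lemma PT_dedup {D X} `{Enc D} `{Enc X} (l : D -> list X) : PT l -> PT (fun e => dedup (l e)).
Proof.
  intros Hl. unfold dedup.
  apply (PT_fold (fun _ acc x => if mem x acc then acc else x :: acc) l (fun _ => [])
    (fun e => S (sz (l e)))); pt.
  - apply (PT_mem (fun p : D * (list X * X) => snd (snd p)) (fun p => fst (snd p))); pt.
  - apply (pb_add (fun _ => 1)); [apply pb_const|now apply PT_size].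
  - intros e b x Hx. apply sz_In in Hx. destruct (mem x b); [lia|]. rewrite sz_cons. lia.
Qed.

Lemma PT_length_eqb {D X} `{Enc D} `{Enc X} (l : D -> list X) k :
  PT l -> PT (fun e => length (l e) =? k).
Proof. intros Hl. apply (PT_comp (fun n => n =? k)); [apply PT_eqn|now apply PT_length]. Qed.

Lemma PT_leb_length {D X} `{Enc D} `{Enc X} (l : D -> list X) k :
  PT l -> PT (fun e => k <=? length (l e)).
Proof. intros Hl. apply (PT_comp (fun n => k <=? n)); [apply PT_leq|now apply PT_length]. Qed.

Lemma PT_head {D X} `{Enc D} `{Enc X} (l : D -> list X) : PT l -> PT (fun e => hd_error (l e)).
Proof. intros Hl. unfold hd_error. apply (PT_list_case l (fun _ => None) (fun _ x _ => Some x)); pt. Qed.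

Lemma PT_tl {D X} `{Enc D} `{Enc X} (l : D -> list X) : PT l -> PT (fun e => tl (l e)).
Proof. intros Hl. unfold tl. apply (PT_list_case l (fun _ => []) (fun _ _ r => r)); pt. Qed.

Ltac pt_ext ::= match goal with
  | |- PT (fun e => mem (@?f e) (@?g e)) => apply (PT_mem f g)
  | |- PT (fun e => eqx (@?f e) (@?g e)) => apply (PT_eqx f g)
  | |- PT (fun e => subset (@?f e) (@?g e)) => apply (PT_subset f g)
  | |- PT (fun e => minus (@?f e) (@?g e)) => apply (PT_minus f g)
  | |- PT (fun e => dedup (@?f e)) => apply (PT_dedup f)
  | |- PT (fun e => hd_error (@?f e)) => apply (PT_head f)
  | |- PT (fun e => tl (@?f e)) => apply (PT_tl f)
  | |- PT (fun e => @?f e ++ @?g e) => apply (PT_app f g)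
  | |- PT (fun e => rev (@?f e)) => apply (PT_rev f)
  | |- PT (fun e => concat (@?f e)) => apply (PT_concat f)
  | |- PT (fun e => length (@?f e) =? ?k) => apply (PT_length_eqb f k)
  | |- PT (fun e => ?k <=? length (@?f e)) => apply (PT_leb_length f k)
  | |- PT (fun e => map (@?f e) (@?l e)) => apply (PT_map f l)
  | |- PT (fun e => filter (@?f e) (@?l e)) => apply (PT_filter f l)
  | |- PT (fun e => flat_map (@?f e) (@?l e)) => apply (PT_flat_map f l)
  | |- PT (fun e => existsb (@?f e) (@?l e)) => apply (PT_existsb f l)
  | |- PT (fun e => forallb (@?f e) (@?l e)) => apply (PT_forallb f l)
  | H : PT ?f |- PT (fun e => ?f (@?g e)) => apply (PT_comp f g); [exact H|]
  end.

Lemma PT_flower {D} `{Enc D} s (c : D -> list lit) (l : D -> cnf) :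
  PT c -> PT l -> PT (fun e => flower s (c e) (l e)).
Proof. intros. unfold flower. pt. Qed.

Lemma PT_branch {D} `{Enc D} (c l : D -> cnf) : PT c -> PT l -> PT (fun e => branch (c e) (l e)).
Proof. intros. unfold branch. pt. Qed.

Lemma PT_reduce {D} `{Enc D} (l : D -> cnf) : PT l -> PT (fun e => reduce (l e)).
Proof.
  intros Hl. unfold reduce, ins.
  apply (PT_fold (fun _ acc c => if existsb (fun e => subset e c) acc then acc
      else c :: filter (fun e => negb (subset c e)) acc) l (fun _ => []) (fun e => S (sz (l e)))); pt.
  - apply (pb_add (fun _ => 1)); [apply pb_const|now apply PT_size].
  - intros e b x Hx. apply sz_In in Hx. destruct (existsb _ b); [lia|]. rewrite sz_cons.
    assert (Hf : forall f : list lit -> bool, sz (filter f b) <= sz b).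
    { intros f. clear. induction b as [|y b IH]; simpl; [lia|].
      destruct (f y); rewrite ?sz_cons; lia. }
    specialize (Hf (fun e => negb (subset x e))). lia.
Qed.

Lemma PT_find_heart {D} `{Enc D} th s (c l : D -> cnf) :
  PT c -> PT l -> PT (fun e => find_heart th s (c e) (l e)).
Proof.
  intros. unfold find_heart. pt.
  apply (PT_flower s (fun p : D * list lit => snd p) (fun p => l (fst p))); pt.
Qed.

Lemma PT_expand {D} `{Enc D} s (c : D -> list lit) (l : D -> cnf) :
  PT c -> PT l -> PT (fun e => expand s (c e) (l e)).
Proof.
  intros. pose proof (PT_flower s c l). unfold expand. pt.
  - apply PT_branch; pt.
  - apply PT_branch; pt. apply PT_flower; pt.
Qed.

Lemma PT_split_cnf th1 th2 : PT (split_cnf th1 th2).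
Proof.
  unfold split_cnf.
  assert (PT hearts1) by (unfold hearts1; pt).
  assert (PT hearts2) by (unfold hearts2; pt).
  apply (PT_option_case (fun E => find_heart th1 2 (hearts1 E) E) _ (fun E H => Some (expand 2 H E))).
  { apply PT_find_heart; pt. }
  2:{ pt. apply PT_expand; pt. }
  apply (PT_option_case (fun E => find_heart th1 3 (hearts2 E) E) _ (fun E H => Some (expand 3 H E))).
  { apply PT_find_heart; pt. }
  2:{ pt. apply PT_expand; pt. }
  apply (PT_option_case (fun E => find_heart th2 3 (hearts1 E) E) _ (fun E H => Some (expand 3 H E))).
  { apply PT_find_heart; pt. }
  - pt.
  - pt. apply PT_expand; pt.
Qed.

Lemma PT_parse : PT parse.
Proof.
  unfold parse. apply PT_fst, PT_snd.
  apply (PT_fold (fun _ => parse_step) (fun w => w) (fun _ => (false, ([], ([], None))))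
    (fun w => sz w + 20)); pt.
  - unfold parse_step. pt.
    apply (PT_option_case (fun p : list sym * (pstate * sym) => snd (snd (snd (fst (snd p))))) _
      (fun p l => if is_sep (snd (snd p))
        then (true, (fst (snd (fst (snd p))), (l :: fst (snd (snd (fst (snd p)))), None)))
        else (true, (fst (snd (fst (snd p))), (fst (snd (snd (fst (snd p)))),
          Some (fst l, snd (snd p) :: snd l)))))); pt.
  - apply pb_add; auto using pb_self, pb_const.
  - intros w b x Hx. apply sz_In in Hx. destruct b as [s [cls [cur o]]].
    unfold parse_step. cbn [fst snd].
    assert (Hb : forall b : bool, 1 <= sz b <= 3) by (intros []; unfold sz; simpl; lia).
    pose proof (Hb s). pose proof (Hb true). pose proof (Hb (is_sep x)). pose proof (Hb (is_one x)).
    assert (Hs : forall l : lit, sz (Some l) = S (sz l + 1)) by reflexivity.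
    assert (Hn : sz (@None lit) = 1) by reflexivity.
    assert (Hn' : sz (@nil lit) = 1) by reflexivity.
    assert (Hn'' : sz (@nil sym) = 1) by reflexivity.
    destruct s; [destruct o as [[p v]|]; destruct (is_sep x)|]; cbn [fst snd];
      rewrite ?sz_pair, ?sz_cons, ?Hs, ?sz_pair, ?sz_cons, ?Hn, ?Hn', ?Hn''; try lia.
Qed.

(** Each step copies parts of the accumulator itself, so its growth is not bounded for arbitrary
    accumulators as [PT_fold] demands. The reachable ones are computed explicitly; their size is
    quadratic. *)
Lemma PT_splits {D X} `{Enc D} `{Enc X} (l : D -> list X) : PT l -> PT (fun e => splits [] (l e)).
Proof.
  intros Hl.
  pose (g := fun (_ : D) (s : list nat * (list X * list (list nat * list X))) (_ : X) =>
     (0 :: fst s, (tl (fst (snd s)), (fst s, fst (snd s)) :: snd (snd s)))).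
  assert (Hg : forall e pre z post acc,
    fold_left (g e) pre (z, (pre ++ post, acc))
    = (repeat 0 (length pre) ++ z, (post, rev (firstn (length pre) (splits z (pre ++ post))) ++ acc))).
  { intros e. induction pre as [|x pre IH]; intros z post acc; [reflexivity|].
    simpl fold_left. unfold g at 2. simpl tl. cbn [fst snd].
    rewrite IH. simpl. rewrite <- app_assoc. simpl.
    replace (repeat 0 (length pre) ++ 0 :: z) with (0 :: repeat 0 (length pre) ++ z); [reflexivity|].
    clear. induction (length pre); simpl; congruence. }
  apply (PT_ext (fun e => rev (snd (snd (fold_left (g e) (l e) ([], (l e, []))))))).
  { intros e. pose proof (Hg e (l e) [] [] []) as Hf. rewrite !app_nil_r in Hf. rewrite Hf.
    cbn [fst snd]. rewrite rev_involutive. apply firstn_all2.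
    assert (Hlen : forall (m : list X) z, length (splits z m) = length m).
    { induction m; intros; simpl; auto. }
    now rewrite Hlen. }
  apply PT_rev. do 2 apply PT_snd.
  apply (PT_fold_gen g l (fun e => ([], (l e, [])))
    (fun e => (sz (l e) + 2) * (4 * sz (l e) + 10) + 4 * sz (l e) + 10)); pt.
  - unfold g. pt.
  - apply PT_size in Hl.
    assert (pbound (fun e => 4 * sz (l e)) sz) by (apply (pb_mul (fun _ => 4)); auto using pb_const).
    repeat apply pb_add; auto using pb_const. apply pb_mul; apply pb_add; auto using pb_const.
  - intros e pre post El. rewrite El, Hg. rewrite !sz_pair, app_nil_r.
    assert (Hz : forall n, sz (repeat 0 n) = 1 + 2 * n).
    { induction n; [reflexivity|]. simpl repeat. rewrite sz_cons, IHn. change (sz 0) with 1. lia. }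
    assert (Hsuf : forall (m : list X) z, (forall p, In p (splits z m) -> 
        sz (fst p) <= sz z + 2 * length m /\ sz (snd p) <= sz m)).
    { induction m as [|x m IH]; intros z p Hp; [easy|]. simpl in Hp. destruct Hp as [<-|Hp].
      - simpl. lia.
      - apply IH in Hp. rewrite !sz_cons in *. change (sz 0) with 1 in Hp. simpl length. lia. }
    assert (Hacc : forall (m : list (list nat * list X)) B, (forall p, In p m -> sz p <= B) ->
        sz m <= 1 + length m * (B + 1)).
    { induction m as [|p m IH]; intros B HB; [unfold sz; simpl; lia|].
      rewrite sz_cons. specialize (IH B (fun p Hp => HB p (or_intror Hp))).
      specialize (HB p (or_introl eq_refl)). simpl length. lia. }
    set (L := pre ++ post) in *.
    pose proof (length_le_sz L) as HL.
    assert (length pre <= sz L). { unfold L in *. rewrite length_app in HL. lia. }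
    specialize (Hacc (rev (firstn (length pre) (splits [] L))) (4 * sz L + 5)).
    rewrite length_rev in Hacc.
    assert (length (firstn (length pre) (splits [] L)) <= length pre) by (rewrite length_firstn; lia).
    assert (sz post <= sz L).
    { unfold L. pose proof (sz_app pre post). pose proof (sz_pos pre). lia. }
    rewrite app_nil_r, Hz.
    assert (sz (rev (firstn (length pre) (splits [] L))) <= 1 + sz L * (4 * sz L + 6)).
    { etransitivity; [apply Hacc|nia]. intros p Hp. apply in_rev in Hp.
      assert (In p (splits [] L)) as Hin.
      { rewrite <- (firstn_skipn (length pre) (splits [] L)). apply in_or_app; auto. }
      apply Hsuf in Hin. destruct p. rewrite sz_pair. simpl in Hin. change (sz (@nil nat)) with 1 in Hin. lia. }
    nia.
Qed.

Lemma PT_digit_bits : PT digit_bits.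
Proof.
  unfold digit_bits.
  apply (PT_nat_case (fun d => d) _ (fun _ d => match d with 0 => [true; false; false]
    | S 0 => [false; true; false] | _ => [true; true; false] end)); pt.
  apply (PT_nat_case (fun p : nat * nat => snd p) _ (fun _ d => match d with 0 => [false; true; false]
    | _ => [true; true; false] end)); pt.
  apply (PT_nat_case (fun p : (nat * nat) * nat => snd p) _ (fun _ d => [true; true; false])); pt.
Qed.

Lemma PT_bits {D} `{Enc D} (l : D -> list nat) : PT l -> PT (fun e => bits (l e)).
Proof. intros Hl. pose proof PT_digit_bits. unfold bits. pt. Qed.

Lemma PT_groups : PT groups.
Proof. unfold groups, vec, vars. pt. Qed.

Lemma PT_items {D} `{Enc D} (l : D -> list (list (list nat))) : PT l -> PT (fun e => items (l e)).
Proof.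
  intros Hl. unfold items, item_digits, zeros.
  apply PT_flat_map; [|now apply PT_splits].
  apply (PT_list_case (fun p : D * (list nat * list (list (list nat))) => snd (snd p)) _
    (fun p g post => map (fun u => fst (snd p) ++ 1 :: map (fun _ => 0) post ++ u ++ map (fun _ => 0) post) g)); pt.
Qed.

Lemma PT_target : PT target.
Proof.
  pose proof PT_groups. unfold target. apply PT_bits. unfold target_digits. pt.
Qed.

Lemma PT_ssm_input : PT ssm_input.
Proof.
  pose proof PT_target. pose proof PT_groups.
  unfold ssm_input, numbers, pads, bsym. pt.
  - apply PT_bits. pt.
  - now apply PT_items.
  - now apply PT_splits.
Qed.

Lemma PT_normalize_parse : PT (fun w => normalize (parse w)).
Proof. pose proof PT_parse. unfold normalize. apply PT_reduce. pt. Qed.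

(** * Simulating a Turing machine *)

Notation tcfg := (nat * (list sym * (sym * list sym)))%type.
Notation tact := (bool * (bool * (nat * (sym * (bool * bool)))))%type.

Definition cfg_data (c : config) : tcfg := let '(q, l, x, r) := c in (q, (l, (x, r))).

(* Halting actions are flagged by the first component; the last two tell left and right moves. *)
Definition act_data (a : action) : tact :=
  match a with
  | Halt b => (true, (b, (0, (Blank, (false, false)))))
  | Step q w d =>
      (false, (false, (q, (w, (match d with MLeft => true | _ => false end,
                              match d with MRight => true | _ => false end)))))
  end.

Definition move_data (q : nat) (l : list sym) (w : sym) (r : list sym) (d : bool * bool) : tcfg :=
  if fst d then
    match l with [] => (q, ([], (Blank, w :: r))) | x :: l' => (q, (l', (x, w :: r))) end
  else if snd d then
    match r with [] => (q, (w :: l, (Blank, []))) | x :: r' => (q, (w :: l, (x, r'))) end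
  else (q, (l, (w, r))).

(** A transition table is finite, so it can be built into the code as a nested case distinction; the
    default makes it total. *)
Definition table {Y} (n : nat) (y0 : Y) (f : nat -> sym -> Y) (q : nat) (x : sym) : Y :=
  if q <? n then f q x else y0.

Definition sim_apply (a : tact) (c : tcfg) : bool * (bool * tcfg) :=
  if fst a then (true, (fst (snd a), c))
  else (false, (false, move_data (fst (snd (snd a))) (fst (snd c)) (fst (snd (snd (snd a))))
                         (snd (snd (snd c))) (snd (snd (snd (snd a)))))).

Definition sim_step (M : TM) (s : bool * (bool * tcfg)) : bool * (bool * tcfg) :=
  let c := snd (snd s) in
  sim_apply (table (nstates M) (act_data (Halt false)) (fun q x => act_data (delta M q x))
               (fst c) (fst (snd (snd c)))) c.

Lemma PT_table1 {Y} `{Enc Y} (y0 : Y) n : forall f : nat -> Y,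
  PT (fun q => if q <? n then f q else y0).
Proof.
  induction n; intros f; [apply (PT_const y0)|].
  apply (PT_ext (fun q => match q with 0 => f 0 | S q => if q <? n then f (S q) else y0 end)).
  { now intros [|q]. }
  specialize (IHn (fun q => f (S q))).
  apply (PT_nat_case (fun q => q) (fun _ => f 0) (fun _ q => if q <? n then f (S q) else y0)); [pt|pt|].
  apply (PT_comp (fun q => if q <? n then f (S q) else y0) (fun p : nat * nat => snd p)); [exact IHn|pt].
Qed.

Lemma PT_table {Y} `{Enc Y} (y0 : Y) n (f : nat -> sym -> Y) :
  PT (fun p : nat * sym => table n y0 f (fst p) (snd p)).
Proof.
  apply (PT_ext (fun p : nat * sym =>
    if is_zero (snd p) then (fun q => if q <? n then f q Zero else y0) (fst p)
    else if is_one (snd p) then (fun q => if q <? n then f q One else y0) (fst p)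
    else if is_sep (snd p) then (fun q => if q <? n then f q Sep else y0) (fst p)
    else (fun q => if q <? n then f q Blank else y0) (fst p))).
  { now intros [q []]. }
  pose proof (fun a => PT_table1 y0 n (fun q => f q a)) as HT.
  apply PT_if; [pt| |apply PT_if; [pt| |apply PT_if; [pt| |]]];
    apply (PT_comp (fun q => if q <? n then f q _ else y0) fst); auto; pt.
Qed.

Lemma PT_move {D} `{Enc D} (q : D -> nat) l w r d :
  PT q -> PT l -> PT w -> PT r -> PT d ->
  PT (fun e => move_data (q e) (l e) (w e) (r e) (d e)).
Proof.
  intros. unfold move_data. apply PT_if; [pt| |apply PT_if; [pt| |pt]].
  - apply (PT_list_case l (fun e => (q e, ([], (Blank, w e :: r e))))
      (fun e x l' => (q e, (l', (x, w e :: r e))))); pt.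
  - apply (PT_list_case r (fun e => (q e, (w e :: l e, (Blank, []))))
      (fun e x r' => (q e, (w e :: l e, (x, r'))))); pt.
Qed.

Lemma PT_sim_step M : PT (sim_step M).
Proof.
  unfold sim_step, sim_apply.
  pose proof (PT_table (act_data (Halt false)) (nstates M) (fun q x => act_data (delta M q x))) as HT.
  assert (HT' : PT (fun s : bool * (bool * tcfg) =>
    table (nstates M) (act_data (Halt false)) (fun q x => act_data (delta M q x))
      (fst (snd (snd s))) (fst (snd (snd (snd (snd s))))))).
  { apply (PT_comp (fun p : nat * sym => table (nstates M) (act_data (Halt false))
      (fun q x => act_data (delta M q x)) (fst p) (snd p))
      (fun s : bool * (bool * tcfg) => (fst (snd (snd s)), fst (snd (snd (snd (snd s))))))); pt. }
  set (A := fun s : bool * (bool * tcfg) => table _ _ _ _ _) in HT'.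
  change (PT (fun s : bool * (bool * tcfg) =>
    if fst (A s) then (true, (fst (snd (A s)), snd (snd s)))
    else (false, (false, move_data (fst (snd (snd (A s)))) (fst (snd (snd (snd s))))
      (fst (snd (snd (snd (A s))))) (snd (snd (snd (snd (snd s)))))
      (snd (snd (snd (snd (A s))))))))).
  clearbody A. pt. apply PT_move; pt.
Qed.

Lemma sim_step_run M q l x r : q < nstates M ->
  match delta M q x with
  | Halt b => forall h a, sim_step M (h, (a, cfg_data (q, l, x, r))) = (true, (b, cfg_data (q, l, x, r)))
  | Step q' w d => forall h a, sim_step M (h, (a, cfg_data (q, l, x, r)))
                     = (false, (false, cfg_data (do_move q' l w r d)))
  end.
Proof.
  intros Hq. unfold sim_step, table. cbn [fst snd cfg_data].
  apply Nat.ltb_lt in Hq. rewrite Hq.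
  destruct (delta M q x) as [b|q' w []]; intros; [reflexivity|destruct l|destruct r|]; reflexivity.
Qed.

Definition tape_size (c : tcfg) : nat := sz (fst (snd c)) + sz (snd (snd (snd c))).

Lemma sz_sym (a : sym) : sz a <= 5.
Proof. unfold sz. destruct a; simpl; lia. Qed.

Lemma sz_nat n : sz n = 2 * n + 1.
Proof. induction n; [reflexivity|]. change (sz (S n)) with (S (1 + sz n)). lia. Qed.

Lemma sz_bool (b : bool) : sz b <= 3.
Proof. destruct b; unfold sz; simpl; lia. Qed.

Lemma do_move_size q l w r d :
  tape_size (cfg_data (do_move q l w r d)) <= sz l + sz r + 6.
Proof.
  unfold tape_size. pose proof (sz_sym w).
  destruct d; [destruct l|destruct r|]; cbn [cfg_data do_move fst snd]; rewrite ?sz_cons;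
    change (sz (@nil sym)) with 1; lia.
Qed.

Lemma do_move_state q l w r d : fst (cfg_data (do_move q l w r d)) = q.
Proof. destruct d; [destruct l|destruct r|]; reflexivity. Qed.

(** A step of [M] enlarges the two tape lists by at most 6 in size, so the summand [6 * fuel] bounds
    every configuration still to come. *)
Lemma sim_lsteps M cc cs Tc Ts kc ks :
  (forall s : bool * (bool * tcfg), evb cc (enc s) (enc (negb (fst s))) (Tc s)) ->
  (forall s, evb cs (enc s) (enc (sim_step M s)) (Ts s)) ->
  (forall s, Tc s <= (sz s + 2) ^ kc) -> (forall s, Ts s <= (sz s + 2) ^ ks) ->
  forall fuel c b B, run M fuel c = Some b -> fst (cfg_data c) < nstates M ->
  tape_size (cfg_data c) + 6 * fuel + 2 * nstates M + 30 <= B ->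
  exists c' : tcfg, sz (true, (b, c')) <= B /\
    lsteps cc cs (enc (false, (false, cfg_data c))) (enc (true, (b, c')))
      (fuel * (4 * (B + 2) ^ (kc + ks) + 4 * B + 10)).
Proof.
  intros Hc Hs Pc Ps. induction fuel; intros c b B Hrun Hq HB; [discriminate|].
  assert (Hsz : sz (false, (false, cfg_data c)) <= B /\ sz (true, (b, cfg_data c)) <= B).
  { destruct c as [[[q l] x] r]. unfold tape_size in HB. cbn [cfg_data fst snd] in *.
    rewrite !sz_pair, sz_nat. pose proof (sz_sym x). pose proof (sz_bool b).
    change (sz false) with 1. change (sz true) with 3. lia. }
  destruct Hsz as [Hsz Hsz'].
  set (s := (false, (false, cfg_data c))) in *.
  assert (HQ : forall k, k <= kc + ks -> (sz s + 2) ^ k <= (B + 2) ^ (kc + ks)).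
  { intros k Hk. transitivity ((B + 2) ^ k); [apply Nat.pow_le_mono_l; lia|].
    apply Nat.pow_le_mono_r; lia. }
  pose proof (HQ kc ltac:(lia)). pose proof (HQ ks ltac:(lia)).
  pose proof (Pc s). pose proof (Ps s).
  assert (Hc' : evb cc (enc s) (tbool true) ((B + 2) ^ (kc + ks))).
  { eapply evb_weaken; [apply (Hc s)|lia]. }
  assert (Hs' : evb cs (enc s) (enc (sim_step M s)) ((B + 2) ^ (kc + ks))).
  { eapply evb_weaken; [apply (Hs s)|lia]. }
  destruct c as [[[q l] x] r]. cbn [run] in Hrun.
  pose proof (sim_step_run M q l x r Hq) as Hstep.
  destruct (delta M q x) as [b'|q' w d] eqn:Ed.
  - injection Hrun as ->. unfold s in Hs'. rewrite Hstep in Hs'.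
    exists (cfg_data (q, l, x, r)). split; [exact Hsz'|].
    eapply lsS; [exact Hc'|exact Hs'|apply (ls0 _ _ _ 0)|].
    change (size (enc s)) with (sz s). lia.
  - unfold s in Hs'. rewrite Hstep in Hs'.
    pose proof (do_move_size q' l w r d).
    destruct (IHfuel (do_move q' l w r d) b B Hrun) as (c' & Hc2 & Hl).
    { rewrite do_move_state. eapply delta_closed; eauto. }
    { unfold tape_size in HB at 1. cbn [cfg_data fst snd] in HB. lia. }
    exists c'. split; auto.
    eapply lsS; [exact Hc'|exact Hs'|exact Hl|].
    change (size (enc s)) with (sz s). lia.
Qed.

Theorem sim_correct (M : TM) : exists c k, forall w fuel b,
  run M fuel (init_config w) = Some b -> evb c (enc w) (tbool b) ((sz w + fuel + 2) ^ k).
Proof.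
  destruct (PT_sim_step M) as (cs & Ts & Hs & ks & Ps).
  assert (PT (fun s : bool * (bool * tcfg) => negb (fst s))) as (cc & Tc & Hc & kc & Pc) by pt.
  assert (PT (fun w : list sym => (false, (false, cfg_data (init_config w))))) as (ci & Ti & Hi & ki & Pi).
  { apply (PT_ext (fun w : list sym => (false, (false,
      match w with [] => (0, ([], (Blank, []))) | x :: r => (0, ([], (x, r))) end)))).
    { now intros [|x r]. }
    pt. apply (PT_list_case (fun w => w) _ (fun _ x r => (0, ([], (x, r))))); pt. }
  assert (PT (fun s : bool * (bool * tcfg) => fst (snd s))) as (ce & Te & He & ke & Pe) by pt.
  pose (B := fun p : list sym * nat => sz (fst p) + 6 * snd p + 2 * nstates M + 40).
  assert (HP : pbound (fun p : list sym * nat =>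
     (sz (fst p) + snd p + 2) ^ ki
     + (snd p * (4 * (B p + 2) ^ (kc + ks) + 4 * B p + 10) + 4 * (B p + 2) ^ kc + 4 * B p + 10)
     + (B p + 2) ^ ke) (fun p => sz (fst p) + snd p)).
  { assert (Hsnd : pbound (fun p : list sym * nat => snd p) (fun p => sz (fst p) + snd p)).
    { apply (pb_le _ (fun p => sz (fst p) + snd p)); [intros p; lia|apply pb_self]. }
    assert (Hself := pb_self (fun p : list sym * nat => sz (fst p) + snd p)).
    assert (HB : pbound B (fun p => sz (fst p) + snd p)).
    { apply (pb_le _ (fun p => 6 * (sz (fst p) + snd p) + (2 * nstates M + 40))).
      - intros p. unfold B. lia.
      - apply pb_add; [apply (pb_mul (fun _ => 6))|]; auto using pb_const. }
    assert (HB4 : pbound (fun p => 4 * B p) (fun p => sz (fst p) + snd p))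
      by (apply (pb_mul (fun _ => 4)); auto using pb_const).
    clearbody B.
    apply pb_add; [apply pb_add|]; auto using pb_pow.
    apply pb_add; auto using pb_const. apply pb_add; auto. apply pb_add.
    - apply pb_mul; auto. apply pb_add; auto using pb_const. apply pb_add; auto.
      apply (pb_mul (fun _ => 4)); auto using pb_const, pb_pow.
    - apply (pb_mul (fun _ => 4)); auto using pb_const, pb_pow. }
  destruct HP as (k & HP).
  exists (Comp ce (Comp (loop cc cs) ci)), k. intros w fuel b Hrun.
  assert (Htape : tape_size (cfg_data (init_config w)) <= sz w + 1).
  { unfold tape_size. destruct w; cbn [init_config cfg_data fst snd]; rewrite ?sz_cons;
      change (sz (@nil sym)) with 1; lia. }
  destruct (sim_lsteps M cc cs Tc Ts kc ks Hc Hs Pc Ps fuel (init_config w) b (B (w, fuel)) Hrun)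
    as (c' & Hc' & Hl).
  { destruct w; apply start_lt. }
  { unfold B. cbn [fst snd]. lia. }
  eapply evb_weaken.
  - eapply evb_comp; [|apply (He (true, (b, c')))].
    eapply evb_comp; [apply Hi|].
    eapply lsteps_loop; [exact Hl|]. apply (Hc (true, (b, c'))).
  - etransitivity; [|apply (HP (w, fuel))]. cbn [fst snd].
    set (z := (true, (b, c'))) in *. change (size (enc z)) with (sz z).
    pose proof (Pi w). pose proof (Pc z). pose proof (Pe z).
    assert ((sz w + 2) ^ ki <= (sz w + fuel + 2) ^ ki) by (apply Nat.pow_le_mono_l; lia).
    assert ((sz z + 2) ^ kc <= (B (w, fuel) + 2) ^ kc) by (apply Nat.pow_le_mono_l; lia).
    assert ((sz z + 2) ^ ke <= (B (w, fuel) + 2) ^ ke) by (apply Nat.pow_le_mono_l; lia).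
    clearbody B. lia.
Qed.

(** * Depth-first search *)

(* [search split leaf S TL E b n d]: the search tree below [E] has [n] nodes, depth at most [d] and
   answer [b]; its formulas have size at most [S], and [leaf] answers on leaves within cost [TL]. *)
Inductive search (split : cnf -> option (cnf * cnf)) (leaf : code) (S TL : nat) :
  cnf -> bool -> nat -> nat -> Prop :=
| sLeaf E b d :
    split E = None -> sz E <= S -> evb leaf (enc E) (tbool b) TL ->
    search split leaf S TL E b 1 d
| sNode E E1 E2 b1 b2 n1 n2 d :
    split E = Some (E1, E2) -> sz E <= S ->
    search split leaf S TL E1 b1 n1 d -> search split leaf S TL E2 b2 n2 d ->
    search split leaf S TL E (b1 || b2) (Datatypes.S (n1 + n2)) (Datatypes.S d).

Lemma search_sz split leaf S TL E b n d : search split leaf S TL E b n d -> sz E <= S.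
Proof. now destruct 1. Qed.

Definition dfs_branching (split : cnf -> option (cnf * cnf)) (s : bool * list cnf) : bool :=
  match hd_error (snd s) with
  | None => false
  | Some E => match split E with None => false | Some _ => true end
  end.

Definition dfs_branch (split : cnf -> option (cnf * cnf)) (s : bool * list cnf) : bool * list cnf :=
  match hd_error (snd s) with
  | None => s
  | Some E => match split E with None => s | Some p => (false, fst p :: snd p :: tl (snd s)) end
  end.

Definition dfs_top (s : bool * list cnf) : cnf :=
  match hd_error (snd s) with None => [] | Some E => E end.

Definition dfs_running (s : bool * list cnf) : bool :=
  negb (fst s) && match snd s with [] => false | _ :: _ => true end.

Lemma PT_dfs split : PT split ->
  PT (dfs_branching split) /\ PT (dfs_branch split) /\ PT dfs_top /\ PT dfs_running.
Proof.
  intros Hs. unfold dfs_branching, dfs_branch, dfs_top, dfs_running.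
  assert (PT (fun s : bool * list cnf => hd_error (snd s))) as Hh by pt.
  assert (forall X (H : Enc X), PT (fun p : X * cnf => split (snd p))) as Hsp
    by (intros X HX; apply (PT_comp split (fun p : X * cnf => snd p)); [exact Hs|pt]).
  repeat split.
  - apply (PT_option_case _ _ (fun _ E => match split E with None => false | Some _ => true end)); [pt|pt|].
    apply (PT_option_case _ _ (fun _ _ => true)); pt; apply Hsp.
  - apply (PT_option_case _ _ (fun s E => match split E with None => s
      | Some p => (false, fst p :: snd p :: tl (snd s)) end)); [pt|pt|].
    apply (PT_option_case _ _ (fun e p => (false, fst p :: snd p :: tl (snd (fst e))))); pt; apply Hsp.
  - apply (PT_option_case _ _ (fun _ E => E)); pt.
  - apply PT_andb; [pt|]. apply (PT_list_case _ _ (fun _ _ _ => true)); pt.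
Qed.

Section DFS.

Variables (split : cnf -> option (cnf * cnf)) (leaf : code) (S TL : nat).
Variables (cb cg ct cr ctl : code) (k : nat).
Hypothesis Hb : forall s, evb cb (enc s) (enc (dfs_branching split s)) ((sz s + 2) ^ k).
Hypothesis Hg : forall s, evb cg (enc s) (enc (dfs_branch split s)) ((sz s + 2) ^ k).
Hypothesis Ht : forall s, evb ct (enc s) (enc (dfs_top s)) ((sz s + 2) ^ k).
Hypothesis Hr : forall s, evb cr (enc s) (enc (dfs_running s)) ((sz s + 2) ^ k).
Hypothesis Htl : forall s : bool * list cnf, evb ctl (enc s) (enc (tl (snd s))) ((sz s + 2) ^ k).

(** The answer of a leaf overwrites the flag. This is sound because the loop runs only while the
    flag is [false]. *)
Definition dfs_body : code := If cb cg (Pair (Comp leaf ct) ctl).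

(** At most one formula per level is pending, whence the space [(d + 1) * (S + 1)]. A negative
    answer restores [rest], so the sibling comes next; a positive one ends the search with an
    arbitrary remainder. *)
Lemma dfs_lsteps E b n d : search split leaf S TL E b n d -> forall rest B,
  sz rest + (d + 1) * (S + 1) + 5 <= B ->
  exists rest', sz rest' <= B /\ (b = false -> rest' = rest) /\
    lsteps cr dfs_body (enc (false, E :: rest)) (enc (b, rest'))
      (n * (40 * (TL + (B + 2) ^ k + B + 10))).
Proof.
  induction 1 as [E b d Hs HS Hl|E E1 E2 b1 b2 n1 n2 d Hs HS H1 IH1 H2 IH2]; intros rest B HB.
  - exists rest. assert (Hsz : sz (false, E :: rest) <= B).
    { rewrite sz_pair, sz_cons. change (sz false) with 1. nia. }
    set (s := (false, E :: rest)) in *.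
    assert (HQ : (sz s + 2) ^ k <= (B + 2) ^ k) by (apply Nat.pow_le_mono_l; lia).
    split; [lia|]. split; auto.
    pose proof (Hr s) as Xr. pose proof (Hb s) as Xb. pose proof (Ht s) as Xt. pose proof (Htl s) as Xtl.
    unfold dfs_branching in Xb. cbn [hd_error snd s] in Xb. rewrite Hs in Xb.
    pose proof (evb_pair _ _ _ _ _ _ _ (evb_comp _ _ _ _ _ _ _ Xt Hl) Xtl) as Xp.
    pose proof (evb_if cb cg (Pair (Comp leaf ct) ctl) _ false _ _ _ Xb Xp) as Xs.
    change (size (enc s)) with (sz s) in Xs.
    eapply lsS; [eapply evb_weaken; [exact Xr|]|eapply evb_weaken; [exact Xs|]|apply (ls0 _ _ _ 0)|].
    + instantiate (1 := 4 * ((B + 2) ^ k + TL + (B + 2) ^ k + B) + 2 * B + (B + 2) ^ k + 3). lia.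
    + lia.
    + change (size (enc s)) with (sz s). lia.
  - set (s := (false, E :: rest)).
    pose proof (search_sz _ _ _ _ _ _ _ _ H2) as HS2.
    destruct (IH1 (E2 :: rest) B) as (r1 & Hr1 & Er1 & L1).
    { rewrite sz_cons. nia. }
    assert (Hsz : sz s <= B).
    { unfold s. rewrite sz_pair, sz_cons. change (sz false) with 1. nia. }
    assert (HQ : (sz s + 2) ^ k <= (B + 2) ^ k) by (apply Nat.pow_le_mono_l; lia).
    pose proof (Hr s) as Xr. pose proof (Hb s) as Xb. pose proof (Hg s) as Xg.
    unfold dfs_branching in Xb. cbn [hd_error snd s] in Xb. rewrite Hs in Xb.
    pose proof (evb_if cb cg (Pair (Comp leaf ct) ctl) _ true _ _ _ Xb Xg) as Xs.
    change (size (enc s)) with (sz s) in Xs.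
    unfold dfs_branch in Xs. cbn [hd_error snd s tl] in Xs. rewrite Hs in Xs.
    set (Q := 40 * (TL + (B + 2) ^ k + B + 10)) in *.
    assert (Hfirst : forall z X, lsteps cr dfs_body (enc (false, E1 :: E2 :: rest)) z X ->
      lsteps cr dfs_body (enc s) z (X + Q)).
    { intros z X HX.
      eapply lsS; [eapply evb_weaken; [exact Xr|]|eapply evb_weaken; [exact Xs|]|exact HX|].
      - instantiate (1 := 2 * (B + 2) ^ k + B + 3). lia.
      - lia.
      - change (size (enc s)) with (sz s). unfold Q. lia. }
    destruct b1.
    + exists r1. split; [auto|]. split; [discriminate|].
      eapply lsteps_weaken; [apply Hfirst; exact L1|]. nia.
    + rewrite (Er1 eq_refl) in L1.
      destruct (IH2 rest B) as (r2 & Hr2 & Er2 & L2); [nia|].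
      exists r2. split; [auto|]. split; [exact Er2|].
      eapply lsteps_weaken; [apply Hfirst; eapply lsteps_trans; [exact L1|exact L2]|]. nia.
Qed.

End DFS.

Lemma evb_pow c x y T s i k : evb c x y T -> T <= (s + 2) ^ i -> i <= k -> evb c x y ((s + 2) ^ k).
Proof. intros H HT Hi. eapply evb_weaken; [exact H|]. eapply pw_mono; eauto. Qed.

(** The node count [n] stays outside the power. The leaf cost [TL] may be raised to it, because its
    exponential rate can be made small afterwards. *)
Theorem dfs_correct (split : cnf -> option (cnf * cnf)) (init : list sym -> cnf) (leaf : code) :
  PT split -> PT init ->
  exists c k, forall w S TL b n d, search split leaf S TL (init w) b n d ->
    evb c (enc w) (tbool b) ((n + 1) * ((d + 1) * (S + 1) + TL + sz w + 2) ^ k).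
Proof.
  intros Hsp Hin. destruct (PT_dfs split Hsp) as (Pb & Pg & Pt & Pr).
  assert (PT (fun s : bool * list cnf => tl (snd s))) as Ptl by pt.
  assert (PT (fun w => (false, [init w]))) as Pi by pt.
  assert (PT (fun s : bool * list cnf => fst s)) as Pe by pt.
  destruct Pb as (cb & Tb & Hb & kb & Pb), Pg as (cg & Tg & Hg & kg & Pg),
    Pt as (ct & Tt & Ht & kt & Pt), Pr as (cr & Tr & Hr & kr & Pr),
    Ptl as (ctl & Ttl & Htl & ktl & Ptl), Pi as (ci & Ti & Hi & ki & Pi),
    Pe as (ce & Te & He & ke & Pe).
  set (k := kb + kg + kt + kr + ktl + ki + ke).
  exists (Comp ce (Comp (loop cr (dfs_body leaf cb cg ct ctl)) ci)), (2 * k + 6).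
  intros w S TL b n d Hsearch.
  set (B := (d + 1) * (S + 1) + 6).
  assert (Hr' : forall s, evb cr (enc s) (enc (dfs_running s)) ((sz s + 2) ^ k))
    by (intros; eapply evb_pow; [apply Hr|apply Pr|lia]).
  destruct (dfs_lsteps split leaf S TL cb cg ct cr ctl k
    ltac:(intros; eapply evb_pow; [apply Hb|apply Pb|lia])
    ltac:(intros; eapply evb_pow; [apply Hg|apply Pg|lia])
    ltac:(intros; eapply evb_pow; [apply Ht|apply Pt|lia]) Hr'
    ltac:(intros; eapply evb_pow; [apply Htl|apply Ptl|lia])
    _ _ _ _ Hsearch [] B) as (rest' & Hrest & Enil & Hl).
  { change (sz (@nil cnf)) with 1. unfold B. lia. }
  set (z := (b, rest')) in *.
  assert (Hend : enc (dfs_running z) = Lf).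
  { unfold dfs_running, z. cbn [fst snd]. destruct b; [reflexivity|].
    now rewrite (Enil eq_refl). }
  assert (Hsz : sz z <= B + 4).
  { unfold z. rewrite sz_pair. pose proof (sz_bool b). lia. }
  pose proof (Hr' z) as Xr. rewrite Hend in Xr.
  pose proof (evb_pow _ _ _ _ _ _ k (Hi w) (Pi w) ltac:(lia)) as Xi.
  pose proof (evb_pow _ _ _ _ _ _ k (He z) (Pe z) ltac:(lia)) as Xe.
  eapply evb_weaken.
  - eapply evb_comp; [|exact Xe]. eapply evb_comp; [exact Xi|].
    eapply lsteps_loop; [exact Hl|exact Xr].
  - change (size (enc z)) with (sz z).
    set (N := (d + 1) * (S + 1) + TL + sz w + 2).
    pose proof (sz_pos w).
    assert (HN : 4 <= N) by (unfold N; nia).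
    assert (HBN : B + 10 <= 5 * N) by (unfold B, N; nia).
    assert (HP : forall a, a <= N + 12 -> a ^ k <= N ^ (2 * k)).
    { intros a Ha. rewrite Nat.pow_mul_r. apply Nat.pow_le_mono_l. simpl. nia. }
    assert (H1 := HP (sz w + 2) ltac:(unfold N; lia)).
    assert (H2 := HP (sz z + 2) ltac:(unfold B, N in *; lia)).
    assert (H3 := HP (B + 2) ltac:(unfold B, N in *; lia)).
    assert (HTL : TL <= N) by (unfold N; lia).
    rewrite Nat.pow_add_r.
    assert (HN6 : 1000 * N <= N ^ 6).
    { assert (4 ^ 5 <= N ^ 5) by (apply Nat.pow_le_mono_l; lia).
      change (N ^ 6) with (N * N ^ 5). change (4 ^ 5) with 1024 in *. nia. }
    set (P := N ^ (2 * k)) in *.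
    assert (1 <= P).
    { unfold P. apply Nat.neq_0_lt_0, Nat.pow_nonzero. lia. }
    assert (n * (40 * (TL + (B + 2) ^ k + B + 10)) <= n * (P * (1000 * N))) by (apply Nat.mul_le_mono_l; nia).
    assert (P * (1000 * N) <= P * N ^ 6) by (apply Nat.mul_le_mono_l; lia).
    assert ((sz w + 2) ^ k + 4 * (sz z + 2) ^ k + 4 * sz z + 10 + (sz z + 2) ^ k <= P * (1000 * N)) by nia.
    nia.
Qed.

(** * Sparsification *)

Lemma mem_spec {X} `{Enc X} (x : X) l : mem x l = true <-> In x l.
Proof.
  unfold mem. rewrite existsb_exists. split.
  - intros (y & Hy & E). apply (proj1 (eqx_spec x y)) in E. now subst.
  - intros Hx. exists x. split; auto. now apply eqx_spec.
Qed.

Lemma subset_spec {X} `{Enc X} (c d : list X) : subset c d = true <-> incl c d.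
Proof.
  unfold subset. rewrite forallb_forall.
  split; intros Hc x Hx; [apply (proj1 (mem_spec x d))|apply (proj2 (mem_spec x d))]; auto.
Qed.

Lemma minus_In {X} `{Enc X} (x : X) c d : In x (minus c d) <-> In x c /\ ~ In x d.
Proof.
  unfold minus. rewrite filter_In, negb_true_iff, <- not_true_iff_false, mem_spec. tauto.
Qed.

Lemma dedup_spec {X} `{Enc X} (l : list X) : NoDup (dedup l) /\ forall x, In x (dedup l) <-> In x l.
Proof.
  unfold dedup.
  enough (forall acc, NoDup acc ->
    NoDup (fold_left (fun acc x => if mem x acc then acc else x :: acc) l acc) /\
    forall x, In x (fold_left (fun acc x => if mem x acc then acc else x :: acc) l acc)
              <-> In x l \/ In x acc) as G.
  { destruct (G [] (NoDup_nil _)) as [G1 G2]. split; auto. intros x. rewrite G2. simpl. tauto. }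
  induction l as [|y l IH]; intros acc Ha; simpl; [tauto|].
  destruct (mem y acc) eqn:Em.
  - apply mem_spec in Em. destruct (IH acc Ha) as [I1 I2]. split; auto.
    intros x. rewrite I2. intuition congruence.
  - rewrite <- not_true_iff_false, mem_spec in Em.
    destruct (IH (y :: acc) (NoDup_cons _ Em Ha)) as [I1 I2]. split; auto.
    intros x. rewrite I2. simpl. intuition.
Qed.

Definition count {X} (p : X -> bool) (l : list X) : nat := length (filter p l).

Lemma count_app {X} (p : X -> bool) l m : count p (l ++ m) = count p l + count p m.
Proof. unfold count. now rewrite filter_app, length_app. Qed.

Lemma count_le {X} (p q : X -> bool) l :
  (forall x, In x l -> p x = true -> q x = true) -> count p l <= count q l.
Proof.
  unfold count. induction l as [|x l IH]; intros Hpq; simpl; [lia|].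
  specialize (IH (fun y Hy => Hpq y (or_intror Hy))).
  specialize (Hpq x (or_introl eq_refl)).
  destruct (p x), (q x); simpl; try lia.
Qed.

Lemma count_filter {X} (p q : X -> bool) l : count p (filter q l) = count (fun x => q x && p x) l.
Proof.
  unfold count. induction l as [|x l IH]; simpl; auto.
  destruct (q x); simpl; [destruct (p x); simpl; auto|auto].
Qed.

Lemma count_orb {X} (p q : X -> bool) l : count (fun x => p x || q x) l <= count p l + count q l.
Proof.
  unfold count. induction l as [|x l IH]; simpl; [lia|].
  destruct (p x), (q x); simpl; lia.
Qed.

Lemma count_existsb {X Y} (R : Y -> X -> bool) l D : forall N,
  (forall n, In n N -> count (R n) l <= D) ->
  count (fun x => existsb (fun n => R n x) N) l <= length N * D.
Proof.
  induction N as [|n N IH]; intros HD; simpl.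
  - clear HD. unfold count. induction l; simpl; auto.
  - etransitivity; [apply count_orb|].
    specialize (IH (fun m Hm => HD m (or_intror Hm))). specialize (HD n (or_introl eq_refl)). lia.
Qed.

Lemma count_none {X} (p : X -> bool) l : (forall x, In x l -> p x = false) -> count p l = 0.
Proof.
  unfold count. induction l as [|x l IH]; intros Hp; simpl; auto.
  rewrite (Hp x (or_introl eq_refl)). apply IH. intros; apply Hp; now right.
Qed.

Lemma minus_length {X} `{Enc X} (c d : list X) :
  NoDup c -> NoDup d -> incl d c -> length (minus c d) + length d = length c.
Proof.
  intros Hc Hd Hi. pose proof (filter_length (fun x => mem x d) c) as HL.
  assert (length (filter (fun x => mem x d) c) = length d).
  { apply Nat.le_antisymm; apply NoDup_incl_length; auto using NoDup_filter.
    - intros x Hx. apply filter_In in Hx as [_ Hx]. now apply mem_spec.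
    - intros x Hx. apply filter_In. split; auto. now apply mem_spec. }
  unfold minus. lia.
Qed.

(** Branching is sound for an arbitrary set [A] of true literals; that [A] comes from an assignment
    matters only for [sat]. *)
Definition hits (A : lit -> bool) (c : list lit) : Prop := exists l, In l c /\ A l = true.
Definition hits_all (A : lit -> bool) (E : cnf) : Prop := Forall (hits A) E.
Definition satisfies (asg : list sym -> bool) (l : lit) : bool := Bool.eqb (asg (snd l)) (fst l).
Definition sat (E : cnf) : Prop := exists asg, hits_all (satisfies asg) E.

Lemma hits_incl A c d : incl c d -> hits A c -> hits A d.
Proof. intros Hi (l & Hl & Ha). exists l. auto. Qed.

Definition antichain (E : cnf) : Prop :=
  NoDup E /\ forall c d, In c E -> In d E -> incl c d -> c = d.
Definition clause_ok (U : list lit) (c : list lit) : Prop :=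
  NoDup c /\ length c <= 3 /\ incl c U.
Definition wf (U : list lit) (E : cnf) : Prop := antichain E /\ Forall (clause_ok U) E.

Definition new_ok (U : list lit) (E N : cnf) : Prop :=
  antichain N /\ forall n, In n N -> clause_ok U n /\ n <> [] /\
    exists c, In c E /\ incl n c /\ length n < length c.

Lemma branch_In N E c : In c (branch N E) <->
  In c N \/ (In c E /\ forall n, In n N -> ~ incl n c).
Proof.
  unfold branch. rewrite in_app_iff, filter_In, negb_true_iff, <- not_true_iff_false, existsb_exists.
  split; (intros [Hc|[Hc Hn]]; [now left|right; split; auto]).
  - intros n Hn' Hi. apply Hn. exists n. split; auto. now apply subset_spec.
  - intros (n & Hn' & Hi). apply (Hn n); auto. now apply subset_spec.
Qed.

(** A new clause is a proper part of an old clause [c]. An old clause inside it would lie inside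
    [c], hence equal [c] in the antichain, which is too long. *)
Lemma no_subclause U E N e n : wf U E -> new_ok U E N -> In n N -> In e E -> ~ incl e n.
Proof.
  intros [[_ Ha] Hf] [_ HN] Hn He Hi. destruct (HN n Hn) as (_ & _ & c & Hc & Hnc & Hlen).
  assert (e = c) by (apply Ha; auto; eapply incl_tran; eauto). subst e.
  rewrite Forall_forall in Hf. destruct (Hf c Hc) as (Hnd & _).
  apply NoDup_incl_length in Hi; auto. lia.
Qed.

Lemma branch_wf U E N : wf U E -> new_ok U E N -> wf U (branch N E).
Proof.
  intros Hw Hn. pose proof (no_subclause U E N) as Hno.
  destruct Hw as [[Hnd Ha] Hf]. pose proof Hn as [[HNnd HNa] HN].
  assert (Hw : wf U E) by (repeat split; auto).
  split; [split|].
  - unfold branch. apply NoDup_app; auto using NoDup_filter.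
    intros c Hc Hc'. apply filter_In in Hc' as [Hc' _].
    apply (Hno c c Hw Hn Hc Hc'). apply incl_refl.
  - intros c d Hc Hd Hi. apply branch_In in Hc as [Hc|[Hc Hc']], Hd as [Hd|[Hd Hd']]; auto.
    + now apply Hd' in Hi.
    + now apply (Hno c d Hw Hn) in Hi.
  - rewrite Forall_forall in *. intros c Hc. apply branch_In in Hc as [Hc|[Hc _]]; auto.
    now apply HN.
Qed.

Lemma hits_branch A N E : hits_all A (branch N E) <-> hits_all A N /\ hits_all A E.
Proof.
  unfold hits_all. rewrite !Forall_forall. split.
  - intros Hb. assert (HN : forall n, In n N -> hits A n).
    { intros n Hn. apply Hb, branch_In. now left. }
    split; auto. intros c Hc.
    destruct (existsb (fun n => subset n c) N) eqn:Ex.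
    + apply existsb_exists in Ex as (n & Hn & Hs). apply subset_spec in Hs.
      eapply hits_incl; eauto.
    + apply Hb, branch_In. right. split; auto. intros n Hn Hi.
      rewrite <- not_true_iff_false, existsb_exists in Ex. apply Ex.
      exists n. split; auto. now apply subset_spec.
  - intros [HN HE] c Hc. apply branch_In in Hc as [Hc|[Hc _]]; auto.
Qed.

Lemma flower_In s H E c : In c (flower s H E) <-> In c E /\ length c = s /\ incl H c.
Proof.
  unfold flower. rewrite filter_In, andb_true_iff, Nat.eqb_eq, subset_spec. tauto.
Qed.

Definition petals (s : nat) (H : list lit) (E : cnf) : cnf :=
  map (fun c => minus c H) (flower s H E).

Lemma hits_expand A s H E : hits_all A E <->
  hits_all A (fst (expand s H E)) \/ hits_all A (snd (expand s H E)).
Proof.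
  unfold expand. cbn [fst snd]. rewrite !hits_branch. split; [|tauto].
  intros HE. destruct (existsb A H) eqn:Ex.
  - left. split; auto. constructor; [|constructor].
    apply existsb_exists in Ex as (l & Hl & Ha). now exists l.
  - right. split; auto. apply Forall_map, Forall_forall. intros c Hc.
    apply flower_In in Hc as (Hc & _ & _). unfold hits_all in HE. rewrite Forall_forall in HE.
    destruct (HE c Hc) as (l & Hl & Ha). exists l. split; auto. apply minus_In. split; auto.
    intros Hl'. rewrite <- not_true_iff_false, existsb_exists in Ex. apply Ex. eauto.
Qed.

Lemma new_heart U E s H : wf U E -> NoDup H -> H <> [] -> length H < s ->
  flower s H E <> [] -> new_ok U E [H].
Proof.
  intros [_ Hf] HH Hne Hs Hfl. destruct (flower s H E) as [|c fl] eqn:Efl; [easy|].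
  assert (In c (flower s H E)) as Hc by (rewrite Efl; now left).
  apply flower_In in Hc as (Hc & Hlen & Hi). rewrite Forall_forall in Hf.
  destruct (Hf c Hc) as (_ & H3 & HU).
  split; [split|].
  - constructor; [easy|constructor].
  - intros ? ? [<-|[]] [<-|[]]; auto.
  - intros n [<-|[]]. split; [|split; [auto|exists c; repeat split; auto; lia]].
    repeat split; auto; [lia|]. eapply incl_tran; eauto.
Qed.

Lemma petals_spec U E s H n : wf U E -> NoDup H -> In n (petals s H E) ->
  exists c, In c E /\ length c = s /\ incl H c /\ n = minus c H /\ length n + length H = s /\ NoDup n.
Proof.
  intros [_ Hf] HH Hn. apply in_map_iff in Hn as (c & <- & Hc).
  apply flower_In in Hc as (Hc & Hlen & Hi). rewrite Forall_forall in Hf.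
  destruct (Hf c Hc) as (Hnd & H3 & HU).
  exists c. repeat split; auto.
  - rewrite minus_length; auto.
  - now apply NoDup_filter.
Qed.

(** All clauses involved contain [H], so an inclusion between remainders lifts to the clauses, and
    these form an antichain. *)
Lemma new_petals U E s H : wf U E -> NoDup H -> H <> [] -> length H < s ->
  new_ok U E (petals s H E).
Proof.
  intros Hw HH Hne Hs. pose proof Hw as [[Hnd Ha] Hf].
  assert (Hinj : forall c d, In c (flower s H E) -> In d (flower s H E) ->
    incl (minus c H) (minus d H) -> c = d).
  { intros c d Hc Hd Hi. apply flower_In in Hc as (Hc & _ & Hic), Hd as (Hd & _ & Hid).
    apply Ha; auto. intros l Hl. destruct (mem l H) eqn:Em.
    - apply mem_spec in Em. auto.
    - rewrite <- not_true_iff_false, mem_spec in Em.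
      assert (In l (minus d H)) as Hl' by (apply Hi, minus_In; auto). now apply minus_In in Hl'. }
  split; [split|].
  - unfold petals.
    assert (NoDup (flower s H E)) as Hfl by (apply NoDup_filter; auto).
    clear -Hfl Hinj. induction Hfl as [|c fl Hc Hfl IH]; simpl; constructor.
    + intros Hin. apply in_map_iff in Hin as (d & Ed & Hd). apply Hc.
      rewrite (Hinj c d); [exact Hd|now left|now right|rewrite Ed; apply incl_refl].
    + apply IH. intros; apply Hinj; auto; now right.
  - intros n m Hn Hm Hi. apply in_map_iff in Hn as (c & <- & Hc), Hm as (d & <- & Hd).
    f_equal. now apply Hinj.
  - intros n Hn. destruct (petals_spec U E s H n Hw HH Hn) as (c & Hc & Hlen & Hi & -> & Hl & Hnn).
    rewrite Forall_forall in Hf. destruct (Hf c Hc) as (_ & H3 & HU).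
    assert (H <> [] -> 1 <= length H) as HL by (destruct H; simpl; [easy|lia]). specialize (HL Hne).
    assert (incl (minus c H) c) by (intros l Hx; now apply minus_In in Hx).
    split; [repeat split; auto; [lia|eapply incl_tran; eauto]|].
    split; [intros E0; rewrite E0 in Hl; simpl in Hl; lia|].
    exists c. repeat split; auto. lia.
Qed.

(** * The potential and its decrease *)

Definition units (E : cnf) : nat := count (fun c => length c =? 1) E.
Definition pairs (E : cnf) : nat := count (fun c => length c =? 2) E.
Definition degree (l : lit) (E : cnf) : nat := count (fun c => (length c =? 2) && mem l c) E.

Lemma length1 {X} (c : list X) : length c = 1 -> exists x, c = [x].
Proof. destruct c as [|x [|]]; simpl; try lia. eauto. Qed.

(** Units never disappear: a nonempty new clause inside a unit would contain that unit, against
    [no_subclause]. *)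
Lemma units_branch U E N : wf U E -> new_ok U E N -> units (branch N E) = units N + units E.
Proof.
  intros Hw Hn. unfold units, branch. rewrite count_app. f_equal. rewrite count_filter.
  unfold count. f_equal. apply filter_ext_in. intros e He.
  destruct (Nat.eqb_spec (length e) 1) as [Hl|]; [|now rewrite andb_false_r].
  rewrite andb_true_r, negb_true_iff, <- not_true_iff_false, existsb_exists.
  intros (n & HN & Hs). apply subset_spec in Hs.
  pose proof Hn as [_ HN']. destruct (HN' n HN) as ((Hnd & _) & Hne & _).
  apply (no_subclause U E N e n Hw Hn HN He).
  apply NoDup_length_incl; auto. destruct n; [easy|]. simpl. lia.
Qed.

Lemma pairs_branch_pairs U E N : wf U E -> new_ok U E N ->
  (forall n, In n N -> length n = 2) -> pairs (branch N E) = length N + pairs E.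
Proof.
  intros Hw Hn H2. unfold pairs, branch. rewrite count_app. f_equal.
  { unfold count. f_equal. apply forallb_filter_id. apply forallb_forall.
    intros n HN. apply Nat.eqb_eq. auto. }
  rewrite count_filter. unfold count. f_equal. apply filter_ext_in. intros e He.
  destruct (Nat.eqb_spec (length e) 2) as [Hl|]; [|now rewrite andb_false_r].
  rewrite andb_true_r, negb_true_iff, <- not_true_iff_false, existsb_exists.
  intros (n & HN & Hs). apply subset_spec in Hs.
  pose proof Hn as [_ HN']. destruct (HN' n HN) as ((Hnd & _) & Hne & _).
  apply (no_subclause U E N e n Hw Hn HN He).
  apply NoDup_length_incl; auto. rewrite (H2 n HN). lia.
Qed.

(** A new unit erases only the 2-clauses that contain its literal, at most [D] of them. *)
Lemma pairs_branch_units E N D : (forall n, In n N -> length n = 1) ->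
  (forall l, degree l E <= D) -> pairs E <= pairs (branch N E) + length N * D.
Proof.
  intros H1 HD. unfold pairs at 2, branch. rewrite count_app, count_filter.
  assert (Hk : count (fun c => existsb (fun n => (length c =? 2) && subset n c) N) E <= length N * D).
  { apply count_existsb. intros n Hn. destruct (length1 n (H1 n Hn)) as (l & ->).
    etransitivity; [|apply (HD l)]. apply count_le. intros c _.
    rewrite !andb_true_iff, subset_spec, mem_spec. intros [-> Hi]. split; auto.
    apply Hi. now left. }
  enough (pairs E <= count (fun x => negb (existsb (fun n => subset n x) N) && (length x =? 2)) E
    + count (fun c => existsb (fun n => (length c =? 2) && subset n c) N) E) by lia.
  etransitivity; [|apply count_orb]. apply count_le. intros c _ Hc. rewrite Hc.
  rewrite andb_true_r, orb_true_iff, negb_true_iff.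
  destruct (existsb (fun n => subset n c) N) eqn:Ex; [right|now left].
  apply existsb_exists in Ex as (n & Hn & Hs). apply existsb_exists. exists n. now rewrite Hs.
Qed.

Lemma degree_branch l N E : degree l (branch N E) <= degree l N + degree l E.
Proof.
  unfold degree, branch. rewrite count_app, count_filter.
  apply Nat.add_le_mono_l. apply count_le. intros c _. rewrite andb_true_iff. tauto.
Qed.

Lemma degree_units l N : (forall n, In n N -> length n = 1) -> degree l N = 0.
Proof. intros H1. apply count_none. intros n Hn. now rewrite (H1 n Hn). Qed.

Lemma units_le U E : wf U E -> units E <= length U.
Proof.
  intros [[Hnd _] Hf]. unfold units, count. rewrite <- (length_map (fun l => [l]) U).
  apply NoDup_incl_length; [now apply NoDup_filter|].
  intros c Hc. apply filter_In in Hc as [Hc Hl]. apply Nat.eqb_eq in Hl.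
  rewrite Forall_forall in Hf. destruct (Hf c Hc) as (_ & _ & HU).
  destruct (length1 c Hl) as (l & ->). apply in_map_iff. exists l. split; auto.
  apply HU. now left.
Qed.

Lemma count_size_le U E s D : wf U E -> s <> 0 ->
  (forall l, In l U -> count (fun c => (length c =? s) && mem l c) E <= D) ->
  count (fun c => length c =? s) E <= length U * D.
Proof.
  intros [_ Hf] Hs HD.
  etransitivity; [|apply (count_existsb (fun l c => (length c =? s) && mem l c)); exact HD].
  apply count_le. intros c Hc Hl. rewrite Forall_forall in Hf. destruct (Hf c Hc) as (_ & _ & HU).
  apply Nat.eqb_eq in Hl. destruct c as [|l c]; [simpl in Hl; lia|].
  apply existsb_exists. exists l. split; [apply HU; now left|].
  rewrite andb_true_iff, Nat.eqb_eq. split; auto. apply mem_spec. now left.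
Qed.

Section Potential.

Variables (U : list lit) (th : nat).

(** The factor 2 makes room for one batch of new 2-clauses: it is added only when degrees are at
    most [th], and contributes at most [th] to each literal. *)
Definition low_degree (E : cnf) : bool := forallb (fun l => degree l E <=? 2 * th) U.

(* Pairs are only credited once all degrees are small, so that a new unit, which erases the
   pairs containing it, still makes the potential drop. *)
Definition potential (E : cnf) : nat :=
  4 * th * (length U - units E)
  + (2 * th * length U - (if low_degree E then pairs E else 0)).

Lemma degree_outside E l : wf U E -> ~ In l U -> degree l E = 0.
Proof.
  intros [_ Hf] Hl. apply count_none. intros c Hc. rewrite Forall_forall in Hf.
  destruct (Hf c Hc) as (_ & _ & HU). rewrite andb_false_iff. right.
  rewrite <- not_true_iff_false, mem_spec. auto.
Qed.

Lemma low_degree_spec E : wf U E -> low_degree E = true <-> forall l, degree l E <= 2 * th.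
Proof.
  intros Hw. unfold low_degree. rewrite forallb_forall. split.
  - intros Hd l. destruct (mem l U) eqn:Em.
    + apply mem_spec in Em. now apply Nat.leb_le, Hd.
    + rewrite <- not_true_iff_false, mem_spec in Em. rewrite degree_outside; auto. lia.
  - intros Hd l _. now apply Nat.leb_le.
Qed.

Lemma pairs_le E : wf U E -> low_degree E = true -> pairs E <= 2 * th * length U.
Proof.
  intros Hw Hd. rewrite low_degree_spec in Hd by auto. rewrite Nat.mul_comm.
  apply count_size_le; [auto|lia|]. intros l _. apply Hd.
Qed.

(** A unit earns [4 * th] and costs at most [2 * th] credited pairs. New units do not raise degrees,
    so the credit is not lost; if it starts only now, the potential falls further. *)
Lemma potential_units E N : wf U E -> new_ok U E N -> (forall n, In n N -> length n = 1) ->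
  potential (branch N E) + 2 * th * length N <= potential E.
Proof.
  intros Hw Hn H1. pose proof (branch_wf _ _ _ Hw Hn) as Hw'.
  pose proof (units_branch _ _ _ Hw Hn) as Hu. pose proof (units_le _ _ Hw') as Hu'.
  assert (units N = length N) as HuN.
  { unfold units, count. f_equal. apply forallb_filter_id, forallb_forall.
    intros n Hx. apply Nat.eqb_eq; auto. }
  unfold potential. destruct (low_degree E) eqn:El.
  - pose proof El as El2. rewrite low_degree_spec in El2 by auto.
    assert (low_degree (branch N E) = true) as El'.
    { apply low_degree_spec; auto. intros l. etransitivity; [apply degree_branch|].
      rewrite degree_units by auto. apply El2. }
    rewrite El'. pose proof (pairs_branch_units E N (2 * th) H1 El2).
    pose proof (pairs_le _ Hw El). nia.
  - destruct (low_degree (branch N E)); nia.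
Qed.

(** No unit and no 2-clause is erased, and degrees stay within [2 * th], so every new pair is
    credited. *)
Lemma potential_pairs E N : wf U E -> new_ok U E N -> (forall n, In n N -> length n = 2) ->
  (forall l, degree l E <= th) -> (forall l, degree l N <= th) ->
  potential (branch N E) + length N <= potential E.
Proof.
  intros Hw Hn H2 HE HN. pose proof (branch_wf _ _ _ Hw Hn) as Hw'.
  pose proof (units_branch _ _ _ Hw Hn) as Hu.
  assert (units N = 0) as HuN by (apply count_none; intros n Hx; now rewrite (H2 n Hx)).
  assert (low_degree E = true) as El.
  { apply low_degree_spec; auto. intros l. specialize (HE l). lia. }
  assert (low_degree (branch N E) = true) as El'.
  { apply low_degree_spec; auto. intros l. etransitivity; [apply degree_branch|].
    specialize (HE l). specialize (HN l). lia. }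
  unfold potential. rewrite El, El'.
  pose proof (pairs_branch_pairs _ _ _ Hw Hn H2). pose proof (pairs_le _ Hw' El').
  rewrite Hu, HuN. simpl. lia.
Qed.

End Potential.

Lemma find_heart_spec th s C E :
  match find_heart th s C E with
  | Some H => In H C /\ th <= length (flower s H E)
  | None => forall H, In H C -> length (flower s H E) < th
  end.
Proof.
  unfold find_heart.
  destruct (filter (fun H => th <=? length (flower s H E)) C) as [|H l] eqn:Ef; simpl.
  - intros H HC. destruct (Nat.lt_ge_cases (length (flower s H E)) th); auto.
    assert (In H (filter (fun H => th <=? length (flower s H E)) C)) as Hin.
    { apply filter_In. split; auto. now apply Nat.leb_le. }
    now rewrite Ef in Hin.
  - assert (In H (filter (fun H => th <=? length (flower s H E)) C)) as Hin
      by (rewrite Ef; now left).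
    apply filter_In in Hin as [HC Hl]. now apply Nat.leb_le in Hl.
Qed.

Lemma flower_hearts1 th s E l : 1 <= th ->
  (forall H, In H (hearts1 E) -> length (flower s H E) < th) -> length (flower s [l] E) < th.
Proof.
  intros Hth Hf. destruct (flower s [l] E) as [|c fl] eqn:Ef; [simpl; lia|]. rewrite <- Ef.
  apply Hf. apply in_map_iff. exists l. split; auto.
  assert (In c (flower s [l] E)) as Hc by (rewrite Ef; now left).
  apply flower_In in Hc as (Hc & _ & Hi). apply in_concat. exists c. split; auto.
  apply Hi. now left.
Qed.

Lemma flower_hearts2 th s E l l' : 1 <= th -> l <> l' ->
  (forall H, In H (hearts2 E) -> length (flower s H E) < th) -> length (flower s [l; l'] E) < th.
Proof.
  intros Hth Hne Hf. destruct (flower s [l; l'] E) as [|c fl] eqn:Ef; [simpl; lia|]. rewrite <- Ef.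
  assert (In c (flower s [l; l'] E)) as Hc by (rewrite Ef; now left).
  apply flower_In in Hc as (Hc & _ & Hi).
  apply Hf. apply in_flat_map. exists l. split.
  - apply in_concat. exists c. split; auto. apply Hi. now left.
  - apply in_map_iff. exists l'. split; auto. apply filter_In. split.
    + apply in_concat. exists c. split; auto. apply Hi. right. now left.
    + apply negb_true_iff. rewrite <- not_true_iff_false, eqx_spec. auto.
Qed.

Lemma hearts1_spec E H : In H (hearts1 E) -> exists l, H = [l].
Proof. intros Hh. apply in_map_iff in Hh as (l & <- & _). eauto. Qed.

Lemma hearts2_spec E H : In H (hearts2 E) -> exists l l', H = [l; l'] /\ l <> l'.
Proof.
  intros Hh. apply in_flat_map in Hh as (l & _ & Hh). apply in_map_iff in Hh as (l' & <- & Hl).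
  apply filter_In in Hl as [_ Hl]. exists l, l'. split; auto. intros <-.
  rewrite (proj2 (eqx_spec l l) eq_refl) in Hl. discriminate.
Qed.

Lemma NoDup1 {X} (x : X) : NoDup [x].
Proof. constructor; [easy|constructor]. Qed.

Lemma NoDup2 {X} (x y : X) : x <> y -> NoDup [x; y].
Proof. intros Hn. constructor; [intros [|[]]; congruence|apply NoDup1]. Qed.

Lemma degree_flower l E : degree l E = length (flower 2 [l] E).
Proof.
  unfold degree, count, flower. f_equal. apply filter_ext. intros c. f_equal.
  unfold subset. simpl. now rewrite andb_true_r.
Qed.

(** A petal containing [l] comes from a 3-clause containing both [h] and [l]; failure of the test on
    pairs thus bounds the degrees of the new 2-clauses. *)
Lemma degree_petals U E h l : wf U E ->
  degree l (petals 3 [h] E) <= (if eqx l h then 0 else length (flower 3 [h; l] E)).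
Proof.
  intros Hw. unfold degree, petals, count.
  assert (Hmf : forall (p : list lit -> bool) (f : list lit -> list lit) L,
    length (filter p (map f L)) = length (filter (fun c => p (f c)) L)).
  { intros p f L. induction L as [|x L IH]; simpl; auto. destruct (p (f x)); simpl; auto. }
  rewrite Hmf. destruct (eqx l h) eqn:Eh.
  - apply (proj1 (eqx_spec l h)) in Eh. subst. apply Nat.le_0_r. apply length_zero_iff_nil.
    destruct (filter _ _) as [|c r] eqn:Ef; auto.
    assert (In c (c :: r)) as Hc by now left. rewrite <- Ef in Hc.
    apply filter_In in Hc as [_ Hc]. apply andb_true_iff in Hc as [_ Hc].
    apply mem_spec, minus_In in Hc as [_ Hc]. elim Hc. now left.
  - apply NoDup_incl_length.
    + apply NoDup_filter, NoDup_filter. apply Hw.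
    + intros c Hc. apply filter_In in Hc as [Hc Hm]. apply andb_true_iff in Hm as [_ Hm].
      apply mem_spec, minus_In in Hm as [Hm _]. apply flower_In in Hc as (Hc & Hl & Hi).
      apply flower_In. repeat split; auto. intros x [<-|[<-|[]]]; auto. apply Hi. now left.
Qed.

Definition sparse (U : list lit) (th1 th2 : nat) (E : cnf) : Prop :=
  length E <= 1 + length U * (1 + th1 + th2).

Lemma clauses_by_length U E : wf U E ->
  length E <= 1 + units E + pairs E + count (fun c => length c =? 3) E.
Proof.
  intros [[Hnd _] Hf].
  assert (H0 : count (fun c : list lit => length c =? 0) E <= 1).
  { unfold count. change 1 with (length [@nil lit]). apply NoDup_incl_length.
    - now apply NoDup_filter.
    - intros c Hc. apply filter_In in Hc as [_ Hc]. apply Nat.eqb_eq in Hc.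
      destruct c; [now left|discriminate]. }
  enough (length E <= count (fun c : list lit => length c =? 0) E + units E + pairs E
    + count (fun c => length c =? 3) E) by lia.
  clear Hnd H0. unfold units, pairs, count.
  induction Hf as [|c E (_ & H3 & _) Hf IH]; simpl; [lia|].
  destruct c as [|? [|? [|? [|]]]]; simpl in *; lia.
Qed.

(** The drop depends on the type of heart and petals: a unit is worth [2 * th1], a pair 1. Petals
    that are units come at least [th1] at a time, petals that are pairs at least [th2]. *)
Lemma split_spec U th1 th2 E : 1 <= th1 -> 1 <= th2 -> wf U E ->
  match split_cnf th1 th2 E with
  | Some (E1, E2) =>
      wf U E1 /\ wf U E2 /\ (forall A, hits_all A E <-> hits_all A E1 \/ hits_all A E2) /\
      exists a b, potential U th1 E1 + a <= potential U th1 E /\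
        potential U th1 E2 + b <= potential U th1 E /\
        ((a = 1 /\ b = 2 * th1 * th1) \/ (a = 2 * th1 /\ b = th2))
  | None => sparse U th1 th2 E
  end.
Proof.
  intros Ht1 Ht2 Hw.
  assert (Hgen : forall s H, NoDup H -> H <> [] -> length H < s -> 1 <= length (flower s H E) ->
    wf U (branch [H] E) /\ wf U (branch (petals s H E) E) /\
    new_ok U E [H] /\ new_ok U E (petals s H E)).
  { intros s H HH Hne Hs Hf.
    assert (new_ok U E [H]).
    { eapply new_heart; eauto. intros E0. rewrite E0 in Hf. simpl in Hf. lia. }
    pose proof (new_petals U E s H Hw HH Hne Hs). auto using branch_wf. }
  unfold split_cnf.
  pose proof (find_heart_spec th1 2 (hearts1 E) E) as HA.
  destruct (find_heart th1 2 (hearts1 E) E) as [H|].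
  { destruct HA as [HC Hl]. destruct (hearts1_spec _ _ HC) as (l & ->).
    destruct (Hgen 2 [l] (NoDup1 l) ltac:(discriminate) ltac:(simpl; lia) ltac:(lia)) as (W1 & W2 & N1 & N2).
    split; [exact W1|]. split; [exact W2|]. split; [intros A; apply hits_expand|].
    (* The heart is a unit and even yields [2 * th1]; only 1 is recorded, so that this case shares
       the recurrence of the next one. *)
    exists 1, (2 * th1 * th1). split; [|split; [|now left]].
    - pose proof (potential_units U th1 E [[l]] Hw N1) as Hp. simpl length in Hp.
      specialize (Hp ltac:(intros n [<-|[]]; reflexivity)). lia.
    - pose proof (potential_units U th1 E (petals 2 [l] E) Hw N2) as Hp.
      specialize (Hp ltac:(intros n Hn; destruct (petals_spec U E 2 [l] n Hw (NoDup1 l) Hn)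
        as (c & _ & _ & _ & _ & Hln & _); simpl in Hln; lia)).
      unfold petals in Hp at 2. rewrite length_map in Hp.
      fold (petals 2 [l] E).
      assert (2 * th1 * th1 <= 2 * th1 * length (flower 2 [l] E)) by (apply Nat.mul_le_mono_l; lia).
      lia. }
  assert (HA' : forall l, degree l E <= th1).
  { intros l. rewrite degree_flower. apply Nat.lt_le_incl. apply flower_hearts1; auto. }
  pose proof (find_heart_spec th1 3 (hearts2 E) E) as HB.
  destruct (find_heart th1 3 (hearts2 E) E) as [H|].
  { destruct HB as [HC Hl]. destruct (hearts2_spec _ _ HC) as (l & l' & -> & Hne).
    pose proof (NoDup2 l l' Hne) as Hnd2.
    destruct (Hgen 3 [l; l'] Hnd2 ltac:(discriminate) ltac:(simpl; lia) ltac:(lia)) as (W1 & W2 & N1 & N2).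
    split; [exact W1|]. split; [exact W2|]. split; [intros A; apply hits_expand|].
    exists 1, (2 * th1 * th1). split; [|split; [|now left]].
    - pose proof (potential_pairs U th1 E [[l; l']] Hw N1 ltac:(intros n [<-|[]]; reflexivity) HA') as Hp.
      apply Hp. intros x. etransitivity; [apply filter_length_le|simpl; lia].
    - pose proof (potential_units U th1 E (petals 3 [l; l'] E) Hw N2) as Hp.
      specialize (Hp ltac:(intros n Hn; destruct (petals_spec U E 3 [l; l'] n Hw Hnd2 Hn)
        as (c & _ & _ & _ & _ & Hln & _); simpl in Hln; lia)).
      unfold petals in Hp at 2. rewrite length_map in Hp.
      fold (petals 3 [l; l'] E).
      assert (2 * th1 * th1 <= 2 * th1 * length (flower 3 [l; l'] E)) by (apply Nat.mul_le_mono_l; lia).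
      lia. }
  pose proof (find_heart_spec th2 3 (hearts1 E) E) as HD.
  destruct (find_heart th2 3 (hearts1 E) E) as [H|].
  { destruct HD as [HC Hl]. destruct (hearts1_spec _ _ HC) as (l & ->).
    destruct (Hgen 3 [l] (NoDup1 l) ltac:(discriminate) ltac:(simpl; lia) ltac:(lia)) as (W1 & W2 & N1 & N2).
    split; [exact W1|]. split; [exact W2|]. split; [intros A; apply hits_expand|].
    exists (2 * th1), th2. split; [|split; [|now right]].
    - pose proof (potential_units U th1 E [[l]] Hw N1) as Hp. simpl length in Hp.
      specialize (Hp ltac:(intros n [<-|[]]; reflexivity)). lia.
    - pose proof (potential_pairs U th1 E (petals 3 [l] E) Hw N2) as Hp.
      specialize (Hp ltac:(intros n Hn; destruct (petals_spec U E 3 [l] n Hw (NoDup1 l) Hn)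
        as (c & _ & _ & _ & _ & Hln & _); simpl in Hln; lia) HA').
      unfold petals in Hp at 3. rewrite length_map in Hp.
      fold (petals 3 [l] E).
      enough (forall x, degree x (petals 3 [l] E) <= th1) as Hx by (specialize (Hp Hx); lia).
      intros x. etransitivity; [apply (degree_petals U E l x Hw)|].
      destruct (eqx x l) eqn:Ex; [lia|]. apply Nat.lt_le_incl, flower_hearts2; auto.
      intros <-. rewrite (proj2 (eqx_spec l l) eq_refl) in Ex. discriminate. }
  unfold sparse.
  pose proof (clauses_by_length U E Hw). pose proof (units_le U E Hw).
  assert (pairs E <= length U * th1) by (apply count_size_le; [auto|lia|intros l _; apply HA']).
  assert (count (fun c => length c =? 3) E <= length U * th2).
  { apply count_size_le; [auto|lia|]. intros l _.
    transitivity (length (flower 3 [l] E)); [|apply Nat.lt_le_incl, flower_hearts1; auto].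
    unfold flower. apply count_le. intros c _. rewrite !andb_true_iff.
    unfold subset. simpl. rewrite andb_true_r. tauto. }
  lia.
Qed.

Lemma sat_split E E1 E2 : (forall A, hits_all A E <-> hits_all A E1 \/ hits_all A E2) ->
  (sat E <-> sat E1 \/ sat E2).
Proof.
  intros He. unfold sat. split.
  - intros (asg & Ha). apply He in Ha as [Ha|Ha]; eauto.
  - intros [(asg & Ha)|(asg & Ha)]; exists asg; apply He; auto.
Qed.

(** A binary tree with L leaves has 2L - 1 nodes; the recurrence bounds L by [z] to the potential.
    Both branches lower the potential, so it bounds the depth as well. *)
Lemma search_exists U th1 th2 leaf S TL (z : R) :
  1 <= th1 -> 1 <= th2 ->
  (1 <= z)%R -> (/ z + / z ^ (2 * th1 * th1) <= 1)%R -> (/ z ^ (2 * th1) + / z ^ th2 <= 1)%R ->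
  (forall E, wf U E -> sz E <= S) ->
  (forall E, wf U E -> sparse U th1 th2 E ->
     exists b, evb leaf (enc E) (tbool b) TL /\ (b = true <-> sat E)) ->
  forall E, wf U E -> exists b n,
    (forall d, potential U th1 E <= d -> search (split_cnf th1 th2) leaf S TL E b n d) /\
    (b = true <-> sat E) /\ (INR n <= 2 * z ^ potential U th1 E - 1)%R.
Proof.
  intros Ht1 Ht2 Hz Hz1 Hz2 HS Hleaf E.
  assert (Hzp : forall k, (1 <= z ^ k)%R) by (intros; now apply pow_R1_Rle).
  remember (potential U th1 E) as p eqn:Ep. revert E Ep.
  induction p as [p IH] using lt_wf_ind. intros E Ep Hw. subst p.
  pose proof (split_spec U th1 th2 E Ht1 Ht2 Hw) as Hsp.
  destruct (split_cnf th1 th2 E) as [[E1 E2]|] eqn:Es.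
  - destruct Hsp as (W1 & W2 & He & a & b & Ha & Hb & Hab).
    assert (1 <= a /\ 1 <= b) as [La Lb] by (destruct Hab as [[-> ->]|[-> ->]]; nia).
    destruct (IH (potential U th1 E1) ltac:(lia) E1 eq_refl W1) as (b1 & n1 & S1 & C1 & B1).
    destruct (IH (potential U th1 E2) ltac:(lia) E2 eq_refl W2) as (b2 & n2 & S2 & C2 & B2).
    exists (b1 || b2), (Datatypes.S (n1 + n2)). split; [|split].
    + intros [|d] Hd; [lia|]. eapply sNode; eauto; [apply S1|apply S2]; lia.
    + rewrite orb_true_iff, C1, C2. symmetry. now apply sat_split.
    + rewrite S_INR, plus_INR.
      assert (Hdrop : forall p q c, p + c <= q -> (z ^ p <= z ^ q * / z ^ c)%R).
      { intros p q c Hpq. apply (Rmult_le_reg_r (z ^ c)); [specialize (Hzp c); lra|].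
        rewrite Rmult_assoc, Rinv_l, Rmult_1_r by (specialize (Hzp c); lra).
        rewrite <- pow_add. apply Rle_pow; auto. }
      pose proof (Hdrop _ _ _ Ha) as D1. pose proof (Hdrop _ _ _ Hb) as D2.
      assert (Hsum : (/ z ^ a + / z ^ b <= 1)%R).
      { destruct Hab as [[-> ->]|[-> ->]]; auto. rewrite pow_1. auto. }
      assert (z ^ potential U th1 E * (/ z ^ a + / z ^ b) <= z ^ potential U th1 E * 1)%R.
      { apply Rmult_le_compat_l; auto. specialize (Hzp (potential U th1 E)). lra. }
      lra.
  - destruct (Hleaf E Hw Hsp) as (b & Hev & Hb). exists b, 1. split; [|split; auto].
    + intros d _. now apply sLeaf; auto.
    + simpl. specialize (Hzp (potential U th1 E)). lra.
Qed.

Lemma potential_le U th E : potential U th E <= 6 * th * length U.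
Proof. unfold potential. destruct (low_degree U th E); nia. Qed.

(** * Size of formulas and preprocessing *)

Fixpoint lists_of_length (U : list lit) (k : nat) : cnf :=
  match k with
  | 0 => [[]]
  | S k => flat_map (fun l => map (cons l) (lists_of_length U k)) U
  end.

Lemma lists_of_length_length U k : length (lists_of_length U k) = length U ^ k.
Proof.
  induction k; simpl; auto. rewrite <- IHk. generalize (lists_of_length U k). intros L.
  clear. induction U; simpl; auto. rewrite length_app, length_map. lia.
Qed.

Lemma lists_of_length_In U c : incl c U -> In c (lists_of_length U (length c)).
Proof.
  induction c as [|l c IH]; intros Hi; simpl; [now left|].
  apply in_flat_map. exists l. split; [apply Hi; now left|].
  apply in_map. apply IH. intros x Hx. apply Hi. now right.
Qed.

(** A polynomial bound for the inner nodes of the search too, where formulas are not yet sparse: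
    there are only so many clauses of at most three literals. *)
Lemma wf_length U E : wf U E -> length E <= 4 * (length U + 1) ^ 3.
Proof.
  intros [[Hnd _] Hf].
  transitivity (length (flat_map (lists_of_length U) [0; 1; 2; 3])).
  - apply NoDup_incl_length; auto. intros c Hc. rewrite Forall_forall in Hf.
    destruct (Hf c Hc) as (_ & H3 & HU). apply in_flat_map. exists (length c).
    split; [|now apply lists_of_length_In]. simpl. lia.
  - change (flat_map (lists_of_length U) [0; 1; 2; 3]) with
      (lists_of_length U 0 ++ lists_of_length U 1 ++ lists_of_length U 2 ++ lists_of_length U 3 ++ []).
    rewrite !length_app, !lists_of_length_length. simpl. nia.
Qed.

Lemma wf_sz U E L : wf U E -> (forall l, In l U -> sz l <= L) ->
  sz E <= 1 + 4 * (length U + 1) ^ 3 * (3 * L + 5).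
Proof.
  intros Hw HL. pose proof (wf_length U E Hw) as Hlen. destruct Hw as [_ Hf].
  enough (sz E <= 1 + length E * (3 * L + 5)) by nia. clear Hlen.
  induction Hf as [|c E (_ & H3 & HU) Hf IH]; [apply le_n|].
  rewrite sz_cons. simpl length. enough (sz c <= 1 + 3 * (L + 1)) by lia.
  enough (sz c <= 1 + length c * (L + 1)) by nia. clear -HL HU.
  induction c as [|l c IH]; [apply le_n|]. rewrite sz_cons. simpl length.
  pose proof (HL l (HU l (or_introl eq_refl))).
  specialize (IH (fun x Hx => HU x (or_intror Hx))). lia.
Qed.

Lemma ins_spec U E c : wf U E -> clause_ok U c ->
  wf U (ins E c) /\ forall A, hits_all A (ins E c) <-> hits_all A E /\ hits A c.
Proof.
  intros [[Hnd Ha] Hf] Hc. unfold ins, hits_all.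
  destruct (existsb (fun e => subset e c) E) eqn:Ex.
  - split; [repeat split; auto|]. intros A. split; [|tauto]. intros HE. split; auto.
    apply existsb_exists in Ex as (e & He & Hs). apply subset_spec in Hs.
    rewrite Forall_forall in HE. eapply hits_incl; eauto.
  - rewrite <- not_true_iff_false, existsb_exists in Ex.
    assert (Hno : forall e, In e E -> ~ incl e c).
    { intros e He Hi. apply Ex. exists e. split; auto. now apply subset_spec. }
    assert (Hk : forall e, In e (filter (fun e => negb (subset c e)) E) <-> In e E /\ ~ incl c e).
    { intros e. rewrite filter_In, negb_true_iff, <- not_true_iff_false, subset_spec. tauto. }
    split; [split; [split|]|].
    + constructor; [|now apply NoDup_filter]. rewrite Hk. intros [_ Hn]. apply Hn, incl_refl.
    + intros d e [<-|Hd] [<-|He] Hi; auto; rewrite ?Hk in *.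
      * tauto.
      * now apply Hno in Hi.
      * apply Ha; tauto.
    + constructor; auto. rewrite Forall_forall in *. intros e He. apply Hk in He. apply Hf. tauto.
    + intros A. rewrite Forall_cons_iff, !Forall_forall. split; intros HA.
      * split; [|tauto]. intros e He. destruct (subset c e) eqn:Es.
        -- apply subset_spec in Es. eapply hits_incl; eauto. tauto.
        -- apply HA, Hk. split; auto. rewrite <- subset_spec, Es. discriminate.
      * split; [tauto|]. intros e He. apply HA. apply Hk in He. tauto.
Qed.

Lemma reduce_spec U F : Forall (clause_ok U) F ->
  wf U (reduce F) /\ forall A, hits_all A (reduce F) <-> hits_all A F.
Proof.
  intros HF. unfold reduce.
  enough (forall E, wf U E -> wf U (fold_left ins F E) /\
    forall A, hits_all A (fold_left ins F E) <-> hits_all A E /\ hits_all A F) as G.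
  { destruct (G []) as [G1 G2].
    - repeat split; auto using NoDup_nil. intros ? ? [].
    - split; auto. intros A. rewrite G2. unfold hits_all. split; [tauto|]. split; auto. }
  induction HF as [|c F Hc HF IH]; intros E HE; simpl.
  - split; auto. intros A. unfold hits_all. split; [|tauto]. split; auto.
  - destruct (ins_spec U E c HE Hc) as [I1 I2]. destruct (IH _ I1) as [J1 J2]. split; auto.
    intros A. rewrite J2, I2. unfold hits_all. rewrite Forall_cons_iff. tauto.
Qed.

Lemma normalize_spec U F : Forall (fun c => length c <= 3 /\ incl c U) F ->
  wf U (normalize F) /\ (sat (normalize F) <-> sat F).
Proof.
  intros HF. unfold normalize. destruct (reduce_spec U (map dedup F)) as [H1 H2].
  - apply Forall_map. eapply Forall_impl; [|exact HF]. intros c [H3 HU].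
    destruct (dedup_spec c) as [D1 D2]. repeat split; auto.
    + etransitivity; [apply NoDup_incl_length|exact H3]; auto. intros x Hx. now apply D2.
    + intros x Hx. apply HU. now apply D2.
  - split; auto. unfold sat.
    enough (forall A, hits_all A (reduce (map dedup F)) <-> hits_all A F) as G.
    { split; intros (asg & Ha); exists asg; now apply G. }
    intros A. rewrite H2. unfold hits_all. rewrite Forall_map.
    split; apply Forall_impl; intros c (l & Hl & Ha); exists l; (split; [now apply (dedup_spec c)|auto]).
Qed.

(** * Parsing *)

Definition name (v : nat) : list sym := rev (enc_nat v).
Definition rename (l : literal) : lit := (fst l, name (snd l)).

Lemma pos_bits_inj p : forall q, pos_bits p = pos_bits q -> p = q.
Proof.
  induction p; destruct q; simpl; intros E; try congruence;
    try (destruct p; discriminate); try (destruct q; discriminate);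
    injection E as E; f_equal; auto.
Qed.

Lemma enc_nat_inj v v' : enc_nat v = enc_nat v' -> v = v'.
Proof.
  unfold enc_nat. intros E. apply Nat2N.inj.
  destruct (N.of_nat v) as [|p], (N.of_nat v') as [|q]; auto;
    [destruct q; discriminate|destruct p; discriminate|].
  f_equal. now apply pos_bits_inj.
Qed.

Lemma name_inj v v' : name v = name v' -> v = v'.
Proof. unfold name. intros E. apply enc_nat_inj. rewrite <- (rev_involutive (enc_nat v)), E. apply rev_involutive. Qed.

Lemma enc_nat_bits v : Forall is_bit (enc_nat v).
Proof.
  unfold enc_nat. destruct (N.of_nat v) as [|p]; [constructor|].
  induction p; simpl; constructor; auto; (now left) || (now right).
Qed.

Lemma bit_not_sep a : is_bit a -> is_sep a = false.
Proof. now intros [->| ->]. Qed.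

Lemma parse_header l s : Forall is_bit l ->
  fold_left parse_step (l ++ [Sep]) (false, s) = (true, s).
Proof.
  induction 1 as [|a l Ha Hl IH]; simpl; [reflexivity|].
  unfold parse_step at 2. simpl. now rewrite (bit_not_sep a Ha).
Qed.

Lemma parse_bits l : Forall is_bit l -> forall cls cur b acc,
  fold_left parse_step (l ++ [Sep]) (true, (cls, (cur, Some (b, acc))))
  = (true, (cls, ((b, rev l ++ acc) :: cur, None))).
Proof.
  induction 1 as [|a l Ha Hl IH]; intros; simpl; [reflexivity|].
  unfold parse_step at 2. simpl. rewrite (bit_not_sep a Ha), IH, <- app_assoc. reflexivity.
Qed.

Lemma parse_literal l cls cur :
  fold_left parse_step (enc_literal l) (true, (cls, (cur, None)))
  = (true, (cls, (rename l :: cur, None))).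
Proof.
  unfold enc_literal. destruct l as [b v]. simpl.
  unfold parse_step at 2. simpl.
  replace (is_sep (if b then One else Zero)) with false by now destruct b.
  rewrite (parse_bits _ (enc_nat_bits v)), app_nil_r. now destruct b.
Qed.

Lemma parse_clause cl cls :
  fold_left parse_step (enc_clause cl) (true, (cls, ([], None)))
  = (true, (rev (map rename cl) :: cls, ([], None))).
Proof.
  unfold enc_clause. rewrite fold_left_app.
  assert (G : forall cur, fold_left parse_step (concat (map enc_literal cl)) (true, (cls, (cur, None)))
    = (true, (cls, (rev (map rename cl) ++ cur, None)))).
  { induction cl as [|l cl IH]; intros cur; cbn [map concat rev app]; [reflexivity|].
    rewrite fold_left_app, parse_literal, IH, <- app_assoc. reflexivity. }
  rewrite G, app_nil_r. reflexivity.
Qed.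

Lemma parse_enc_sat F :
  parse (enc_sat F) = rev (map (fun cl => rev (map rename cl)) (snd F)).
Proof.
  unfold parse, enc_sat. rewrite app_assoc, fold_left_app, (parse_header _ _ (enc_nat_bits _)).
  assert (G : forall cls, fold_left parse_step (concat (map enc_clause (snd F))) (true, (cls, ([], None)))
    = (true, (rev (map (fun cl => rev (map rename cl)) (snd F)) ++ cls, ([], None)))).
  { induction (snd F) as [|c l IH]; intros cls; cbn [map concat rev app]; [reflexivity|].
    rewrite fold_left_app, parse_clause, IH, <- app_assoc. reflexivity. }
  now rewrite G, app_nil_r.
Qed.

Lemma sat_parse F : valid_3sat F -> (sat (parse (enc_sat F)) <-> satisfiable F).
Proof.
  intros HF. rewrite parse_enc_sat. unfold sat, satisfiable, hits_all.
  assert (Hr : forall (P : list lit -> Prop) L, Forall P (rev L) <-> Forall P L).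
  { intros P L. split; intros H; apply Forall_rev in H; [rewrite rev_involutive in H|]; exact H. }
  split; intros (asg & Ha).
  - exists (fun v => asg (name v)). rewrite Hr, Forall_map in Ha.
    eapply Forall_impl; [|exact Ha]. intros cl (l' & Hl & Hs).
    apply in_rev, in_map_iff in Hl as (l & <- & Hl). exists l. split; auto.
    unfold satisfies in Hs. now apply eqb_prop in Hs.
  (* An assignment of names is obtained by inverting [name] through a search below the number of
     variables, where validity places all indices. *)
  - exists (fun x => existsb (fun v => eqx x (name v) && asg v) (seq 0 (fst F))).
    rewrite Hr, Forall_map. rewrite Forall_forall in *. intros cl Hcl.
    destruct (Ha cl Hcl) as (l & Hl & Hs). exists (rename l). split.
    { rewrite <- in_rev. now apply in_map. }
    unfold valid_3sat in HF. rewrite Forall_forall in HF. destruct (HF cl Hcl) as [_ Hv].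
    rewrite Forall_forall in Hv. specialize (Hv l Hl).
    unfold satisfies, rename. cbn [fst snd]. rewrite <- Hs. apply eqb_true_iff.
    apply eq_iff_eq_true. rewrite existsb_exists. split.
    + intros (v & _ & E). apply andb_true_iff in E as [E1 E2].
      apply (proj1 (eqx_spec _ _)) in E1. apply name_inj in E1. now rewrite E1.
    + intros E. exists (snd l). split; [apply in_seq; lia|].
      now rewrite (proj2 (eqx_spec _ _) eq_refl).
Qed.

Definition universe (E : cnf) : list lit := flat_map (fun v => [(true, v); (false, v)]) (vars E).

Lemma vars_In E v : In v (vars E) <-> exists c l, In c E /\ In l c /\ snd l = v.
Proof.
  unfold vars. destruct (dedup_spec (map snd (concat E))) as [_ D]. rewrite D, in_map_iff.
  split.
  - intros (l & <- & Hl). apply in_concat in Hl as (c & Hc & Hl). eauto.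
  - intros (c & l & Hc & Hl & <-). exists l. split; auto. apply in_concat. eauto.
Qed.

Lemma universe_In E l : In l (universe E) <-> In (snd l) (vars E).
Proof.
  unfold universe. rewrite in_flat_map. split.
  - intros (v & Hv & [<-|[<-|[]]]); auto.
  - intros Hl. exists (snd l). split; auto. destruct l as [[] v]; simpl; auto.
Qed.

Lemma universe_length E : length (universe E) = 2 * length (vars E).
Proof. unfold universe. induction (vars E); simpl; lia. Qed.

Lemma valid_clauses F : valid_3sat F ->
  Forall (fun c => length c <= 3 /\ incl c (universe (parse (enc_sat F)))) (parse (enc_sat F)).
Proof.
  intros HF. set (E := parse (enc_sat F)). apply Forall_forall. intros c Hc. split.
  - unfold E in Hc. rewrite parse_enc_sat in Hc. apply in_rev, in_map_iff in Hc as (cl & <- & Hcl).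
    unfold valid_3sat in HF. rewrite Forall_forall in HF.
    rewrite length_rev, length_map. now apply HF.
  - intros l Hl. apply universe_In, vars_In. eauto.
Qed.

(** This ties the exponents of the whole analysis to the number of variables that ETH refers to. *)
Lemma vars_le_nvars F : valid_3sat F -> length (vars (parse (enc_sat F))) <= sat_nvars F.
Proof.
  intros HF. unfold sat_nvars. rewrite <- (length_seq (fst F) 0), <- (length_map name).
  apply NoDup_incl_length; [apply dedup_spec|].
  intros v Hv. apply vars_In in Hv as (c & l & Hc & Hl & <-).
  rewrite parse_enc_sat in Hc. apply in_rev, in_map_iff in Hc as (cl & <- & Hcl).
  apply in_rev, in_map_iff in Hl as (l0 & <- & Hl0).
  unfold valid_3sat in HF. rewrite Forall_forall in HF. destruct (HF cl Hcl) as [_ Hv].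
  rewrite Forall_forall in Hv. change (snd (rename l0)) with (name (snd l0)). apply in_map, in_seq. specialize (Hv l0 Hl0). lia.
Qed.

Lemma enc_sat_nonblank F : Forall (fun a => a <> Blank) (enc_sat F).
Proof.
  assert (Hn : forall v, Forall (fun a => a <> Blank) (enc_nat v)).
  { intros v. eapply Forall_impl; [|apply enc_nat_bits]. intros a [->| ->]; discriminate. }
  unfold enc_sat. apply Forall_app. split; auto. constructor; [discriminate|].
  apply Forall_concat, Forall_map, Forall_forall. intros cl _. unfold enc_clause.
  apply Forall_app. split; [|constructor; [discriminate|constructor]].
  apply Forall_concat, Forall_map, Forall_forall. intros [[] v] _; unfold enc_literal; simpl;
    (constructor; [discriminate|]); apply Forall_app; (split; auto;
    constructor; [discriminate|constructor]).
Qed.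

(** * Binary and octal numerals *)

Fixpoint bval (s : list bool) : nat :=
  match s with [] => 0 | b :: s => (if b then 1 else 0) + 2 * bval s end.

(** Base 8 leaves room in the middle block: with one number per group, a clause collects at most 3
    from its literals and 2 from its slack. *)
Fixpoint dval (ds : list nat) : nat :=
  match ds with [] => 0 | d :: ds => d + 8 * dval ds end.

Lemma bval_bits ds : Forall (fun d => d <= 3) ds -> bval (bits ds) = dval (ds ++ [1]).
Proof.
  unfold bits. induction 1 as [|d ds Hd _ IH]; [reflexivity|].
  cbn [flat_map app dval]. rewrite <- IH, <- app_assoc.
  generalize (flat_map digit_bits ds ++ [true]). intros X.
  destruct d as [|[|[|[|]]]]; try lia; simpl; lia.
Qed.

Lemma dval_app a b : dval (a ++ b) = dval a + 8 ^ length a * dval b.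
Proof. induction a; cbn [app dval length Nat.pow]; [lia|]. rewrite IHa. lia. Qed.

Lemma bval_app a b : bval (a ++ b) = bval a + 2 ^ length a * bval b.
Proof. induction a; cbn [app bval length Nat.pow]; [lia|]. rewrite IHa. lia. Qed.

Lemma bval_lt s : bval s < 2 ^ length s.
Proof. induction s as [|[] s IH]; cbn [bval length Nat.pow]; lia. Qed.

Definition canonical (s : list bool) : Prop := exists s', s = s' ++ [true].

(** A leading one is what makes a bit string the encoding of its value, so the algorithm can write
    the instance without computing any number. *)
Lemma enc_nat_bval s : canonical s -> enc_nat (bval s) = map bsym s.
Proof.
  intros (s' & ->). unfold enc_nat.
  enough (exists p, N.of_nat (bval (s' ++ [true])) = Npos p /\ pos_bits p = map bsym (s' ++ [true]))
    as (p & -> & Hp) by exact Hp.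
  induction s' as [|b s IH]; [exists xH; split; reflexivity|].
  destruct IH as (p & Ep & Hp). exists (if b then xI p else xO p). split.
  - cbn [app bval]. rewrite Nat2N.inj_add, Nat2N.inj_mul, Ep. destruct b; reflexivity.
  - cbn [app map]. rewrite <- Hp. now destruct b.
Qed.

Lemma canonical_pos s : canonical s -> 2 ^ (length s - 1) <= bval s.
Proof.
  intros (s' & ->). rewrite bval_app, length_app. simpl. rewrite Nat.add_sub. lia.
Qed.

Lemma bval_inj s s' : canonical s -> canonical s' -> bval s = bval s' -> s = s'.
Proof.
  intros H H' E. pose proof (enc_nat_bval s H) as E1. rewrite E, (enc_nat_bval s' H') in E1.
  clear - E1. revert s' E1. induction s as [|b s IH]; intros [|b' s'] E; simpl in E; try congruence.
  injection E as E1 E2. f_equal; auto. destruct b, b'; simpl in *; congruence.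
Qed.

Lemma canonical_bits ds : canonical (bits ds).
Proof. now exists (flat_map digit_bits ds). Qed.

(** * Sums with repetition *)

(** Multiplicities become a list with repetitions, on which one can use induction and sort by
    groups. *)
Lemma ssm_yes_picks l t : ssm_yes (l, t) <-> exists ps, incl ps l /\ list_sum ps = t.
Proof.
  unfold ssm_yes. cbn [fst snd]. split.
  - intros (lam & <-).
    exists (flat_map (fun i => repeat (nth i l 0) (lam i)) (seq 0 (length l))). split.
    + intros x Hx. apply in_flat_map in Hx as (i & Hi & Hx). apply repeat_spec in Hx. subst.
      apply in_seq in Hi. apply nth_In. lia.
    + induction (seq 0 (length l)) as [|i r IH]; simpl; auto.
      rewrite list_sum_app, IH. f_equal. induction (lam i); simpl; lia.
  - intros (ps & Hi & <-). induction ps as [|p ps IH].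
    + exists (fun _ => 0). simpl. induction (seq 0 (length l)); simpl; auto.
    + destruct IH as (lam & Hlam); [intros x Hx; apply Hi; now right|].
      destruct (In_nth l p 0 (Hi p (or_introl eq_refl))) as (j & Hj & Ej).
      exists (fun i => (if i =? j then 1 else 0) + lam i).
      cbn [list_sum fold_right]. fold (list_sum ps). rewrite <- Hlam, <- Ej.
      assert (G : forall a b, a <= j < a + b ->
        list_sum (map (fun i => ((if i =? j then 1 else 0) + lam i) * nth i l 0) (seq a b))
        = nth j l 0 + list_sum (map (fun i => lam i * nth i l 0) (seq a b))).
      { assert (G0 : forall a b, ~ a <= j < a + b ->
          list_sum (map (fun i => ((if i =? j then 1 else 0) + lam i) * nth i l 0) (seq a b))
          = list_sum (map (fun i => lam i * nth i l 0) (seq a b))).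
        { intros a b. revert a. induction b as [|b IH]; intros a Hab; simpl; auto.
          rewrite IH by lia. destruct (Nat.eqb_spec a j); [lia|]. lia. }
        intros a b. revert a. induction b as [|b IH]; intros a Hab; [lia|]. simpl.
        destruct (Nat.eqb_spec a j) as [->|].
        - rewrite G0 by lia. lia.
        - rewrite IH by lia. lia. }
      apply G. lia.
Qed.

(** * Groups of options *)

(** The octal number of [n] ones, (8^n - 1) / 7. *)
Definition repunit (n : nat) : nat := dval (repeat 1 n).

Lemma repunit_lt n : 7 * repunit n + 1 = 8 ^ n.
Proof. unfold repunit. induction n; cbn [repeat dval Nat.pow]; lia. Qed.

Lemma repunit_S n : repunit (S n) = 8 ^ n + repunit n.
Proof. pose proof (repunit_lt n). pose proof (repunit_lt (S n)). cbn [Nat.pow] in *. lia. Qed.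

Definition item_value (i j m u : nat) : nat :=
  8 ^ i + 8 ^ (i + S j) * u + 8 ^ (i + S j + m) * 8 ^ j.

Lemma dval_zeros {X} (l : list X) : dval (zeros l) = 0.
Proof. unfold zeros. induction l; cbn [map dval]; lia. Qed.

Lemma dval_item {X} z (post : list X) u : Forall (fun d => d = 0) z ->
  dval (item_digits z post u ++ [1]) = item_value (length z) (length post) (length u) (dval u).
Proof.
  intros Hz. unfold item_digits, item_value.
  assert (dval z = 0) as Ez by (induction Hz; simpl; lia).
  assert (length (zeros post) = length post) as Lz by apply length_map.
  rewrite <- app_assoc. cbn [app]. rewrite <- !app_assoc, dval_app, Ez. cbn [dval].
  rewrite !dval_app, dval_zeros, Lz. cbn [dval].
  rewrite !Nat.pow_add_r, Nat.pow_succ_r'. ring.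
Qed.

(** [D] lists for every group the vectors chosen from it, with repetitions. The three functions are
    the totals of the blocks before any carry; the counts in the places may exceed 7. *)
Fixpoint low (D : list (list (list nat))) : nat :=
  match D with [] => 0 | d :: D => length d + 8 * low D end.
Fixpoint top (D : list (list (list nat))) : nat :=
  match D with [] => 0 | d :: D => length d * 8 ^ length D + top D end.
Definition mid (D : list (list (list nat))) : nat := list_sum (map dval (concat D)).

Lemma low_app D D' : low (D ++ D') = low D + 8 ^ length D * low D'.
Proof. induction D; cbn [app low length Nat.pow]; [lia|]. rewrite IHD. lia. Qed.

Lemma top_app D D' : top (D ++ D') = 8 ^ length D' * top D + top D'.
Proof.
  induction D; cbn [app top]; [lia|]. rewrite IHD, length_app, Nat.pow_add_r. lia.
Qed.

Lemma splits_spec {X} (l : list X) : forall z p, In p (splits z l) ->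
  exists pre g post, l = pre ++ g :: post /\ snd p = g :: post /\ fst p = repeat 0 (length pre) ++ z.
Proof.
  induction l as [|g l IH]; intros z p Hp; [easy|]. destruct Hp as [<-|Hp].
  - now exists [], g, l.
  - destruct (IH _ _ Hp) as (pre & g' & post & -> & E1 & E2).
    exists (g :: pre), g', post. split; auto. split; auto. rewrite E2. simpl.
    clear. induction (length pre); simpl; congruence.
Qed.

Lemma repeat_zero n : Forall (fun d => d = 0) (repeat 0 n).
Proof. induction n; simpl; constructor; auto. Qed.

Definition total (m : nat) (D : list (list (list nat))) : nat :=
  low D + 8 ^ length D * mid D + 8 ^ (length D + m) * top D.

(* Sorting the chosen items by group; an item of group i weighs one in place i of the lowest
   block and in place g-1-i of the highest block. *)
Lemma picks_by_group G m : Forall (Forall (fun u => length u = m)) G ->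
  forall qs, incl qs (items G) -> exists D, Forall2 (fun d g => incl d g) D G /\
    list_sum (map (fun q => dval (q ++ [1])) qs) = total m D.
Proof.
  intros HG. induction qs as [|q qs IH]; intros Hi.
  - exists (map (fun _ => []) G). split.
    + clear. induction G; simpl; constructor; auto. intros x [].
    + unfold total, mid. clear. simpl.
      assert (low (map (fun _ : list (list nat) => []) G) = 0) as -> by (induction G; simpl; lia).
      assert (top (map (fun _ : list (list nat) => []) G) = 0) as -> by (induction G; simpl; lia).
      assert (concat (map (fun _ : list (list nat) => @nil (list nat)) G) = []) as ->
        by (induction G; simpl; auto).
      simpl. lia.
  - destruct IH as (D & HD & Hs); [intros x Hx; apply Hi; now right|].
    assert (In q (items G)) as Hq by (apply Hi; now left).
    apply in_flat_map in Hq as (p & Hp & Hq).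
    apply splits_spec in Hp as (pre & g & post & -> & Ep & Ez). rewrite app_nil_r in Ez.
    rewrite Ep in Hq. apply in_map_iff in Hq as (u & <- & Hu).
    apply Forall2_app_inv_r in HD as (D1 & D2' & HD1 & HD2 & ->).
    inversion HD2 as [|d ? D2 ? Hd HD2']; subst.
    assert (L1 := Forall2_length HD1). assert (L2 := Forall2_length HD2').
    exists (D1 ++ (u :: d) :: D2). split.
    + apply Forall2_app; auto. constructor; auto. intros x [<-|Hx]; auto.
    + simpl list_sum. rewrite Hs, Ez, dval_item by apply repeat_zero. rewrite repeat_length.
      assert (length u = m) as ->.
      { rewrite Forall_forall in HG. specialize (HG g ltac:(apply in_or_app; right; now left)).
        rewrite Forall_forall in HG. auto. }
      unfold total, item_value. rewrite !low_app, !top_app, !length_app. cbn [length low top].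
      rewrite L1, L2.
      replace (mid (D1 ++ (u :: d) :: D2)) with (dval u + mid (D1 ++ d :: D2)).
      2:{ unfold mid. rewrite !concat_app. cbn [concat app]. rewrite !map_app, !list_sum_app.
          simpl. rewrite map_app, list_sum_app. lia. }
      generalize (mid (D1 ++ d :: D2)). intros X.
      rewrite !Nat.pow_add_r. ring.
Qed.

(** [X] and [Y] absorb all that lies above the low block. Two choices from the first group would
    exceed the high block, as [2 * 8 ^ (g - 1)] is more than [g] ones; no choice contradicts the
    equation modulo 8. Removing the group leaves the same situation with one place less in both
    blocks. *)
Lemma one_per_group D : forall X Y,
  low D + 8 ^ length D * X = repunit (length D) + 8 ^ length D * Y ->
  top D <= repunit (length D) -> Forall (fun d => length d = 1) D.
Proof.
  induction D as [|d D IH]; intros X Y Hl Ht; constructor.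
  - cbn [low top length] in *. rewrite repunit_S in Ht.
    unfold repunit at 1 in Hl. cbn [repeat dval Nat.pow] in Hl.
    fold (repunit (length D)) in *. pose proof (repunit_lt (length D)).
    assert (length d <= 1) by nia.
    assert (length d <> 0); [|lia]. intros E. rewrite E in Hl. lia.
  - cbn [low top length] in *. rewrite repunit_S in Ht.
    unfold repunit at 1 in Hl. cbn [repeat dval Nat.pow] in Hl.
    fold (repunit (length D)) in *. pose proof (repunit_lt (length D)).
    assert (length d <= 1) by nia.
    assert (length d = 1) as Ed.
    { assert (length d <> 0); [|lia]. intros E. rewrite E in Hl. lia. }
    rewrite Ed in *. apply (IH X Y); nia.
Qed.

Definition choice_value (g m X : nat) : nat :=
  repunit g + 8 ^ g * X + 8 ^ (g + m) * repunit g.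

Lemma picks_choice G m X : Forall (Forall (fun u => length u = m)) G -> X < 8 ^ m ->
  (exists qs, incl qs (items G) /\
     list_sum (map (fun q => dval (q ++ [1])) qs) = choice_value (length G) m X) ->
  exists us, Forall2 (fun u g => In u g) us G /\ list_sum (map dval us) = X.
Proof.
  intros HG HX (qs & Hi & Hs).
  destruct (picks_by_group G m HG qs Hi) as (D & HD & ED). rewrite ED in Hs.
  pose proof (Forall2_length HD) as HL. unfold total, choice_value in Hs. rewrite HL in Hs.
  set (g := length G) in *. pose proof (repunit_lt g) as Hrg.
  rewrite !Nat.pow_add_r in Hs. set (A := 8 ^ g) in *. set (B := 8 ^ m) in *.
  (* Below the high block the target is worth less than [A * B], since [repunit g] is less than [A]
     and [X] less than [B]. So the leading parts can be compared. *)
  assert (Ht : top D <= repunit g).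
  { apply Nat.lt_succ_r. apply (Nat.mul_lt_mono_pos_l (A * B)).
    - unfold A, B. apply Nat.mul_pos_pos; apply Nat.neq_0_lt_0, Nat.pow_nonzero; lia.
    - assert (A * X + A <= A * B) by nia. lia. }
  assert (H1 : Forall (fun d => length d = 1) D).
  (* Both higher blocks are multiples of [A], so they are gathered in the two free summands, however
     large [mid D] is. *)
  { apply (one_per_group D (mid D + B * top D) (X + B * repunit g)); rewrite HL; fold g; fold A;
      [|exact Ht]. rewrite !Nat.mul_add_distr_l. lia. }
  assert (HDu : exists us, D = map (fun u => [u]) us).
  { clear -H1. induction H1 as [|d D Hd _ (us & ->)]; [now exists []|].
    destruct d as [|u [|]]; try discriminate. now exists (u :: us). }
  destruct HDu as (us & ->).
  assert (Elow : low (map (fun u => [u]) us) = repunit (length us)).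
  { unfold repunit. clear. induction us; simpl; lia. }
  assert (Etop : top (map (fun u => [u]) us) = repunit (length us)).
  { clear. induction us as [|u us IH]; [reflexivity|]. cbn [map top length].
    rewrite repunit_S, IH, length_map. lia. }
  rewrite length_map in HL. rewrite Elow, Etop, HL in Hs. fold g in Hs.
  exists us. split.
  - clear -HD. revert G HD. induction us; intros G HD; inversion HD; subst; constructor; auto.
    match goal with H : incl _ _ |- _ => apply H; now left end.
  - assert (mid (map (fun u => [u]) us) = list_sum (map dval us)) as <-.
    { unfold mid. f_equal. clear. induction us; simpl; congruence. }
    assert (A * mid (map (fun u => [u]) us) = A * X) as HA by lia.
    apply Nat.mul_cancel_l in HA; auto. apply Nat.pow_nonzero. lia.
Qed.

Lemma choice_picks G m : Forall (Forall (fun u => length u = m)) G -> forall us,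
  Forall2 (fun u g => In u g) us G ->
  exists qs, incl qs (items G) /\
    list_sum (map (fun q => dval (q ++ [1])) qs) = choice_value (length G) m (list_sum (map dval us)).
Proof.
  intros HG us HF. unfold items.
  (* Generalized over the zeros [z] of the groups already treated, which shift the remaining places
     of the low block upwards. *)
  enough (forall z, Forall (fun d => d = 0) z -> exists qs,
    incl qs (flat_map (fun p => match snd p with [] => [] | g :: post =>
               map (item_digits (fst p) post) g end) (splits z G)) /\
    list_sum (map (fun q => dval (q ++ [1])) qs)
    = 8 ^ length z * repunit (length G) + 8 ^ (length z + length G) * list_sum (map dval us)
      + 8 ^ (length z + length G + m) * repunit (length G)) as H.
  { destruct (H [] (Forall_nil _)) as (qs & Hi & E). exists qs. split; auto.
    rewrite E. unfold choice_value. simpl. lia. }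
  induction HF as [|u g us G Hu HF IH]; intros z Hz.
  - exists []. split; [intros x []|]. unfold repunit. simpl. lia.
  - inversion HG as [|? ? Hg HG']; subst.
    destruct (IH HG' (0 :: z)) as (qs & Hi & E); [constructor; auto|].
    exists (item_digits z G u :: qs). split.
    + intros x [<-|Hx]; simpl; apply in_or_app; [left; now apply in_map|right; now apply Hi].
    + cbn [map list_sum fold_right]. fold (list_sum (map (fun q => dval (q ++ [1])) qs)).
      fold (list_sum (map dval us)). rewrite E, dval_item by exact Hz.
      rewrite Forall_forall in Hg. rewrite (Hg u Hu). unfold item_value. cbn [length].
      replace (S (length z) + length G) with (length z + S (length G)) by lia.
      unfold repunit at 3. cbn [repeat dval]. fold (repunit (length G)).
      rewrite repunit_S. rewrite !Nat.pow_add_r, !Nat.pow_succ_r'. ring.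
Qed.

Lemma sum_map_ext_in {X} (f g : X -> nat) l : (forall x, In x l -> f x = g x) ->
  list_sum (map f l) = list_sum (map g l).
Proof. intros H. f_equal. now apply map_ext_in. Qed.

(** Finite choice: as [l] has no repetitions, the choices made at its positions form a function,
    namely an assignment or a slack function. *)
Lemma choice_function {X Y Z} `{Enc X} (P : X -> Y -> Prop) (f : X -> Y -> Z) (l : list X) :
  NoDup l -> inhabited Y -> forall us, Forall2 (fun u x => exists y, P x y /\ u = f x y) us l ->
  exists h, (forall x, In x l -> P x (h x)) /\ us = map (fun x => f x (h x)) l.
Proof.
  intros Hl [y0] us HF. induction HF as [|u x us l (y & Hp & Eu) HF IH].
  - exists (fun _ => y0). split; [intros x []|reflexivity].
  - inversion Hl as [|? ? Hx Hl']; subst. destruct (IH Hl') as (h & Hh & ->).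
    exists (fun x' => if eqx x' x then y else h x').
    assert (Hne : forall x', In x' l -> eqx x' x = false).
    { intros x' Hx'. rewrite <- not_true_iff_false, eqx_spec. congruence. }
    split.
    + intros x' [<-|Hx']; [now rewrite (proj2 (eqx_spec x x) eq_refl)|].
      rewrite Hne; auto.
    + cbn [map]. rewrite (proj2 (eqx_spec x x) eq_refl). f_equal.
      apply map_ext_in. intros x' Hx'. now rewrite Hne.
Qed.

Lemma Forall2_map_r {X Y Z} (R : X -> Z -> Prop) (f : Y -> Z) us l :
  Forall2 R us (map f l) <-> Forall2 (fun u y => R u (f y)) us l.
Proof.
  revert us. induction l as [|y l IH]; intros us; simpl.
  - split; intros HF; inversion HF; constructor.
  - split; intros HF; inversion HF; subst; constructor; auto; now apply IH.
Qed.

Lemma Forall2_map_self {X Z} (R : Z -> X -> Prop) (f : X -> Z) l :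
  (forall x, In x l -> R (f x) x) -> Forall2 R (map f l) l.
Proof. induction l; simpl; intros; constructor; auto. Qed.

(** * From digits to satisfying assignments *)

Definition clause_digit (asg : list sym -> bool) (sl : list lit -> nat) (E : cnf) (c : list lit) : nat :=
  list_sum (map (fun v => if mem (asg v, v) c then 1 else 0) (vars E))
  + list_sum (map (fun c' => if eqx c' c then sl c' else 0) E).

Lemma dval_plus {Y} (f g : Y -> nat) E :
  dval (map f E) + dval (map g E) = dval (map (fun c => f c + g c) E).
Proof. induction E; cbn [map dval]; lia. Qed.

Lemma dval_sum {X Y} (F : X -> Y -> nat) (l : list X) (E : list Y) :
  list_sum (map (fun x => dval (map (F x) E)) l)
  = dval (map (fun c => list_sum (map (fun x => F x c) l)) E).
Proof.
  induction l as [|x l IH]; simpl.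
  - induction E as [|c E IHE]; simpl; [reflexivity|]. rewrite <- IHE. reflexivity.
  - rewrite IH. clear IH. induction E as [|c E IHE]; simpl; [reflexivity|]. lia.
Qed.

Lemma dval_map_inj {Y} (f g : Y -> nat) E : (forall c, In c E -> f c < 8 /\ g c < 8) ->
  dval (map f E) = dval (map g E) -> forall c, In c E -> f c = g c.
Proof.
  induction E as [|d E IH]; intros Hb He c Hc; [easy|]. cbn [map dval] in He.
  pose proof (Hb d (or_introl eq_refl)).
  assert (f d = g d /\ dval (map f E) = dval (map g E)) as [E1 E2] by lia.
  destruct Hc as [<-|Hc]; auto. apply IH; auto. intros; apply Hb; now right.
Qed.

Lemma choices_iff E X : NoDup E ->
  (exists us, Forall2 (fun u g => In u g) us (groups E) /\ list_sum (map dval us) = X) <->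
  (exists asg sl, (forall c, In c E -> sl c <= 2) /\ dval (map (clause_digit asg sl E) E) = X).
Proof.
  intros HE. destruct (dedup_spec (map snd (concat E))) as [HV _]. fold (vars E) in HV.
  assert (Hsum : forall (asg : list sym -> bool) (sl : list lit -> nat),
    list_sum (map dval (map (fun _ => 0) E
      :: map (fun v => vec (mem (asg v, v)) 1 E) (vars E)
      ++ map (fun c => vec (eqx c) (sl c) E) E)) = dval (map (clause_digit asg sl E) E)).
  { intros asg sl. cbn [map list_sum fold_right].
    fold (list_sum (map dval (map (fun v => vec (mem (asg v, v)) 1 E) (vars E)
      ++ map (fun c => vec (eqx c) (sl c) E) E))).
    change (map (fun _ : list lit => 0) E) with (zeros E).
    rewrite dval_zeros, map_app, list_sum_app, !map_map. unfold vec.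
    rewrite (dval_sum (fun v c => if mem (asg v, v) c then 1 else 0)).
    rewrite (dval_sum (fun c' c => if eqx c' c then sl c' else 0)).
    apply (dval_plus (fun c => list_sum (map (fun v => if mem (asg v, v) c then 1 else 0) (vars E)))). }
  split.
  - intros (us & HF & <-). unfold groups in HF. inversion HF as [|u0 ? us' ? H0 HF']; subst.
    apply Forall2_app_inv_r in HF' as (u1 & u2 & HF1 & HF2 & ->).
    destruct H0 as [<-|[]]. apply (proj1 (Forall2_map_r _ _ _ _)) in HF1, HF2.
    destruct (choice_function (fun _ _ => True) (fun v (b : bool) => vec (mem (b, v)) 1 E) (vars E) HV
      (inhabits true) u1) as (asg & _ & ->).
    { eapply Forall2_impl; [|exact HF1]. intros u v [<-|[<-|[]]]; eauto. }
    destruct (choice_function (fun _ d => d <= 2) (fun c d => vec (eqx c) d E) E HE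
      (inhabits 0) u2) as (sl & Hsl & ->).
    { eapply Forall2_impl; [|exact HF2]. intros u c [<-|[<-|[<-|[]]]]; eauto. }
    exists asg, sl. split; auto.
  - intros (asg & sl & Hsl & <-). rewrite <- Hsum. eexists. split; [|reflexivity].
    unfold groups. constructor; [now left|]. apply Forall2_app; apply Forall2_map_r, Forall2_map_self.
    + intros v _. destruct (asg v); simpl; auto.
    + intros c Hc. specialize (Hsl c Hc). destruct (sl c) as [|[|[|]]]; simpl; auto; lia.
Qed.

Lemma sum_indicator {X} (p : X -> bool) l :
  list_sum (map (fun x => if p x then 1 else 0) l) = count p l.
Proof.
  unfold count. induction l as [|x l IH]; simpl; auto. destruct (p x); simpl; lia.
Qed.

(** A literal is true exactly if it is [(asg v, v)] for its variable [v], so true literals of [c]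
    correspond one to one to the variables counted. *)
Lemma true_literals asg E c : In c E -> NoDup c ->
  list_sum (map (fun v => if mem (asg v, v) c then 1 else 0) (vars E)) = count (satisfies asg) c.
Proof.
  intros Hc Hnd. rewrite sum_indicator. unfold count.
  rewrite <- (length_map (fun v => (asg v, v))).
  destruct (dedup_spec (map snd (concat E))) as [HV _]. fold (vars E) in HV.
  assert (Hs : forall l : lit, satisfies asg l = true <-> l = (asg (snd l), snd l)).
  { intros [b v]. unfold satisfies. cbn [fst snd]. rewrite eqb_true_iff.
    split; [now intros ->|intros E1; injection E1; auto]. }
  assert (Hnd' : NoDup (map (fun v => (asg v, v)) (filter (fun v => mem (asg v, v) c) (vars E)))).
  { apply NoDup_map_inv with (f := snd). rewrite map_map, map_id. now apply NoDup_filter. }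
  apply Nat.le_antisymm; apply NoDup_incl_length; auto using NoDup_filter.
  - intros l Hl. apply in_map_iff in Hl as (v & <- & Hv). apply filter_In in Hv as [_ Hm].
    apply filter_In. apply (proj1 (mem_spec _ _)) in Hm. split; auto. now apply Hs.
  - intros l Hl. apply filter_In in Hl as [Hl Ht]. apply Hs in Ht.
    apply in_map_iff. exists (snd l). split; auto. apply filter_In. split.
    + apply vars_In. eauto.
    + apply mem_spec. now rewrite <- Ht.
Qed.

Lemma own_slack (sl : list lit -> nat) E c : In c E -> NoDup E ->
  list_sum (map (fun c' => if eqx c' c then sl c' else 0) E) = sl c.
Proof.
  intros Hc HE. induction HE as [|d E Hd HE IH]; [easy|]. cbn [map list_sum fold_right].
  fold (list_sum (map (fun c' => if eqx c' c then sl c' else 0) E)).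
  destruct Hc as [->|Hc].
  - rewrite (proj2 (eqx_spec c c) eq_refl).
    enough (list_sum (map (fun c' => if eqx c' c then sl c' else 0) E) = 0) by lia.
    rewrite (sum_map_ext_in _ (fun _ => 0)).
    + clear. induction E; simpl; auto.
    + intros x Hx. destruct (eqx x c) eqn:Ex; auto. apply (proj1 (eqx_spec _ _)) in Ex. congruence.
  - rewrite IH by auto. destruct (eqx d c) eqn:Ex; auto.
    apply (proj1 (eqx_spec _ _)) in Ex. congruence.
Qed.

(** A digit is the number of true literals, at most 3, plus a slack of at most 2. There is no carry,
    and 3 is attained if and only if some literal is true. *)
Lemma sat_iff_digits U E : wf U E ->
  (sat E <-> exists asg sl, (forall c, In c E -> sl c <= 2) /\
     dval (map (clause_digit asg sl E) E) = dval (map (fun _ => 3) E)).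
Proof.
  intros [[HE _] Hf]. rewrite Forall_forall in Hf.
  assert (Hd : forall asg sl c, In c E -> clause_digit asg sl E c = count (satisfies asg) c + sl c).
  { intros asg sl c Hc. destruct (Hf c Hc) as (Hnd & _). unfold clause_digit.
    now rewrite true_literals, own_slack. }
  assert (Hle : forall asg c, In c E -> count (satisfies asg) c <= 3).
  { intros asg c Hc. destruct (Hf c Hc) as (_ & H3 & _).
    etransitivity; [apply filter_length_le|exact H3]. }
  assert (Hpos : forall asg c, 1 <= count (satisfies asg) c <-> hits (satisfies asg) c).
  { intros asg c. unfold count, hits. split.
    - destruct (filter (satisfies asg) c) as [|l r] eqn:Ef; simpl; [lia|]. intros _.
      exists l. apply filter_In. rewrite Ef. now left.
    - intros (l & Hl & Hs). assert (In l (filter (satisfies asg) c)) as Hin by (apply filter_In; auto).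
      destruct (filter (satisfies asg) c); [easy|simpl; lia]. }
  split.
  - intros (asg & Ha). unfold hits_all in Ha. rewrite Forall_forall in Ha.
    exists asg, (fun c => 3 - count (satisfies asg) c). split.
    + intros c Hc. pose proof (proj2 (Hpos asg c) (Ha c Hc)). lia.
    + f_equal. apply map_ext_in. intros c Hc. rewrite Hd by auto.
      pose proof (Hle asg c Hc). lia.
  - intros (asg & sl & Hsl & He). exists asg. unfold hits_all. apply Forall_forall. intros c Hc.
    assert (clause_digit asg sl E c = 3) as E3.
    { apply (dval_map_inj _ (fun _ => 3) E); auto. intros d Hd'. rewrite Hd by auto.
      pose proof (Hle asg d Hd'). pose proof (Hsl d Hd'). lia. }
    rewrite Hd in E3 by auto. specialize (Hsl c Hc). apply Hpos. lia.
Qed.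

(** * The Subset Sum instance and its correctness *)

Lemma groups_length E : length (groups E) = 1 + length (vars E) + length E.
Proof. unfold groups. simpl. now rewrite length_app, !length_map. Qed.

Lemma groups_vectors E : Forall (Forall (fun u => length u = length E)) (groups E).
Proof.
  unfold groups, vec. constructor; [|apply Forall_app; split; apply Forall_map, Forall_forall; intros x _];
    repeat constructor; apply length_map.
Qed.

Lemma groups_digits E : Forall (Forall (Forall (fun d => d <= 3))) (groups E).
Proof.
  assert (Hv : forall P d, d <= 3 -> Forall (fun d => d <= 3) (vec P d E)).
  { intros P d Hd. apply Forall_map, Forall_forall. intros c _. destruct (P c); lia. }
  unfold groups. constructor.
  { constructor; [|constructor]. apply Forall_map, Forall_forall. intros; lia. }
  apply Forall_app; split; apply Forall_map, Forall_forall; intros x _;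
    repeat constructor; apply Hv; lia.
Qed.

Lemma items_In G q : In q (items G) -> exists pre g post u,
  G = pre ++ g :: post /\ In u g /\ q = item_digits (repeat 0 (length pre)) post u.
Proof.
  intros Hq. apply in_flat_map in Hq as (p & Hp & Hq).
  apply splits_spec in Hp as (pre & g & post & -> & Ep & Ez). rewrite app_nil_r in Ez.
  rewrite Ep in Hq. apply in_map_iff in Hq as (u & <- & Hu). rewrite Ez.
  exists pre, g, post, u. auto.
Qed.

Lemma items_digits E q : In q (items (groups E)) ->
  Forall (fun d => d <= 3) q /\ length q <= length (target_digits (groups E) E).
Proof.
  intros Hq. destruct (items_In _ _ Hq) as (pre & g & post & u & EG & Hu & ->).
  assert (Hz : forall n, Forall (fun d => d <= 3) (repeat 0 n)).
  { intros n. apply Forall_impl with (P := fun d => d = 0); [intros; lia|apply repeat_zero]. }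
  assert (Hz' : forall X (l : list X), Forall (fun d => d <= 3) (zeros l)).
  { intros X l. apply Forall_map, Forall_forall. intros; lia. }
  assert (Hg : In g (groups E)) by (rewrite EG; apply in_or_app; right; now left).
  pose proof (groups_digits E) as H1. pose proof (groups_vectors E) as H2.
  rewrite Forall_forall in H1, H2. specialize (H1 g Hg). specialize (H2 g Hg).
  rewrite Forall_forall in H1, H2. specialize (H1 u Hu). specialize (H2 u Hu).
  unfold item_digits, target_digits. split.
  - apply Forall_app. split; auto. constructor; [lia|]. repeat (apply Forall_app; split); auto.
  - rewrite !length_app. cbn [length]. unfold zeros. rewrite !length_app, !length_map, repeat_length, H2.
    rewrite EG, length_app. cbn [length]. destruct pre; cbn [app tl length]; rewrite ?length_app; cbn [length]; lia.
Qed.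

(** The final one appended to the digits completes the high block, of which only [tl] is listed;
    this is where the groups have to be nonempty. *)
Lemma target_value E :
  dval (target_digits (groups E) E ++ [1])
  = choice_value (length (groups E)) (length E) (dval (map (fun _ => 3) E)).
Proof.
  unfold target_digits, choice_value. rewrite <- !app_assoc, !dval_app, !length_map.
  assert (H1 : forall X (l : list X), dval (map (fun _ => 1) l) = repunit (length l)).
  { intros X l. unfold repunit. induction l; simpl; lia. }
  rewrite H1. destruct (groups E) as [|g G] eqn:EG; [discriminate|]. cbn [tl length].
  rewrite H1. cbn [dval]. rewrite !repunit_S.
  rewrite !Nat.pow_add_r, !Nat.pow_succ_r'. ring.
Qed.

Lemma threes_lt {Y} (E : list Y) : dval (map (fun _ => 3) E) < 8 ^ length E.
Proof. induction E; cbn [map dval length Nat.pow]; lia. Qed.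

Lemma bits_length ds : length (bits ds) = 3 * length ds + 1.
Proof.
  unfold bits. rewrite length_app. simpl. f_equal. rewrite Nat.add_0_r.
  induction ds as [|d ds IH]; simpl; auto. rewrite length_app, IH.
  assert (length (digit_bits d) = 3) as -> by now destruct d as [|[|[|]]]. lia.
Qed.

Lemma target_bval E : bval (target E) = dval (target_digits (groups E) E ++ [1]).
Proof.
  apply bval_bits. unfold target_digits.
  repeat (apply Forall_app; split); apply Forall_map, Forall_forall; intros; lia.
Qed.

Lemma pads_In t s : In s (pads t) -> canonical s /\ length t < length s.
Proof.
  intros Hs. apply in_map_iff in Hs as (p & <- & _). split.
  - eexists. now rewrite app_assoc.
  - rewrite !length_app, !length_map. simpl. lia.
Qed.

Lemma splits_length {X} (l : list X) : forall z, length (splits z l) = length l.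
Proof. induction l; intros; simpl; auto. Qed.

Lemma pads_length t : length (pads t) = length t.
Proof. unfold pads. rewrite length_map. apply splits_length. Qed.

Lemma pads_NoDup t : NoDup (pads t).
Proof.
  apply NoDup_map_inv with (f := @length bool). unfold pads. rewrite map_map.
  rewrite (map_ext _ (fun p => length t + length (fst p) + 1))
    by (intros; rewrite !length_app, !length_map; simpl; lia).
  generalize t at 2 as l. intros l.
  enough (forall z, NoDup (map (fun p => length t + length (fst p) + 1) (splits z l)) /\
    forall n, In n (map (fun p => length t + length (fst p) + 1) (splits z l)) -> length t + length z + 1 <= n)
    as H by apply (H []).
  induction l as [|b l IH]; intros z; simpl; [split; [constructor|easy]|].
  destruct (IH (0 :: z)) as [I1 I2]. simpl in I2. split.
  - constructor; auto. intros Hin. apply I2 in Hin. lia.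
  - intros n [<-|Hn]; [lia|]. apply I2 in Hn. lia.
Qed.

Definition instance (E : cnf) : ssm_instance := (map bval (numbers E), bval (target E)).

Lemma numbers_canonical E : Forall canonical (numbers E).
Proof.
  unfold numbers. apply Forall_app. split; apply Forall_forall; intros s Hs.
  - apply dedup_spec, in_map_iff in Hs as (q & <- & _). apply canonical_bits.
  - now apply pads_In in Hs.
Qed.

Lemma numbers_short E s : In s (dedup (map bits (items (groups E)))) ->
  length s <= length (target E) /\
  exists q, In q (items (groups E)) /\ s = bits q /\ bval s = dval (q ++ [1]).
Proof.
  intros Hs. apply dedup_spec, in_map_iff in Hs as (q & <- & Hq).
  destruct (items_digits E q Hq) as [Hd Hl]. split.
  - unfold target. rewrite !bits_length. lia.
  - exists q. auto using bval_bits.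
Qed.

Lemma enc_instance E : enc_ssm (instance E) = ssm_input E.
Proof.
  unfold enc_ssm, instance, ssm_input. cbn [fst snd].
  rewrite (enc_nat_bval (target E) (canonical_bits _)). f_equal. f_equal. rewrite map_map.
  apply map_ext_in. intros s Hs. rewrite enc_nat_bval; auto.
  pose proof (numbers_canonical E) as Hc. rewrite Forall_forall in Hc. auto.
Qed.

Lemma instance_valid E : valid_ssm (instance E).
Proof.
  pose proof (numbers_canonical E) as Hc. rewrite Forall_forall in Hc.
  assert (Hpos : forall s, canonical s -> 0 < bval s).
  { intros s Hs. apply canonical_pos in Hs.
    assert (2 ^ (length s - 1) <> 0) by (apply Nat.pow_nonzero; lia). lia. }
  unfold valid_ssm, instance. cbn [fst snd]. split; [|split].
  - assert (NoDup (numbers E)) as Hn.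
    { unfold numbers. apply NoDup_app; [apply dedup_spec|apply pads_NoDup|].
      intros s Hs Hs'. apply numbers_short in Hs as [Hs _]. apply pads_In in Hs' as [_ Hs']. lia. }
    clear Hpos. induction Hn as [|s l Hs Hn IH]; simpl; constructor.
    + intros Hin. apply in_map_iff in Hin as (s' & Es & Hs'). apply Hs.
      apply bval_inj in Es; [now subst| |]; apply Hc; [now right|now left].
    + apply IH. intros; apply Hc; now right.
  - apply Forall_map, Forall_forall. auto.
  - apply Hpos, canonical_bits.
Qed.

Lemma instance_yes U E : wf U E -> (ssm_yes (instance E) <-> sat E).
Proof.
  intros Hw. rewrite (sat_iff_digits U E Hw), <- choices_iff by apply Hw.
  unfold instance. rewrite ssm_yes_picks, target_bval, target_value.
  pose proof (threes_lt E) as H3. split.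
  - intros (ps & Hi & Hs). apply (picks_choice _ (length E)); auto using groups_vectors.
    rewrite <- Hs. rewrite <- target_value, <- target_bval in Hs.
    (* No summand exceeds the sum, which excludes the pads: each of them has more bits than the
       target. *)
    assert (Hle : forall p, In p ps -> p <= bval (target E)).
    { rewrite <- Hs. clear. induction ps as [|x ps IH]; simpl; [easy|].
      intros p [->|Hp]; [lia|]. specialize (IH p Hp). lia. }
    clear Hs. induction ps as [|p ps IH]; [exists []; split; [intros x []|reflexivity]|].
    destruct IH as (qs & Hqs & E1).
    { intros x Hx. apply Hi. now right. }
    { intros x Hx. apply Hle. now right. }
    destruct (proj1 (in_map_iff _ _ _) (Hi p (or_introl eq_refl))) as (s & <- & Hin).
    apply in_app_or in Hin as [Hin|Hin].
    + apply numbers_short in Hin as (_ & q & Hq & -> & Ev). exists (q :: qs). split.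
      * intros x [<-|Hx]; auto.
      * simpl. rewrite E1, Ev. reflexivity.
    + apply pads_In in Hin as [Hcan Hlen]. apply canonical_pos in Hcan.
      specialize (Hle _ (or_introl eq_refl)). pose proof (bval_lt (target E)).
      assert (2 ^ length (target E) <= 2 ^ (length s - 1)) by (apply Nat.pow_le_mono_r; lia). lia.
  - intros (us & HF & Hs).
    destruct (choice_picks _ (length E) (groups_vectors E) us HF) as (qs & Hi & Eq).
    rewrite Hs in Eq. exists (map (fun q => dval (q ++ [1])) qs). split; auto.
    intros x Hx. apply in_map_iff in Hx as (q & <- & Hq). apply in_map_iff.
    exists (bits q). apply Hi in Hq. split.
    + apply bval_bits. now apply (items_digits E).
    + unfold numbers. apply in_or_app. left. apply dedup_spec. now apply in_map.
Qed.

Lemma items_length E : length (items (groups E)) <= 1 + 2 * length (vars E) + 3 * length E.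
Proof.
  assert (H : forall G z, length (flat_map (fun p => match snd p with [] => [] | g :: post =>
      map (item_digits (fst p) post) g end) (splits z G))
      = list_sum (map (@length (list nat)) G)).
  { induction G as [|g G IH]; intros z; simpl; auto. now rewrite length_app, length_map, IH. }
  unfold items. rewrite H. unfold groups. simpl. rewrite map_app, list_sum_app, !map_map. simpl.
  assert (forall X (l : list X) k, list_sum (map (fun _ => k) l) = k * length l) as Hk.
  { intros X l k. induction l; simpl; lia. }
  rewrite !Hk. lia.
Qed.

Lemma dedup_length {X} `{Enc X} (l : list X) : length (dedup l) <= length l.
Proof.
  destruct (dedup_spec l) as [D1 D2]. apply NoDup_incl_length; auto. intros x Hx. now apply D2.
Qed.

(** The left inequality yields a target of at most 2^n and is the purpose of the pads. The right one
    turns time subexponential in the size of the set into time subexponential in variables plus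
    clauses. *)
Lemma instance_size E :
  length (target E) <= ssm_n (instance E) <= 20 * (1 + length (vars E) + length E).
Proof.
  unfold ssm_n, instance, numbers. cbn [fst]. rewrite length_map, length_app, pads_length.
  split; [lia|]. pose proof (dedup_length (map bits (items (groups E)))) as Hd.
  rewrite length_map in Hd. pose proof (items_length E).
  unfold target. rewrite bits_length. unfold target_digits. rewrite !length_app, !length_map.
  pose proof (groups_length E). assert (length (tl (groups E)) <= length (vars E) + length E).
  { destruct (groups E); simpl in *; lia. }
  lia.
Qed.

(** * Growth rate of the branching recurrences *)

Lemma exp_pow x n : (exp x ^ n = exp (INR n * x))%R.
Proof.
  induction n; [simpl; now rewrite Rmult_0_l, exp_0|].
  rewrite S_INR, Rmult_plus_distr_r, Rmult_1_l, exp_plus. simpl. rewrite IHn. ring.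
Qed.

(** The potential can reach [6 * th1] per literal, so [z] has to approach 1 as [th1] grows. The
    choice [z = exp (delta / th1)] makes the total rate independent of [th1]. *)
Lemma thresholds (delta : R) : (0 < delta)%R -> exists th1 th2 z,
  1 <= th1 /\ 1 <= th2 /\ (1 <= z)%R /\
  (/ z + / z ^ (2 * th1 * th1) <= 1)%R /\ (/ z ^ (2 * th1) + / z ^ th2 <= 1)%R /\
  forall u, (z ^ (6 * th1 * u) = exp (6 * delta * INR u))%R.
Proof.
  intros Hd.
  assert (Hd3 : (0 < delta * delta * delta)%R) by (repeat apply Rmult_lt_0_compat; lra).
  destruct (INR_unbounded (1 + delta + 2 / (delta * delta * delta))) as (th1 & Hth).
  assert (H2d : (0 < 2 / (delta * delta * delta))%R) by (apply Rdiv_lt_0_compat; lra).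
  set (h := INR th1) in *. assert (Hh : (1 < h)%R) by lra.
  set (x := (delta / h)%R).
  assert (Hx : (0 < x)%R) by (apply Rdiv_lt_0_compat; lra).
  assert (Hxh : (x * h = delta)%R) by (unfold x; field; lra).
  assert (Hx1 : (x <= 1)%R) by nra.
  assert (He : (exp (- (2 * delta)) < 1)%R) by (rewrite <- exp_0; apply exp_increasing; lra).
  set (e := exp (- (2 * delta))) in *.
  (* In the second recurrence the first summand is the constant [e < 1], whatever [th1] is. With
     [th2 = th1 * j] the other one is [exp (- j * delta)], which falls below [1 - e] for large
     [j]. *)
  destruct (INR_unbounded (1 + / (delta * (1 - e)))) as (j & Hj).
  assert (Hde : (0 < delta * (1 - e))%R) by (apply Rmult_lt_0_compat; lra).
  assert (Hj0 : (0 < / (delta * (1 - e)))%R) by now apply Rinv_0_lt_compat.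
  exists th1, (th1 * j), (exp x).
  assert (Hexp : forall m, (exp x ^ m = exp (INR m * x))%R) by (intros; apply exp_pow).
  split; [apply INR_le; simpl; unfold h in *; lra|].
  split.
  { assert (1 <= th1) by (apply INR_le; simpl; unfold h in *; lra).
    assert (1 <= j) by (apply INR_le; simpl; lra). nia. }
  split; [pose proof (exp_ineq1_le x); lra|].
  split; [|split].
  (* Because [(1 + x) * (1 - x / 2)] is at least 1 for [x] between 0 and 1. *)
  - assert (E1 : (/ exp x <= 1 - x / 2)%R).
    { apply (Rmult_le_reg_r (exp x)); [apply exp_pos|].
      rewrite Rinv_l by (pose proof (exp_pos x); lra). pose proof (exp_ineq1_le x). nra. }
    (* The left side is [exp (- 2 * h * delta)], less than the inverse square of [h * delta]. This
       is at most [x / 2] once [h] exceeds [2 / delta ^ 3], which is the origin of the bound on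
       [th1]. *)
    assert (E2 : (/ exp x ^ (2 * th1 * th1) <= x / 2)%R).
    { rewrite Hexp, !mult_INR. fold h. change (INR 2) with 2%R.
      replace (2 * h * h * x)%R with (h * delta + h * delta)%R by (rewrite <- Hxh; ring).
      rewrite exp_plus.
      assert (Hhd : (h * delta < exp (h * delta))%R) by (pose proof (exp_ineq1_le (h * delta)); lra).
      assert (0 < h * delta)%R by nra.
      assert (Hsq : ((h * delta) * (h * delta) <= exp (h * delta) * exp (h * delta))%R) by nra.
      apply Rle_trans with (/ ((h * delta) * (h * delta)))%R.
      { apply Rinv_le_contravar; [nra|exact Hsq]. }
      apply (Rmult_le_reg_r ((h * delta) * (h * delta))); [nra|].
      rewrite Rinv_l by nra.
      replace (x / 2 * (h * delta * (h * delta)))%R with (h * (delta * delta * delta) / 2)%R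
        by (rewrite <- Hxh; field).
      assert ((2 / (delta * delta * delta)) * (delta * delta * delta) = 2)%R by (field; lra).
      assert ((2 / (delta * delta * delta)) * (delta * delta * delta) <= h * (delta * delta * delta))%R
        by (apply Rmult_le_compat_r; lra).
      lra. }
    lra.
  - rewrite !Hexp, !mult_INR. fold h. change (INR 2) with 2%R.
    replace (2 * h * x)%R with (2 * delta)%R by (rewrite <- Hxh; ring).
    rewrite <- exp_Ropp. fold e.
    replace (h * INR j * x)%R with (INR j * delta)%R by (rewrite <- Hxh; ring).
    enough (/ exp (INR j * delta) <= 1 - e)%R by lra.
    assert (Hjd : (/ (1 - e) <= exp (INR j * delta))%R).
    { pose proof (exp_ineq1_le (INR j * delta)).
      assert (/ (delta * (1 - e)) * delta <= INR j * delta)%R by (apply Rmult_le_compat_r; lra).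
      assert (/ (delta * (1 - e)) * delta = / (1 - e))%R by (field; lra). lra. }
    rewrite <- (Rinv_inv (1 - e)). apply Rinv_le_contravar; [apply Rinv_0_lt_compat; lra|exact Hjd].
  - intros u. rewrite Hexp, !mult_INR. fold h. f_equal. rewrite <- Hxh.
    replace (INR 6) with 6%R by (simpl; lra). ring.
Qed.

(** * Bounds of the form C 2^(an) poly(len) *)

Definition expb (a : R) (g : sat_instance -> nat) : Prop :=
  exists C j, (0 <= C)%R /\ forall F, valid_3sat F ->
    (INR (g F) <= C * Rpower 2 (a * INR (sat_nvars F)) * (INR (length (enc_sat F)) + 1) ^ j)%R.

Lemma Rpower2_pos x : (0 < Rpower 2 x)%R.
Proof. unfold Rpower. apply exp_pos. Qed.

Lemma Rpower2_ge1 x : (0 <= x)%R -> (1 <= Rpower 2 x)%R.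
Proof. intros Hx. rewrite <- (Rpower_O 2) by lra. apply Rle_Rpower; lra. Qed.

Lemma len_pow_ge1 F j : (1 <= (INR (length (enc_sat F)) + 1) ^ j)%R.
Proof. apply pow_R1_Rle. pose proof (pos_INR (length (enc_sat F))). lra. Qed.

Lemma expb_le a g g' : (forall F, valid_3sat F -> g F <= g' F) -> expb a g' -> expb a g.
Proof.
  intros Hg (C & j & HC & H). exists C, j. split; auto. intros F HF.
  apply Rle_trans with (INR (g' F)); auto. apply le_INR. auto.
Qed.

Lemma expb_weaken a b g : (a <= b)%R -> expb a g -> expb b g.
Proof.
  intros Hab (C & j & HC & H). exists C, j. split; auto. intros F HF.
  eapply Rle_trans; [apply H; auto|]. apply Rmult_le_compat_r.
  - pose proof (len_pow_ge1 F j). lra.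
  - apply Rmult_le_compat_l; auto. apply Rle_Rpower; [lra|].
    apply Rmult_le_compat_r; auto. apply pos_INR.
Qed.

Lemma expb_const a c : (0 <= a)%R -> expb a (fun _ => c).
Proof.
  intros Ha. exists (INR c), 0. split; [apply pos_INR|]. intros F _. simpl.
  pose proof (Rpower2_ge1 (a * INR (sat_nvars F)) (Rmult_le_pos _ _ Ha (pos_INR _))).
  pose proof (pos_INR c). nra.
Qed.

Lemma expb_length a : (0 <= a)%R -> expb a (fun F => length (enc_sat F)).
Proof.
  intros Ha. exists 1%R, 1. split; [lra|]. intros F _.
  pose proof (Rpower2_ge1 (a * INR (sat_nvars F)) (Rmult_le_pos _ _ Ha (pos_INR _))).
  pose proof (pos_INR (length (enc_sat F))). simpl. nra.
Qed.

Lemma expb_add a g g' : expb a g -> expb a g' -> expb a (fun F => g F + g' F).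
Proof.
  intros (C & j & HC & H) (C' & j' & HC' & H'). exists (C + C')%R, (j + j'). split; [lra|].
  intros F HF. rewrite plus_INR, pow_add. specialize (H F HF). specialize (H' F HF).
  set (X := Rpower 2 _) in *. pose proof (Rpower2_pos (a * INR (sat_nvars F))) as HX. fold X in HX.
  pose proof (len_pow_ge1 F j) as P1. pose proof (len_pow_ge1 F j') as P2.
  set (p := ((INR (length (enc_sat F)) + 1) ^ j)%R) in *.
  set (q := ((INR (length (enc_sat F)) + 1) ^ j')%R) in *.
  assert (C * X * p <= C * X * (p * q))%R by (apply Rmult_le_compat_l; nra).
  assert (C' * X * q <= C' * X * (p * q))%R by (apply Rmult_le_compat_l; nra).
  lra.
Qed.

Lemma expb_mul a b g g' : expb a g -> expb b g' -> expb (a + b) (fun F => g F * g' F).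
Proof.
  intros (C & j & HC & H) (C' & j' & HC' & H'). exists (C * C')%R, (j + j'). split; [nra|].
  intros F HF. rewrite mult_INR, pow_add, Rmult_plus_distr_r, Rpower_plus.
  eapply Rle_trans; [apply Rmult_le_compat; [apply pos_INR|apply pos_INR|now apply H|now apply H']|].
  right. ring.
Qed.

Lemma expb_pow a g k : expb a g -> expb (INR k * a) (fun F => g F ^ k).
Proof.
  intros Hg. induction k.
  - rewrite Rmult_0_l. apply (expb_const 0 1). lra.
  - rewrite S_INR. replace ((INR k + 1) * a)%R with (a + INR k * a)%R by ring.
    simpl. now apply expb_mul.
Qed.

(** Rate 0 means polynomial in the length of the encoding, and polynomials compose. For positive
    rates a power multiplies the rate, which has to be tracked. *)
Lemma expb_poly0 g h k : (forall F, g F <= (h F + 2) ^ k) -> expb 0 h -> expb 0 g.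
Proof.
  intros Hg Hh. apply (expb_le _ _ (fun F => (h F + 2) ^ k)); auto.
  replace 0%R with (INR k * 0)%R by ring. apply expb_pow, expb_add; auto. apply expb_const. lra.
Qed.

Definition nat_ceil (r : R) : nat := Z.to_nat (up r).

Lemma nat_ceil_spec r : (0 <= r)%R -> (r <= INR (nat_ceil r) <= r + 1)%R.
Proof.
  intros Hr. unfold nat_ceil. destruct (archimed r) as [H1 H2].
  assert (0 <= up r)%Z by (apply le_IZR; lra).
  rewrite INR_IZR_INZ, Z2Nat.id by auto. lra.
Qed.

Lemma expb_ceil a r C j : (0 <= a)%R -> (0 <= C)%R ->
  (forall F, valid_3sat F -> (0 <= r F <= C * Rpower 2 (a * INR (sat_nvars F))
     * (INR (length (enc_sat F)) + 1) ^ j)%R) ->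
  expb a (fun F => nat_ceil (r F)).
Proof.
  intros Ha HC H. exists (C + 1)%R, j. split; [lra|]. intros F HF.
  destruct (H F HF) as [H0 H1]. destruct (nat_ceil_spec _ H0) as [_ H2].
  pose proof (Rpower2_ge1 (a * INR (sat_nvars F)) (Rmult_le_pos _ _ Ha (pos_INR _))).
  pose proof (len_pow_ge1 F j).
  assert (1 <= Rpower 2 (a * INR (sat_nvars F)) * (INR (length (enc_sat F)) + 1) ^ j)%R by nra.
  rewrite !Rmult_plus_distr_r, Rmult_1_l. lra.
Qed.

(** The finitely many values below the threshold go into [A]. Leaves of the search can be
    arbitrarily small instances, so a bound for all [n] is required. *)
Lemma little_o_affine f eta : little_o_n f -> (0 < eta)%R ->
  exists A, (0 <= A)%R /\ forall n, (f n <= A + eta * INR n)%R.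
Proof.
  intros Hf He. destruct (Hf eta He) as (N & HN).
  assert (exists A, (0 <= A)%R /\ forall n, n < N -> (f n <= A)%R) as (A & HA & HfA).
  { clear HN. induction N as [|N (A & HA & HfA)]; [exists 0%R; split; [lra|lia]|].
    exists (A + Rabs (f N))%R. pose proof (Rabs_pos (f N)). split; [lra|].
    intros n Hn. destruct (Nat.eq_dec n N) as [->|]; [pose proof (Rle_abs (f N)); lra|].
    specialize (HfA n ltac:(lia)). lra. }
  exists A. split; auto. intros n.
  assert (0 <= eta * INR n)%R by (apply Rmult_le_pos; [lra|apply pos_INR]).
  destruct (Nat.lt_ge_cases n N); [specialize (HfA n H0); lra|].
  specialize (HN n H0). lra.
Qed.

Lemma sz_word w : sz (w : list sym) <= 6 * length w + 1.
Proof. induction w; [apply le_n|]. rewrite sz_cons. pose proof (sz_sym a). simpl length. lia. Qed.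

Lemma instance_bounded E :
  (INR (snd (instance E)) <= Rpower 2 (1 * INR (ssm_n (instance E))))%R.
Proof.
  rewrite Rmult_1_l, Rpower_pow by lra. destruct (instance_size E) as [H _].
  change 2%R with (INR 2). rewrite <- pow_INR. apply le_INR. cbn [instance snd].
  pose proof (bval_lt (target E)).
  assert (2 ^ length (target E) <= 2 ^ ssm_n (instance E)) by (apply Nat.pow_le_mono_r; lia). lia.
Qed.

Lemma wf_vars_le E0 E : wf (universe E0) E -> length (vars E) <= length (vars E0).
Proof.
  intros [_ Hf]. apply NoDup_incl_length; [apply dedup_spec|].
  intros v Hv. apply vars_In in Hv as (c & l & Hc & Hl & <-). rewrite Forall_forall in Hf.
  destruct (Hf c Hc) as (_ & _ & HU). now apply universe_In, HU.
Qed.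

Lemma leaf_size E0 th1 th2 n E : length (vars E0) <= n -> wf (universe E0) E ->
  sparse (universe E0) th1 th2 E ->
  ssm_n (instance E) <= 40 * (2 + th1 + th2) * (n + 1).
Proof.
  intros Hn Hw Hs. destruct (instance_size E) as [_ H]. pose proof (wf_vars_le E0 E Hw).
  unfold sparse in Hs. rewrite universe_length in Hs. nia.
Qed.

(** * The running time *)

Lemma PT_universe : PT (fun w => universe (parse w)).
Proof. pose proof PT_parse. unfold universe, vars. pt. Qed.

Lemma truth_tbool b : truth (tbool b) = b.
Proof. now destruct b. Qed.

Definition usize (F : sat_instance) : nat := sz (universe (parse (enc_sat F))).
(** The bound of [wf_sz] in terms of [F] alone, valid for all formulas of the search at once. *)
Definition fsize (F : sat_instance) : nat := 1 + 4 * (usize F + 1) ^ 3 * (3 * usize F + 5).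

Lemma usize_spec F :
  length (universe (parse (enc_sat F))) <= usize F /\
  forall E, wf (universe (parse (enc_sat F))) E -> sz E <= fsize F.
Proof.
  set (U := universe (parse (enc_sat F))).
  assert (HL : length U <= usize F) by apply length_le_sz.
  split; auto. intros E Hw. etransitivity.
  - apply (wf_sz U E (usize F) Hw). intros l Hl. apply sz_In in Hl. unfold usize. fold U. lia.
  - unfold fsize. apply Nat.add_le_mono_l. apply Nat.mul_le_mono_r, Nat.mul_le_mono_l.
    apply Nat.pow_le_mono_l. lia.
Qed.

Lemma usize_le_fsize F : usize F <= fsize F.
Proof.
  unfold fsize. assert ((usize F + 1) ^ 3 <> 0) by (apply Nat.pow_nonzero; lia). nia.
Qed.

Lemma expb_sz : expb 0 (fun F => sz (enc_sat F)).
Proof.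
  apply (expb_le _ _ (fun F => 6 * length (enc_sat F) + 1)); [intros; apply sz_word|].
  apply expb_add; [|apply expb_const; lra].
  replace 0%R with (0 + 0)%R by ring. apply (expb_mul 0 0 (fun _ => 6)); [apply expb_const|apply expb_length]; lra.
Qed.

Lemma expb_fsize : expb 0 fsize.
Proof.
  assert (Hu : expb 0 usize).
  { destruct (PT_size _ PT_universe) as (ku & Hu).
    apply (expb_poly0 _ (fun F => sz (enc_sat F)) ku); [|apply expb_sz].
    intros F. apply (Hu (enc_sat F)). }
  unfold fsize. apply expb_add; [apply expb_const; lra|].
  replace 0%R with (0 + 0)%R by ring. apply expb_mul.
  - replace 0%R with (0 + 0)%R by ring. apply (expb_mul 0 0 (fun _ => 4)); [apply expb_const; lra|].
    replace 0%R with (INR 3 * 0)%R by ring. apply expb_pow, expb_add; [auto|apply expb_const; lra].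
  - apply expb_add; [|apply expb_const; lra].
    replace 0%R with (0 + 0)%R by ring. apply (expb_mul 0 0 (fun _ => 3)); [apply expb_const; lra|auto].
Qed.

Lemma decider_on_instance (M : TM) (T : ssm_instance -> R) E U :
  decides_within M enc_ssm
    (fun I => valid_ssm I /\ (INR (snd I) <= Rpower 2 (1 * INR (ssm_n I)))%R) ssm_yes T ->
  wf U E -> exists s b, (INR s <= T (instance E))%R /\
    run M s (init_config (ssm_input E)) = Some b /\ (b = true <-> sat E).
Proof.
  intros Hdec Hw.
  destruct (Hdec (instance E) (conj (instance_valid E) (instance_bounded E))) as (s & b & Hs & Hrun & Hb).
  rewrite enc_instance in Hrun. exists s, b. split; auto. split; auto.
  rewrite Hb. now apply (instance_yes U).
Qed.

(** The origin of 96: the potential contributes a factor 6 and the two literals per variable a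
    factor 2, which leaves 12/96 = 1/8 of [c]. *)
Lemma node_bound (c z : R) th n u p : (0 < c)%R -> (1 <= z)%R ->
  (forall u, z ^ (6 * th * u) = exp (6 * (c * ln 2 / 96) * INR u))%R ->
  u <= 2 * n -> p <= 6 * th * u -> (z ^ p <= Rpower 2 (c / 8 * INR n))%R.
Proof.
  intros Hc Hz Hzu Hu Hp.
  apply Rle_trans with (z ^ (6 * th * u))%R; [now apply Rle_pow|].
  rewrite Hzu. unfold Rpower.
  assert (0 < ln 2)%R by (rewrite <- ln_1; apply ln_increasing; lra).
  assert (INR u <= 2 * INR n)%R by (change 2%R with (INR 2); rewrite <- mult_INR; now apply le_INR).
  destruct (Req_dec (6 * (c * ln 2 / 96) * INR u) (c / 8 * INR n * ln 2)) as [->|Hne]; [lra|].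
  left. apply exp_increasing.
  assert (0 <= c * ln 2 * (2 * INR n - INR u))%R by (apply Rmult_le_pos; nra).
  nra.
Qed.

Local Close Scope nat_scope.

Theorem theorem3 :
  ETH ->
  exists d : R, 0 < d /\
    forall (M : TM) (f : nat -> R) (k : nat),
      little_o_n f ->
      ~ decides_within M enc_ssm
          (fun I => valid_ssm I /\ INR (snd I) <= Rpower 2 (d * INR (ssm_n I)))
          ssm_yes
          (fun I => Rpower 2 (f (ssm_n I)) * (INR (length (enc_ssm I)) + 1) ^ k).
Proof.
  (* The pads guarantee targets of at most 2^n, so the constant 1 suffices in the restriction on
     targets. *)
  intros (c & Hc & HETH). exists 1. split; [lra|]. intros M f k Hf Hdec.
  assert (Hln2 : 0 < ln 2) by (rewrite <- ln_1; apply ln_increasing; lra).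
  destruct (thresholds (c * ln 2 / 96)) as (th1 & th2 & z & Ht1 & Ht2 & Hz & Hz1 & Hz2 & Hzu).
  { apply Rdiv_lt_0_compat; [now apply Rmult_lt_0_compat|lra]. }
  pose proof (PT_size _ PT_ssm_input) as (kz & Hkz).
  destruct PT_ssm_input as (cs & Ts & Hcs & ks & Hks).
  destruct (sim_correct M) as (cm & km & Hcm).
  destruct (dfs_correct (split_cnf th1 th2) (fun w => normalize (parse w)) (Comp cm cs)
    (PT_split_cnf th1 th2) PT_normalize_parse) as (cd & kd & Hcd).
  destruct (code_to_TM cd) as (M' & K & HM').
  (* The simulation of [M] multiplies the rate of its running time by [km], the search by [kd]; [mu]
     anticipates both. The [+ 1] prevents division by zero. *)
  set (mu := c / (8 * (INR kd * INR km + 1))).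
  assert (Hkk : 0 <= INR kd * INR km) by (apply Rmult_le_pos; apply pos_INR).
  assert (Hmu : 0 < mu) by (apply Rdiv_lt_0_compat; lra).
  assert (Hmu' : INR kd * (INR km * mu) <= c / 8).
  { assert (mu * (8 * (INR kd * INR km + 1)) = c) by (unfold mu; field; lra). nra. }
  (* A leaf has at most [K0 * (n + 1)] numbers by [leaf_size], so [f] is compared with a line of
     slope [mu / K0]. *)
  set (K0 := (40 * (2 + th1 + th2))%nat).
  assert (HK0 : 0 < INR K0) by (apply lt_0_INR; unfold K0; lia).
  destruct (little_o_affine f (mu / INR K0) Hf) as (A & HA & HfA).
  { now apply Rdiv_lt_0_compat. }
  set (p1 := fun F => ((fsize F + 2) ^ kz)%nat).
  set (r := fun F => Rpower 2 (A + mu * (INR (sat_nvars F) + 1)) * (INR (p1 F) + 1) ^ k).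
  set (fmax := fun F => nat_ceil (r F)).
  set (TL := fun F => ((fsize F + 2) ^ ks + (p1 F + fmax F + 2) ^ km)%nat).
  set (big := fun F => ((6 * th1 * usize F + 1) * (fsize F + 1) + TL F + sz (enc_sat F) + 2)%nat).
  set (nodes := fun F => nat_ceil (2 * Rpower 2 (c / 8 * INR (sat_nvars F)))).
  set (time := fun F => ((nodes F + 1) * big F ^ kd + length (enc_sat F) + 1)%nat).
  assert (Htime : expb c (fun F => (K * time F * time F)%nat)).
  { assert (Hkm : 0 <= INR km * mu) by (apply Rmult_le_pos; [apply pos_INR|lra]).
    assert (Hp1 : expb 0 p1) by (apply (expb_poly0 _ fsize kz); [now unfold p1|apply expb_fsize]).
    assert (Hfmax : expb mu fmax).
    { assert (Hq : expb 0 (fun F => ((p1 F + 1) ^ k)%nat)).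
      { replace 0 with (INR k * 0) by ring. apply expb_pow, expb_add; [auto|apply expb_const; lra]. }
      destruct Hq as (C & j & HC & Hq).
      apply (expb_ceil mu r (Rpower 2 (A + mu) * C) j); [lra| |].
      { apply Rmult_le_pos; [left; apply Rpower2_pos|auto]. }
      intros F HF. specialize (Hq F HF). rewrite Rmult_0_l, Rpower_O, Rmult_1_r in Hq by lra.
      rewrite pow_INR, plus_INR in Hq. unfold r. cbn [INR] in Hq.
      assert (0 <= (INR (p1 F) + 1) ^ k) by (apply pow_le; pose proof (pos_INR (p1 F)); lra).
      pose proof (Rpower2_pos (A + mu * (INR (sat_nvars F) + 1))) as Hp.
      split; [apply Rmult_le_pos; lra|].
      replace (A + mu * (INR (sat_nvars F) + 1)) with (A + mu + mu * INR (sat_nvars F)) in * by ring.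
      rewrite Rpower_plus in *.
      eapply Rle_trans; [apply Rmult_le_compat_l; [lra|exact Hq]|]. right. ring. }
    assert (HTL : expb (INR km * mu) TL).
    { apply expb_add.
      - apply (expb_weaken 0); auto. apply (expb_poly0 _ fsize ks); [auto|apply expb_fsize].
      - apply expb_pow. repeat apply expb_add; [|auto|apply expb_const; lra].
        apply (expb_weaken 0); [lra|auto]. }
    assert (Hbig : expb (INR km * mu) big).
    { unfold big. apply expb_add; [|apply expb_const; auto].
      apply expb_add; [apply expb_add; [|auto]|].
      - apply (expb_weaken 0); auto.
        apply (expb_le _ _ (fun F => (6 * th1 * fsize F + 1) * (fsize F + 1))%nat).
        { intros F _. apply Nat.mul_le_mono_r. pose proof (usize_le_fsize F). nia. }
        pose proof expb_fsize as Hfs. replace 0 with (0 + 0) by ring.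
        apply expb_mul; (apply expb_add; [|apply expb_const; lra]); auto.
        replace 0 with (0 + 0) by ring. apply (expb_mul 0 0 (fun _ => (6 * th1)%nat)); auto.
        apply expb_const; lra.
      - apply (expb_weaken 0); [auto|apply expb_sz]. }
    assert (Hnodes : expb (c / 8) nodes).
    { apply (expb_ceil _ _ 2 0%nat); [lra|lra|]. intros F _. simpl.
      pose proof (Rpower2_pos (c / 8 * INR (sat_nvars F))). lra. }
    assert (Ht : expb (c / 4) time).
    { unfold time. repeat apply expb_add; [|apply expb_length; lra|apply expb_const; lra].
      apply (expb_weaken (c / 8 + INR kd * (INR km * mu))); [lra|].
      apply expb_mul; [apply expb_add; [auto|apply expb_const; lra]|now apply expb_pow]. }
    (* Nodes and work per node have rate [c / 8] each, so [time] has rate [c / 4]; squaring it for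
       one tape gives [c / 2], within [c]. *)
    apply (expb_weaken (0 + c / 4 + c / 4)); [lra|].
    apply (expb_mul (0 + c / 4) (c / 4) (fun F => (K * time F)%nat)); auto.
    apply (expb_mul 0 (c / 4) (fun _ => K)); [apply expb_const; lra|auto]. }
  destruct Htime as (C & j & _ & Htime).
  apply (HETH M' C j). intros F HF.
  assert (Hrun : exists b, evb cd (enc (enc_sat F)) (tbool b) ((nodes F + 1) * big F ^ kd)%nat
      /\ (b = true <-> satisfiable F)).
  { set (E0 := parse (enc_sat F)). set (U := universe E0).
    destruct (usize_spec F) as [HUl HUs]. fold E0 U in HUl, HUs.
    pose proof (vars_le_nvars F HF) as Hvn. fold E0 in Hvn.
    destruct (normalize_spec U E0 (valid_clauses F HF)) as [Hw Hsat].
    destruct (search_exists U th1 th2 (Comp cm cs) (fsize F) (TL F) z Ht1 Ht2 Hz Hz1 Hz2 HUs)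
      with (E := normalize E0) as (b & n & Hsearch & Hb & Hn); [|exact Hw|].
    (* At a leaf the reduction is written out and [M] simulated on it. Sparseness bounds the
       cardinality of the set linearly in the number of variables, and hence the running time of [M]
       by [r F]. *)
    { intros E HE Hsp.
      destruct (decider_on_instance M _ E U Hdec HE) as (s & b & Hs & Hr & Hb).
      exists b. split; auto.
      pose proof (HUs E HE) as HsE.
      assert (Hz' : (sz (ssm_input E) <= p1 F)%nat).
      { etransitivity; [apply Hkz|]. apply Nat.pow_le_mono_l. lia. }
      assert (Hsf : (s <= fmax F)%nat).
      { apply INR_le. apply Rle_trans with (r F).
        - eapply Rle_trans; [exact Hs|]. unfold r. rewrite enc_instance.
          apply Rmult_le_compat; [left; apply Rpower2_pos|apply pow_le; pose proof (pos_INR (length (ssm_input E))); lra| |].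
          + apply Rle_Rpower; [lra|]. eapply Rle_trans; [apply HfA|].
            apply Rplus_le_compat_l.
            pose proof (leaf_size E0 th1 th2 (sat_nvars F) E Hvn HE Hsp) as Hls. fold K0 in Hls.
            apply le_INR in Hls. rewrite mult_INR, plus_INR in Hls. cbn [INR] in Hls.
            assert (mu / INR K0 * (INR K0 * (INR (sat_nvars F) + 1)) = mu * (INR (sat_nvars F) + 1))
              as <- by (field; lra).
            apply Rmult_le_compat_l; [left; now apply Rdiv_lt_0_compat|exact Hls].
          + apply pow_incr. split; [pose proof (pos_INR (length (ssm_input E))); lra|].
            apply Rplus_le_compat_r, le_INR. pose proof (length_le_sz (ssm_input E)). lia.
        - apply nat_ceil_spec. apply Rmult_le_pos; [left; apply Rpower2_pos|].
          apply pow_le. pose proof (pos_INR (p1 F)). lra. }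
      eapply evb_weaken; [eapply evb_comp; [apply Hcs|apply (Hcm _ s b Hr)]|].
      unfold TL. apply Nat.add_le_mono.
      - etransitivity; [apply Hks|]. apply Nat.pow_le_mono_l. lia.
      - apply Nat.pow_le_mono_l. lia. }
    exists b. split; [|rewrite Hb, Hsat; now apply sat_parse].
    assert (Hpot : (potential U th1 (normalize E0) <= 6 * th1 * length U)%nat) by apply potential_le.
    eapply evb_weaken.
    (* The depth is bounded by the potential, which is polynomial in the length of the input, so the
       stack of pending formulas stays small. *)
    - apply (Hcd (enc_sat F) (fsize F) (TL F) b n (6 * th1 * usize F)%nat), Hsearch. nia.
    - unfold big. apply Nat.mul_le_mono_r. apply Nat.add_le_mono_r. apply INR_le.
      apply Rle_trans with (2 * Rpower 2 (c / 8 * INR (sat_nvars F))).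
      + pose proof (node_bound c z th1 (sat_nvars F) (length U) _ Hc Hz Hzu
          ltac:(unfold U; rewrite universe_length; lia) Hpot). lra.
      + apply nat_ceil_spec. pose proof (Rpower2_pos (c / 8 * INR (sat_nvars F))). lra. }
  destruct Hrun as (b & (t & Ht & Hev) & Hb).
  destruct (HM' (enc_sat F) _ t (enc_sat_nonblank F) Hev) as (s & Hs & Hr).
  exists s, b. split; [|split; [now rewrite truth_tbool in Hr|exact Hb]].
  eapply Rle_trans; [|apply Htime; exact HF]. apply le_INR.
  etransitivity; [exact Hs|]. unfold time. repeat apply Nat.mul_le_mono; lia.
Qed.
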